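(* Suppose that for every $t\in[0,1]$ the operator $\mathcal A_t$ is the self-adjoint extension of $A$ with $\mathrm{dom}(\mathcal A_t)=\{u\in\mathcal D:[X_t,Y_t]\mathrm T_tu=0\}$ and $$\overline{\mathrm T_t(\mathrm{dom}(\mathcal A_t))}=\mathrm{ran}(Q_t)=\ker([X_t,Y_t]),\quad X_t,Y_t\in\mathcal B(\mathfrak H),\quad X_tY_t^*=Y_tX_t^*,\quad 0\notin\mathrm{Spec}\begin{bmatrix}X_t&Y_t\\-Y_t&X_t\end{bmatrix}.$$ Then for $s,t\in[0,1]$ and $\zeta\notin\mathrm{Spec}(H_t)\cup\mathrm{Spec}(H_s)$, $$R_t(\zeta)-R_s(\zeta)=R_t(\zeta)(V_s-V_t)R_s(\zeta)+(\mathrm T_tR_t(\overline\zeta))^*Z_{t,s}\mathrm T_sR_s(\zeta)+(\mathrm T_tR_t(\overline\zeta))^*J(\mathrm T_t-\mathrm T_s)R_s(\zeta),$$ where $Z_{t,s}:=(W(X_t,Y_t))^*(X_tY_s^*-Y_tX_s^* )W(X_s,Y_s)\in\mathcal B(\mathfrak H\times\mathfrak H)$. Moreover, let $t_0\in[0,1]$. If $\|(\mathcal A_t-\mathbf i)^{-1}\|_{\mathcal B(\mathcal H,\mathcal D)}=\mathcal O(1)$ as $t\to t_0$ and $t\mapsto\mathrm T_t,V_t,X_t,Y_t$ are continuous at $t_0$ in the respective spaces of operators, then $t\mapsto R_t(\zeta_0)$ is continuous at $t=t_0$ for any $\zeta_0\notin\mathrm{Spec}(H_{t_0})$. Further, assume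 that $\|(\mathcal A_t-\mathbf i)^{-1}-(\mathcal A_{t_0}-\mathbf i)^{-1}\|_{\mathcal B(\mathcal H,\mathcal D)}=o(1)$ as $t\to t_0$ and that $t\mapsto\mathrm T_t,V_t,X_t,Y_t$ are differentiable at $t_0$. Then for $\zeta_0\notin\mathrm{Spec}(H_{t_0})$ the function $t\mapsto R_t(\zeta_0)$ is differentiable at $t=t_0$ and $$\dot R_{t_0}(\zeta_0)=-R_{t_0}(\zeta_0)\dot V_{t_0}R_{t_0}(\zeta_0)+(\mathrm T_{t_0}R_{t_0}(\overline{\zeta_0}))^*(W(X_{t_0},Y_{t_0}))^*(\dot X_{t_0}Y_{t_0}^*-\dot Y_{t_0}X_{t_0}^* )W(X_{t_0},Y_{t_0})\mathrm T_{t_0}R_{t_0}(\zeta_0)+(\mathrm T_{t_0}R_{t_0}(\overline{\zeta_0}))^*J\dot{\mathrm T}_{t_0}R_{t_0}(\zeta_0).$$ Furthermore (under the same differentiability assumptions), if $\lambda(t_0)\in\mathrm{Spec}(H_{t_0})$ is an isolated eigenvalue of multiplicity $m\ge1$, then there exist a choice of orthonormal eigenfunctions $\{u_j\}_{j=1}^m\subset\ker(H_{t_0}-\lambda(t_0))$ and a labeling $\{\lambda_j(t)\}_{j=1}^m$ of the eigenvalues of $H_t$ bifurcating from $\lambda(t_0)$, for $t$ near $t_0$, such that $$\dot\lambda_j(t_0)=\langle\dot V_{t_0}u_j,u_j\rangle_{\mathcal H}+\langle(X_{t_0}\dot Y_{t_0}^*-Y_{t_0}\dot X_{t_0}^* )\phi_j,\phi_j\rangle_{\mathfrak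 H}+\omega(\mathrm T_{t_0}u_j,\dot{\mathrm T}_{t_0}u_j),\quad1\le j\le m,$$ where $\phi_j=W(X_{t_0},Y_{t_0})\mathrm T_{t_0}u_j$, or, equivalently, $\phi_j$ is the unique vector in $\mathfrak H$ satisfying $\Gamma_{0t_0}u_j=-Y_{t_0}^*\phi_j$ and $\Gamma_{1t_0}u_j=X_{t_0}^*\phi_j$.
   Context: Inner products are linear in the first argument. $\mathcal H,\mathfrak H$ are complex separable Hilbert spaces; $A$ is a densely defined, closed, symmetric operator in $\mathcal H$ with equal (possibly infinite) deficiency indices; $\mathcal H_+:=\mathrm{dom}(A^* )$ carries the graph inner product $\langle u,v\rangle_{\mathcal H}+\langle A^*u,A^*v\rangle_{\mathcal H}$. $\mathcal D$ is a dense subspace of $\mathcal H_+$ with $\mathrm{dom}(A)\subset\mathcal D$, equipped with a Banach norm $\|\cdot\|_{\mathcal D}$ for which the embedding $\mathcal D\hookrightarrow\mathcal H_+$ is bounded. For each $t\in[0,1]$, the trace operator $\mathrm T_t=[\Gamma_{0t},\Gamma_{1t}]^\top\in\mathcal B(\mathcal D,\mathfrak H\times\mathfrak H)$ has dense range and satisfies $\langle A^*u,v\rangle_{\mathcal H}-\langle u,A^*v\rangle_{\mathcal H}=\langle\Gamma_{1t}u,\Gamma_{0t}v\rangle_{\mathfrak H}-\langle\Gamma_{0t}u,\Gamma_{1t}v\rangle_{\mathfrak H}$ for $u,v\in\mathcal D$. $J=\begin{bmatrix}0&I_{\mathfrak H}\\-I_{\mathfrak H}&0\end{bmatrix}$,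 $\omega(f,g)=\langle Jf,g\rangle_{\mathfrak H\times\mathfrak H}$; a subspace $\mathcal F\subset\mathfrak H\times\mathfrak H$ is Lagrangian if it equals $\{f:\omega(f,g)=0\ \forall g\in\mathcal F\}$. For each $t\in[0,1]$: $Q_t$ is an orthogonal projection in $\mathfrak H\times\mathfrak H$ with Lagrangian range; $\mathcal A_t$ is a self-adjoint extension of $A$ with $\mathrm{dom}(\mathcal A_t)\subset\mathcal D$; $V_t\in\mathcal B(\mathcal H)$ is self-adjoint; $H_t:=\mathcal A_t+V_t$, $R_t(\zeta):=(H_t-\zeta)^{-1}$. $[X,Y](f_1,f_2)^\top=Xf_1+Yf_2$ and $W(X,Y):=(XX^*+YY^* )^{-1}[-Y,X]\in\mathcal B(\mathfrak H\times\mathfrak H,\mathfrak H)$. Operators $\mathrm T_tR_t(\zeta)$ are viewed in $\mathcal B(\mathcal H,\mathfrak H\times\mathfrak H)$. Continuity and differentiability of $\mathrm T_t,V_t,X_t,Y_t$ are in the norms of $\mathcal B(\mathcal D,\mathfrak H\times\mathfrak H)$, $\mathcal B(\mathcal H)$, $\mathcal B(\mathfrak H)$, $\mathcal B(\mathfrak H)$, and that of $R_t(\zeta_0)$ in $\mathcal B(\mathcal H)$; the dot is the $t$-derivative. The eigenvalues of $H_t$ bifurcating from $\lambda(t_0)$ are the $m$ eigenvalues (with multiplicity) of $H_t$, $t$ near $t_0$, lying in a small disc centered at $\lambda(t_0)$ that contains no other point of $\mathrm{Spec}(H_{t_0})$; multiplicity $m$ is finite. *)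

(* Defs.v *)
From HB Require Import structures.
From mathcomp Require Import all_boot all_order all_algebra.
From mathcomp Require Import complex ring.
From mathcomp Require Import all_classical all_reals all_analysis.
Set Implicit Arguments.
Unset Strict Implicit.
Unset Printing Implicit Defensive.
Import Order.TTheory GRing.Theory Num.Theory.
Import numFieldNormedType.Exports.
Local Open Scope classical_set_scope.
Local Open Scope ring_scope.

HB.mixin Record CompleteNormedModule_isHilbert (R : realType) (V : Type)
    & CompleteNormedModule R[i] V := {
  hdot : {dot V for (@Num.conj R[i])} ;
  hnormE : forall u : V, `|u| ^+ 2 = hdot u u
}.

#[short(type="hilbertType")]
HB.structure Definition Hilbert (R : realType) :=
  {V of CompleteNormedModule R[i] V & CompleteNormedModule_isHilbert R V}.

Notation "''[' u , v ]" := (hdot u v) : ring_scope.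

(* The Hilbert direct sum. An alias is needed because the library equips the
   bare product type with the max norm. *)
Definition hprod (R : realType) (U V : hilbertType R) : Type := (U * V)%type.

Section HilbertProduct.
Variables (R : realType) (U V : hilbertType R).
Local Notation W := (hprod U V).

HB.instance Definition _ := GRing.Lmodule.copy W (U * V)%type.

Definition hprod_norm (w : W) : R[i] := sqrtC (`|w.1| ^+ 2 + `|w.2| ^+ 2).

Let nge0 (w : W) : 0 <= `|w.1| ^+ 2 + `|w.2| ^+ 2.
Proof. by rewrite addr_ge0// exprn_ge0. Qed.

Lemma hprod_norm_ge0 w : 0 <= hprod_norm w.
Proof. by rewrite sqrtC_ge0. Qed.

Lemma hprod_normK w : hprod_norm w ^+ 2 = `|w.1| ^+ 2 + `|w.2| ^+ 2.
Proof. exact: sqrtCK. Qed.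

Lemma hprod_ler_normD x y : hprod_norm (x + y) <= hprod_norm x + hprod_norm y.
Proof.
rewrite -(@ler_pXn2r _ 2)// ?nnegrE ?addr_ge0 ?hprod_norm_ge0//.
rewrite sqrrD !hprod_normK.
have h1 : `|x.1 + y.1| ^+ 2 <= (`|x.1| + `|y.1|) ^+ 2.
  by rewrite ler_pXn2r ?nnegrE ?addr_ge0// ler_normD.
have h2 : `|x.2 + y.2| ^+ 2 <= (`|x.2| + `|y.2|) ^+ 2.
  by rewrite ler_pXn2r ?nnegrE ?addr_ge0// ler_normD.
apply: le_trans (lerD h1 h2) _; rewrite !sqrrD.
have cs : `|x.1| * `|y.1| + `|x.2| * `|y.2| <= hprod_norm x * hprod_norm y.
  rewrite -(@ler_pXn2r _ 2)// ?nnegrE ?mulr_ge0 ?addr_ge0 ?mulr_ge0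
    ?hprod_norm_ge0//.
  rewrite exprMn !hprod_normK -subr_ge0.
  set a := `|x.1|; set b := `|x.2|; set c := `|y.1|; set d := `|y.2|.
  have -> : (a ^+ 2 + b ^+ 2) * (c ^+ 2 + d ^+ 2) - (a * c + b * d) ^+ 2
            = (a * d - b * c) ^+ 2 by ring.
  by rewrite -real_normK ?exprn_ge0// realB// realM ?ger0_real// /a /b /c /d.
have := lerD (lexx (`|x.1| ^+ 2 + `|x.2| ^+ 2 + (`|y.1| ^+ 2 + `|y.2| ^+ 2)))
  (lerD cs cs).
set a := `|x.1|; set b := `|x.2|; set c := `|y.1|; set d := `|y.2|.
set n := hprod_norm x * hprod_norm y => h.
by apply: le_trans (le_trans h _); rewrite le_eqVlt; apply/orP; left;
  apply/eqP; ring.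
Qed.

Lemma hprod_normrZ (l : R[i]) x : hprod_norm (l *: x) = `|l| * hprod_norm x.
Proof.
apply/eqP; rewrite -(@eqrXn2 _ 2)// ?mulr_ge0 ?hprod_norm_ge0//.
by rewrite exprMn !hprod_normK !normrZ !exprMn mulrDr.
Qed.

Lemma hprod_normr0_eq0 x : hprod_norm x = 0 -> x = 0.
Proof.
move=> /(congr1 (fun z => z ^+ 2)); rewrite hprod_normK expr0n/= => /eqP.
rewrite paddr_eq0 ?exprn_ge0// !expf_eq0/= !normr_eq0.
by case: x => a b /= /andP[/eqP-> /eqP->].
Qed.

HB.instance Definition _ := @Lmodule_isNormed.Build R[i] W hprod_norm
  hprod_ler_normD hprod_normrZ hprod_normr0_eq0.

Lemma hprod_normE (w : W) : `|w| ^+ 2 = `|w.1| ^+ 2 + `|w.2| ^+ 2.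
Proof. exact: hprod_normK. Qed.

Lemma hprod_norm_fst (w : W) : `|w.1| <= `|w|.
Proof. by rewrite -(@ler_pXn2r _ 2)// ?nnegrE// hprod_normE lerDl exprn_ge0. Qed.

Lemma hprod_norm_snd (w : W) : `|w.2| <= `|w|.
Proof. by rewrite -(@ler_pXn2r _ 2)// ?nnegrE// hprod_normE lerDr exprn_ge0. Qed.

Lemma hprod_norm_le (w : W) : `|w| <= `|w.1| + `|w.2|.
Proof.
rewrite -(@ler_pXn2r _ 2)// ?nnegrE ?addr_ge0//.
by rewrite hprod_normE sqrrD lerD2r lerDl mulrn_wge0 ?mulr_ge0.
Qed.

Lemma hprod_complete (F : set_system W) : ProperFilter F -> cauchy F -> cvg F.
Proof.
move=> FF /cauchyP Fc.
have c1 : cvg ((fun w : W => w.1) @ F).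
  apply: cauchy_cvg; apply: cauchy_exP => e e0.
  have [w Fw] := Fc _ e0; exists w.1.
  rewrite /= /fmap /=; apply: filterS Fw => x /=.
  rewrite -!ball_normE /= => h; apply: le_lt_trans h.
  exact: (hprod_norm_fst (w - x)).
have c2 : cvg ((fun w : W => w.2) @ F).
  apply: cauchy_cvg; apply: cauchy_exP => e e0.
  have [w Fw] := Fc _ e0; exists w.2.
  rewrite /= /fmap /=; apply: filterS Fw => x /=.
  rewrite -!ball_normE /= => h; apply: le_lt_trans h.
  exact: (hprod_norm_snd (w - x)).
apply/cvg_ex; exists ((lim ((fun w : W => w.1) @ F), lim ((fun w : W => w.2) @ F)) : W).
apply/cvgrPdist_lt => e e0.
have e20 : 0 < e / 2 by rewrite divr_gt0.
move/cvgrPdist_lt: c1 => /(_ _ e20) d1.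
move/cvgrPdist_lt: c2 => /(_ _ e20) d2.
apply: filterS2 d1 d2 => x x1 x2.
apply: le_lt_trans (hprod_norm_le _) _.
by rewrite [e]splitr; apply: ltrD.
Qed.

HB.instance Definition _ := Uniform_isComplete.Build W hprod_complete.

Definition hprod_dot (f g : W) : R[i] := '[f.1, g.1] + '[f.2, g.2].

Lemma hprod_dot_bilinear : bilinear_for
  (GRing.Scale.Law.clone _ _ ( *%R ) _)
  (GRing.Scale.Law.clone _ _ (@Num.conj R[i] \; *%R) _) hprod_dot.
Proof.
split=> w a u v; rewrite /hprod_dot /=.
  by rewrite !linearPl /= mulrDr; ring.
by rewrite !linearPr /= mulrDr; ring.
Qed.

HB.instance Definition _ := bilinear_isBilinear.Build R[i] W W R[i]
  (GRing.Scale.Law.clone _ _ ( *%R ) _)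
  (GRing.Scale.Law.clone _ _ (@Num.conj R[i] \; *%R) _) hprod_dot
  hprod_dot_bilinear.

Lemma hprod_dotC (f g : W) : hprod_dot f g = (-1) ^+ false * (hprod_dot g f)^*.
Proof.
rewrite /hprod_dot rmorphD /= mulrDr.
by rewrite (hermC hdot f.1) (hermC hdot f.2).
Qed.

HB.instance Definition _ :=
  isHermitianSesquilinear.Build R[i] W false (@Num.conj R[i]) hprod_dot
    hprod_dotC.

Lemma hprod_dotE (f : W) : `|f| ^+ 2 = hprod_dot f f.
Proof. by rewrite hprod_normE /hprod_dot -!hnormE. Qed.

Lemma hprod_dot_gt0 (f : W) : f != 0 -> 0 < hprod_dot f f.
Proof. by move=> f0; rewrite -hprod_dotE exprn_gt0// normr_gt0. Qed.

HB.instance Definition _ := isDotProduct.Build R[i] W hprod_dot hprod_dot_gt0.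

HB.instance Definition _ :=
  @CompleteNormedModule_isHilbert.Build R W hprod_dot hprod_dotE.

End HilbertProduct.

Section Operators.
Variable R : realType.
Local Notation C := R[i].

Definition separable (T : topologicalType) :=
  exists2 S : set T, countable S & dense S.

(* Norms of a normed module over R[i] live in R[i]; [rnorm] is the real value. *)
Definition rnorm (X : normedModType C) (x : X) : R := complex.Re `|x|.

(* Equal to +oo when f is unbounded. *)
Definition opnorm (X Y : normedModType C) (f : X -> Y) : \bar R :=
  ereal_sup [set (rnorm (f x))%:E | x in [set x : X | rnorm x <= 1]].

Definition bounded_operator (X Y : normedModType C) (f : X -> Y) :=
  linear f /\ (opnorm f < +oo)%E.

(* Adjoint of an everywhere defined bounded operator; it is obtained by choice,
   and its existence for bounded f is the Riesz representation theorem. *)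
Definition badj (U V : hilbertType R) (f : U -> V) : V -> U :=
  fun y => xget 0 [set x | forall u, '[f u, y] = '[u, x]].

Definition binv (X Y : normedModType C) (f : X -> Y) : Y -> X :=
  fun y => xget 0 [set x | f x = y].

(* A partially defined operator; only the values on [dom] are meaningful, and
   no definition below depends on the other ones. *)
Record operator (X : Type) := Operator { dom : set X ; app :> X -> X }.

Definition total_operator (X : Type) (f : X -> X) : operator X :=
  Operator setT f.

Definition linear_operator (X : lmodType C) (A : operator X) :=
  dom A 0 /\ forall (a : C) (u v : X), dom A u -> dom A v ->
    dom A (a *: u + v) /\ A (a *: u + v) = a *: A u + A v.

Definition extends (X : Type) (B A : operator X) :=
  forall u, dom A u -> dom B u /\ B u = A u.

Definition operator_add (X : lmodType C) (A : operator X) (V : X -> X) :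
  operator X := Operator (dom A) (fun u => A u + V u).

Definition graph (H : hilbertType R) (A : operator H) : set (hprod H H) :=
  [set p | dom A p.1 /\ p.2 = A p.1].

Definition closed_operator (H : hilbertType R) (A : operator H) :=
  closed (graph A).

(* Meaningful for densely defined A, for which [w] below is unique. *)
Definition adjoint (H : hilbertType R) (A : operator H) : operator H :=
  let rep v := [set w | forall u, dom A u -> '[A u, v] = '[u, w]] in
  Operator [set v | exists w, rep v w] (fun v => xget 0 (rep v)).

Definition symmetric_operator (H : hilbertType R) (A : operator H) :=
  forall u v, dom A u -> dom A v -> '[A u, v] = '[u, A v].

Definition selfadjoint (H : hilbertType R) (A : operator H) :=
  [/\ linear_operator A, dense (dom A),
      extends (adjoint A) A & extends A (adjoint A)].

Definition resolvent (X : normedModType C) (A : operator X) (z : C) : X -> X :=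
  fun x => xget 0 [set u | dom A u /\ A u - z *: u = x].

Definition spectrum (X : normedModType C) (A : operator X) : set C :=
  ~` [set z | (forall x, exists! u, dom A u /\ A u - z *: u = x)
              /\ bounded_operator (resolvent A z)].

Definition eigenkernel (X : lmodType C) (A : operator X) (z : C) : set X :=
  [set u | dom A u /\ A u = z *: u].

(* Dimension of a subspace, with value +oo for infinite dimensional ones. *)
Definition hdim (H : hilbertType R) (S : set H) : \bar R :=
  ereal_sup [set ((size s)%:R : R)%:E | s in
    [set s : seq H | orthonormal hdot s /\ forall u, u \in s -> S u]].

Definition deficiency (H : hilbertType R) (A : operator H) (z : C) : \bar R :=
  hdim (eigenkernel (adjoint A) z).

Definition orthogonal_projection (H : hilbertType R) (Q : H -> H) :=
  [/\ bounded_operator Q, forall f, Q (Q f) = Q f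
    & forall f g, '[Q f, g] = '[f, Q g]].

Definition isolated_eigenvalue (H : hilbertType R) (A : operator H) (l : R)
    (m : nat) :=
  [/\ spectrum A l%:C%C,
      exists2 r : R, 0 < r & forall z, spectrum A z ->
        `|z - l%:C%C| < r%:C%C -> z = l%:C%C
    & hdim (eigenkernel A l%:C%C) = (m%:R)%:E].

Section Symplectic.
Variable K : hilbertType R.

Definition Jop (f : hprod K K) : hprod K K := (f.2, - f.1).

Definition omega (f g : hprod K K) : C := '[Jop f, g].

Definition lagrangian (F : set (hprod K K)) :=
  F = [set f | forall g, F g -> omega f g = 0].

Definition row_op (X Y : K -> K) (f : hprod K K) : K := X f.1 + Y f.2.

Definition block_op (X Y : K -> K) (f : hprod K K) : hprod K K :=
  (X f.1 + Y f.2, - Y f.1 + X f.2).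

Definition Wop (X Y : K -> K) (f : hprod K K) : K :=
  binv (fun x => X (badj X x) + Y (badj Y x)) (row_op (fun x => - Y x) X f).

Definition Zop (Xt Yt Xs Ys : K -> K) (f : hprod K K) : hprod K K :=
  badj (Wop Xt Yt)
    (Xt (badj Ys (Wop Xs Ys f)) - Yt (badj Xs (Wop Xs Ys f))).

End Symplectic.

(* Limits in the parameter t are taken inside [0, 1], hence are one-sided at
   the end points. *)
Definition near01 (t0 : R) : set_system R := within [set` `[0, 1]] (nbhs t0).

Definition dnear01 (t0 : R) : set_system R := within [set` `[0, 1]] t0^'.

Definition op_cvg (X Y : normedModType C) (F : set_system R)
    (f : R -> X -> Y) (g : X -> Y) :=
  opnorm (fun x => f t x - g x) @[t --> F] --> 0%E.

Definition op_continuous (X Y : normedModType C) (f : R -> X -> Y) (t0 : R) :=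
  op_cvg (near01 t0) f (f t0).

Definition op_derivative (X Y : normedModType C) (f : R -> X -> Y) (t0 : R)
    (f' : X -> Y) :=
  bounded_operator f' /\
  op_cvg (dnear01 t0) (fun t x => ((t - t0)^-1)%:C%C *: (f t x - f t0 x)) f'.

(* [lam j t], j < m, list with multiplicity the eigenvalues of [Hf t] lying in
   any given disc around l0 containing no other point of the spectrum of
   [Hf t0], as soon as t is close enough to t0. *)
Definition bifurcating (H : hilbertType R) (Hf : R -> operator H) (t0 l0 : R)
    (m : nat) (lam : 'I_m -> R -> R) :=
  forall r : R, 0 < r ->
  (forall z, spectrum (Hf t0) z -> `|z - l0%:C%C| <= r%:C%C -> z = l0%:C%C) ->
  \forall t \near near01 t0,
    (forall j, `|lam j t - l0| <= r) /\
    forall z : C, `|z - l0%:C%C| <= r%:C%C ->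
      hdim (eigenkernel (Hf t) z)
      = (#|[set j : 'I_m | (lam j t)%:C%C == z]|%:R)%:E.

(* For an embedding [iD] of D into H, the element of D that underlies a vector
   of its range. *)
Definition unembed (X Y : normedModType C) (iD : X -> Y) : Y -> X := binv iD.

End Operators.

(* Main.v *)
(* Green's identity turns < H_s u, v > - < u, H_t v >, for u in dom H_s and
   v in dom H_t, into V_s - V_t plus the boundary term < J T_t u, T_t v >. Since
   ker [X, Y] is parametrized by phi |-> (- Y^* phi, X^* phi), with inverse W(X, Y),
   writing T_t u = T_s u + (T_t - T_s) u expresses the boundary term through
   X_t Y_s^* - Y_t X_s^*. Tested on resolvents this weak identity is the Krein formula.

   It also bounds the form difference by eps |u|_D |v|_D when the data are
   eps-close, where |.|_D on dom H_t is controlled by the graph norm through the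
   hypothesis on (A_t - i)^{-1}. Testing it against u = R_{t0}(conj z) g makes
   H_t - z bounded below near t0, which gives continuity of R_t(z), and then its
   derivative, both weakly and uniformly on unit vectors.

   For the eigenvalues take the real point z0 = l0 - d, with d so small that
   1/d is the top of the spectrum of R_{t0}(z0), isolated and of multiplicity m.
   The m top eigenvalues mu_j(t) of R_t(z0) exist by maximizing the quadratic form
   (a gap above the form on the complement makes maximizing sequences compact), and
   the Courant-Fischer principle compares them, up to o(t - t0), with the eigenvalues
   of 1/d + (t - t0) P R'(z0) P, P being the projection on ker (H_{t0} - l0); so
   lambda_j = z0 + 1 / mu_j is differentiable. *)
Require Import Defs.
From HB Require Import structures.
From mathcomp Require Import all_boot all_order all_algebra.
From mathcomp Require Import complex ring lra.
From mathcomp Require Import all_classical all_reals all_analysis.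
Set Implicit Arguments.
Unset Strict Implicit.
Unset Printing Implicit Defensive.
Import Order.TTheory GRing.Theory Num.Theory.
Import numFieldNormedType.Exports.
Local Open Scope classical_set_scope.
Local Open Scope ring_scope.

(** * Real-valued norms and operator bounds *)

(** The domains of the $H_t$ vary with $t$, so operators are never subtracted on a common domain:
    every comparison is weak, with $u$ in one domain and $v$ in the other, and norms are recovered
    by duality. The traces see the norm of $\mathcal D$, while resolvents are a priori bounded in
    $\mathcal H$; the closed graph theorem supplies the missing bound for each fixed $t$, and the
    hypothesis on $(\mathcal A_t-\mathbf i)^{-1}$ makes it uniform. Estimates compare one fixed
    datum with any datum at distance $e$, with constants independent of the latter; limits in $t$
    enter only at the end. No spectral calculus is used. A gap in the spectrum becomes a resolvent
    bound at its centre, then quadratic inequalities for a resolvent. The block of $R_t(z_0)$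
    between the eigenspace and its complement is $O(|t-t_0|)$ and enters the min-max bounds squared,
    so the first order sees the compression to the eigenspace alone. *)

Section ComplexModulus.
Variable R : realType.
Local Notation C := R[i].
Implicit Types z w : C.

Definition cabs z : R := complex.Re `|z|.

Lemma cabsE z : `|z| = (cabs z)%:C%C.
Proof.
have := normr_ge0 z; rewrite /cabs; case: `|z| => a b.
by rewrite lecE /= => /andP[/eqP -> _].
Qed.

Lemma cabs_ge0 z : 0 <= cabs z.
Proof. by rewrite -ler0c -cabsE. Qed.

Lemma cabsM z w : cabs (z * w) = cabs z * cabs w.
Proof. by apply: complexI; rewrite -cabsE normrM !cabsE rmorphM. Qed.

Lemma cabsR (a : R) : cabs a%:C%C = `|a|.
Proof. by rewrite /cabs normc_def /= expr0n addr0 sqrtr_sqr. Qed.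

Lemma cabsD z w : cabs (z + w) <= cabs z + cabs w.
Proof. by rewrite -lecR rmorphD /= -!cabsE ler_normD. Qed.

Lemma cabsN z : cabs (- z) = cabs z.
Proof. by rewrite /cabs normrN. Qed.

Lemma cabs_conj z : cabs z^* = cabs z.
Proof. by apply: complexI; rewrite -!cabsE norm_conjC. Qed.

Lemma Re_le_cabs z : complex.Re z <= cabs z.
Proof.
apply: le_trans (ler_norm _) _.
by rewrite -lecR -cabsE normc_ge_Re.
Qed.

Lemma cabs_eq0 z : cabs z = 0 -> z = 0.
Proof. by move=> h; apply/normr0_eq0; rewrite cabsE h. Qed.

Lemma cabs_sqr z : cabs z ^+ 2 = complex.Re z ^+ 2 + complex.Im z ^+ 2.
Proof. by apply: complexI; rewrite add_Re2_Im2 rmorphXn /= -cabsE. Qed.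

Lemma ReD z w : complex.Re (z + w) = complex.Re z + complex.Re w.
Proof. by case: z w => [a b] [c d]. Qed.

Lemma ReN z : complex.Re (- z) = - complex.Re z.
Proof. by case: z. Qed.

Lemma ReJ z : complex.Re z^* = complex.Re z.
Proof. by case: z. Qed.

Lemma ReZ (a : R) z : complex.Re (a%:C%C * z) = a * complex.Re z.
Proof. by case: z => c d /=; rewrite mul0r subr0. Qed.

Lemma conjR (a : R) : (a%:C%C)^* = a%:C%C :> C.
Proof. exact: conjc_real. Qed.

Lemma Im_Re_i z : complex.Im z = complex.Re ((-'i) * z).
Proof. by case: z => a b; rewrite /= oppr0 mul0r sub0r mulN1r opprK. Qed.

Lemma eq_complex_Re z w :
  (forall a, complex.Re (a * z) = complex.Re (a * w)) -> z = w.
Proof.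
move=> h; apply/eqP; rewrite eq_complex.
by have := h 1; rewrite !mul1r => ->; rewrite !Im_Re_i h !eqxx.
Qed.

Lemma cabs_phase z : exists2 a : C, cabs a = 1 & a * z = (cabs z)%:C%C.
Proof.
have [->|z0] := eqVneq z 0.
  by exists 1; rewrite ?mulr0 /cabs ?normr1 ?normr0.
exists (`|z| / z); last by rewrite divfK// cabsE.
by rewrite /cabs normrM normfV normr_id divff// normr_eq0.
Qed.

Lemma real_of_Im0 z : complex.Im z = 0 -> z = (complex.Re z)%:C%C.
Proof. by case: z => a b /= ->. Qed.

End ComplexModulus.

Section RealNorm.
Variable R : realType.
Local Notation C := R[i].
Variable X : normedModType C.
Implicit Types x y : X.

Lemma rnormE x : `|x| = (rnorm x)%:C%C.
Proof.
have := normr_ge0 x; rewrite /rnorm; case: `|x| => a b.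
by rewrite lecE /= => /andP[/eqP -> _].
Qed.

Lemma rnorm_ge0 x : 0 <= rnorm x.
Proof. by rewrite -ler0c -rnormE. Qed.

Lemma rnorm0 : rnorm (0 : X) = 0.
Proof. by rewrite /rnorm normr0. Qed.

Lemma rnorm_eq0 x : rnorm x = 0 -> x = 0.
Proof. by move=> h; apply/normr0_eq0; rewrite rnormE h. Qed.

Lemma rnorm_gt0 x : x != 0 -> 0 < rnorm x.
Proof.
by move=> x0; rewrite lt_neqAle rnorm_ge0 andbT eq_sym; apply: contra x0 => /eqP/rnorm_eq0 ->.
Qed.

Lemma rnormD x y : rnorm (x + y) <= rnorm x + rnorm y.
Proof. by rewrite -lecR rmorphD /= -!rnormE ler_normD. Qed.

Lemma rnormN x : rnorm (- x) = rnorm x.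
Proof. by rewrite /rnorm normrN. Qed.

Lemma rnormB x y : rnorm (x - y) <= rnorm x + rnorm y.
Proof. by rewrite -(rnormN y) rnormD. Qed.

Lemma rdistC x y : rnorm (x - y) = rnorm (y - x).
Proof. by rewrite -rnormN opprB. Qed.

Lemma rnormBt y x z : rnorm (x - z) <= rnorm (x - y) + rnorm (y - z).
Proof. by rewrite -[x - z](subrKA y) rnormD. Qed.

Lemma rnormZ a x : rnorm (a *: x) = cabs a * rnorm x.
Proof.
by apply: complexI; rewrite -rnormE normrZ rmorphM /= -rnormE -cabsE.
Qed.

Lemma rnormZR (a : R) x : rnorm (a%:C%C *: x) = `|a| * rnorm x.
Proof. by rewrite rnormZ cabsR. Qed.

Lemma rnorm_lt_eps x : (forall e, 0 < e -> rnorm x <= e) -> x = 0.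
Proof.
move=> h; apply: rnorm_eq0; apply/eqP; rewrite eq_le rnorm_ge0 andbT.
by apply/ler_addgt0Pr => e e0; rewrite add0r h.
Qed.

End RealNorm.

Lemma le_eps_mul (R : realType) (a b K : R) : 0 <= K ->
  (forall e, 0 < e -> a <= b + e * K) -> a <= b.
Proof.
move=> K0 h; apply/ler_addgt0Pr => e e0.
have K1 : 0 < K + 1 by rewrite ltr_wpDl.
apply: le_trans (h (e / (K + 1)) (divr_gt0 e0 K1)) _.
by rewrite lerD2l -mulrA [_^-1 * _]mulrC ler_piMr ?(ltW e0)// ler_pdivrMr ?mul1r ?lerDl.
Qed.

Lemma half_pow_lt (R : realType) (K e : R) : 0 < e -> exists n, K / 2 ^+ n < e.
Proof.
move=> e0; have [N _ /(_ N (leqnn _)) hN] :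
    \forall n \near \oo, `|0 - K * (2^-1) ^+ n| < e.
  have /cvgrPdist_lt/(_ _ e0) // : geometric K (2^-1) @ \oo --> (0 : R).
  by apply: cvg_geometric; rewrite ger0_norm// invf_lt1// ltr1n.
exists N; apply: le_lt_trans hN; rewrite sub0r normrN exprVn.
exact: ler_norm.
Qed.

(** First-variation argument: a parabola $s^2N-2sD$ that is nonnegative everywhere has no linear
    term. The test value $s=D/(N+1)$ gives $2(N+1)\le N$ unless $D=0$. *)
Lemma quadratic_le0 (R : realType) (D N : R) : 0 <= N -> (forall s, 2 * s * D <= s ^+ 2 * N) -> D = 0.
Proof.
move=> N0 var; have N1 : 0 < N + 1 by rewrite ltr_wpDl.
apply/eqP/negP => /negP D0; have D2 : 0 < D ^+ 2 by rewrite exprn_even_gt0.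
have := var (D / (N + 1)).
have -> : 2 * (D / (N + 1)) * D = D ^+ 2 * (2 / (N + 1)) by ring.
have -> : (D / (N + 1)) ^+ 2 * N = D ^+ 2 * (N / (N + 1) ^+ 2).
  by rewrite expr_div_n; ring.
rewrite ler_pM2l// ler_pdivlMr ?exprn_gt0// expr2 mulrA divfK ?gt_eqF//; lra.
Qed.

Section CauchyCompleteness.
Variable R : realType.
Local Notation C := R[i].
Variable X : completeNormedModType C.

(** Stated for filters because it serves sequences, the sets of near-minimizers in the Riesz
    argument and an ultrafilter of maximizing vectors. *)
Lemma rcauchy_cvg (F : set_system X) : ProperFilter F ->
  (forall e : R, 0 < e -> exists x, F [set y | rnorm (x - y) < e]) ->
  exists l, forall e : R, 0 < e -> F [set y | rnorm (l - y) < e].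
Proof.
move=> FF h.
have : cvg F.
  apply: cauchy_cvg; apply: cauchy_exP => e e0.
  (* Only real numbers are positive in the order of [R[i]]. *)
  have eE : e = (complex.Re e)%:C%C.
    by apply: real_of_Im0; move: e0; case: e => a b /=; rewrite ltcE /= => /andP[/eqP ->].
  have e0' : 0 < complex.Re e by rewrite -ltcR -eE.
  have [x Fx] := h _ e0'; exists x.
  rewrite -ball_normE /=; apply: filterS Fx => y /= hy.
  by rewrite rnormE eE ltcR.
case/cvg_ex => l lP; exists l => e e0.
have e0' : 0 < e%:C%C :> C by rewrite ltcR.
have lP' : F [set y | `|l - y| < e%:C%C] := (@cvgrPdist_lt _ _ _ F FF id l).1 lP _ e0'.
apply: filterS lP' => y /=.
by rewrite rnormE ltcR.
Qed.

Lemma geometric_cvg (s : nat -> X) (K : R) : 0 <= K ->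
  (forall n, rnorm (s n.+1 - s n) <= K / 2 ^+ n) ->
  exists l, forall n, rnorm (l - s n) <= 2 * K / 2 ^+ n.
Proof.
move=> K0 hs.
have tail n k : rnorm (s (n + k)%N - s n) <= 2 * K / 2 ^+ n.
  (* The induction on [k] needs the exact geometric remainder; dropping its negative term gives the
     claim. *)
  suff : rnorm (s (n + k)%N - s n) <= 2 * K / 2 ^+ n - 2 * K / 2 ^+ (n + k).
    by move/le_trans; apply; rewrite gerBl divr_ge0 ?mulr_ge0 ?exprn_ge0.
  elim: k => [|k IH]; first by rewrite addn0 !subrr rnorm0.
  apply: le_trans (rnormBt (s (n + k)%N) _ _) _.
  rewrite addnS; apply: le_trans (lerD (hs _) IH) _.
  rewrite exprS invfM.
  have -> : 2 * K * (2^-1 / 2 ^+ (n + k)) = K / 2 ^+ (n + k) by field; rewrite expf_neq0.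
  by rewrite le_eqVlt; apply/orP; left; apply/eqP; field; rewrite !expf_neq0.
have [l hl] : exists l, forall e : R, 0 < e -> (s @ \oo) [set y | rnorm (l - y) < e].
  apply: rcauchy_cvg => e e0; have [n hn] := half_pow_lt (2 * K) e0.
  exists (s n); exists n => // m /= nm; rewrite rdistC -(subnKC nm).
  by apply: le_lt_trans hn; apply: tail.
exists l => n; apply/ler_addgt0Pr => e e0.
have [N _ hN] := hl e e0.
have := hN (n + N)%N (leq_addl _ _) => /= h.
by apply: le_trans (rnormBt (s (n + N)%N) _ _) _; rewrite addrC lerD ?tail// ltW.
Qed.

End CauchyCompleteness.

Section LinearMaps.
Variable R : realType.
Local Notation C := R[i].
Variables (X Y : lmodType C) (f : X -> Y).
Hypothesis lf : linear f.

Lemma linear_map0 : f 0 = 0.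
Proof. by have := lf 1 0 0; rewrite !scale1r addr0 => /(congr1 (fun z => z - f 0)); rewrite subrr addrK. Qed.

Lemma linear_mapD x y : f (x + y) = f x + f y.
Proof. by have := lf 1 x y; rewrite !scale1r. Qed.

Lemma linear_mapZ a x : f (a *: x) = a *: f x.
Proof. by have := lf a x 0; rewrite linear_map0 !addr0. Qed.

Lemma linear_mapN x : f (- x) = - f x.
Proof. by rewrite -scaleN1r linear_mapZ scaleN1r. Qed.

Lemma linear_mapB x y : f (x - y) = f x - f y.
Proof. by rewrite linear_mapD linear_mapN. Qed.

End LinearMaps.

Section BoundedOperators.
Variable R : realType.
Local Notation C := R[i].
Implicit Types X Y : normedModType C.

(** Real constants in place of the extended real [opnorm]: all estimates are made with [opbound],
    and [opnorm_le] and [op_cvgP] translate them back. *)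
Definition opbound X Y (f : X -> Y) (M : R) :=
  forall x, rnorm (f x) <= M * rnorm x.

Lemma opnorm_le X Y (f : X -> Y) (M : R) : linear f -> 0 <= M ->
  (opnorm f <= M%:E)%E <-> opbound f M.
Proof.
move=> lf M0; split=> [h x|h].
  have [->|x0] := eqVneq x 0; first by rewrite (linear_map0 lf) !rnorm0 mulr0.
  have nx := rnorm_gt0 x0.
  have : ((rnorm (f ((rnorm x)^-1%:C%C *: x)))%:E <= M%:E)%E.
    apply: le_trans h; apply: ereal_sup_ubound; eexists; last reflexivity.
    by rewrite /= rnormZR ger0_norm ?invr_ge0 ?rnorm_ge0// mulVf// gt_eqF.
  rewrite lee_fin (linear_mapZ lf) rnormZR ger0_norm ?invr_ge0 ?rnorm_ge0//.
  by rewrite mulrC ler_pdivrMr.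
apply: ge_ereal_sup => _ [x /= x1 <-]; rewrite lee_fin.
by apply: le_trans (h x) _; rewrite ler_piMr.
Qed.

Lemma opnorm_ge0 X Y (f : X -> Y) : linear f -> (0%:E <= opnorm f)%E.
Proof.
move=> lf; apply: ereal_sup_ubound; exists 0; rewrite /= ?rnorm0//.
by rewrite (linear_map0 lf) rnorm0.
Qed.

Lemma bounded_operatorP X Y (f : X -> Y) :
  bounded_operator f <-> linear f /\ exists2 M, 0 <= M & opbound f M.
Proof.
split=> [[lf h]|[lf [M M0 h]]]; split=> //.
  have := opnorm_ge0 lf; move: h; case E : (opnorm f) => [M||]// _.
  by rewrite lee_fin => M0; exists M => //; apply/opnorm_le => //; rewrite E.
by apply: le_lt_trans (ltry M); apply/opnorm_le.
Qed.

Lemma opboundW X Y (f : X -> Y) M M' : M <= M' -> opbound f M -> opbound f M'.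
Proof. by move=> MM h x; apply: le_trans (h x) _; rewrite ler_wpM2r ?rnorm_ge0. Qed.

Lemma bounded_linear X Y (f : X -> Y) : bounded_operator f -> linear f.
Proof. by case. Qed.

(** Linearity turns the supremum over the unit ball into a homogeneous bound. *)
Lemma op_cvgP X Y (F : set_system R) (f : R -> X -> Y) (g : X -> Y) :
  Filter F -> (\forall t \near F, linear (fun x => f t x - g x)) ->
  op_cvg F f g <->
  forall e, 0 < e -> \forall t \near F, opbound (fun x => f t x - g x) e.
Proof.
move=> FF lf; split=> [h e e0|h].
  have h1 : \forall t \near F, (opnorm (fun x => f t x - g x)%R < e%:E)%E.
    apply: (h [set x : \bar R | (x < e%:E)%E]).
    by apply: open_nbhs_nbhs; split; [exact: open_ereal_lt_ereal|rewrite /= lte_fin].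
  apply: filterS2 lf h1 => t lt /ltW h1.
  by apply/opnorm_le => //; exact: ltW.
rewrite /op_cvg => A /= /nbhs_EFin/nbhs_ballP[d' /= d0' dA'].
have d0 : 0 < d' / 2 by rewrite divr_gt0.
have dA (x : \bar R) : (0%:E <= x)%E -> (x <= (d' / 2)%R%:E)%E -> A x.
  case: x => [r||]//; rewrite !lee_fin => r0 rd; apply: dA' => /=.
  by rewrite -ball_normE /= sub0r normrN ger0_norm//; lra.
have hd := h _ d0.
apply: filterS2 lf hd => t lt ht; apply: dA; first exact: opnorm_ge0.
by apply/opnorm_le => //; exact: ltW.
Qed.

End BoundedOperators.

(** * Riesz representation and adjoints *)

Section InnerProduct.
Variable R : realType.
Local Notation C := R[i].
Variable H : hilbertType R.
Implicit Types x y z : H.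

Lemma dotDl x y z : '[x + y, z] = '[x, z] + '[y, z].
Proof. exact: linearDl. Qed.
Lemma dotDr x y z : '[x, y + z] = '[x, y] + '[x, z].
Proof. exact: linearDr. Qed.
Lemma dotNl x y : '[- x, y] = - '[x, y].
Proof. exact: linearNl. Qed.
Lemma dotNr x y : '[x, - y] = - '[x, y].
Proof. exact: linearNr. Qed.
Lemma dotBl x y z : '[x - y, z] = '[x, z] - '[y, z].
Proof. exact: linearBl. Qed.
Lemma dotBr x y z : '[x, y - z] = '[x, y] - '[x, z].
Proof. exact: linearBr. Qed.
Lemma dotZl a x y : '[a *: x, y] = a * '[x, y].
Proof. by rewrite linearZl_LR. Qed.
Lemma dotZr a x y : '[x, a *: y] = a^* * '[x, y].
Proof. by rewrite linearZr_LR. Qed.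
Lemma dot0l x : '[0, x] = 0.
Proof. by rewrite linear0l. Qed.
Lemma dot0r x : '[x, 0] = 0.
Proof. by rewrite linear0r. Qed.
Lemma dotC x y : '[x, y] = ('[y, x])^*.
Proof. by rewrite (hermC hdot x) /= expr0 mul1r. Qed.
Lemma dotE x : '[x, x] = (rnorm x ^+ 2)%:C%C.
Proof. by rewrite -hnormE rnormE rmorphXn. Qed.

(** Order estimates need a real pairing; complex bounds are recovered by rotating the phase of one
    argument, as in [cabs_dot_le]. *)
Definition rdot x y : R := complex.Re '[x, y].

Lemma rdotC x y : rdot x y = rdot y x.
Proof. by rewrite /rdot dotC ReJ. Qed.
Lemma rdotDl x y z : rdot (x + y) z = rdot x z + rdot y z.
Proof. by rewrite /rdot dotDl ReD. Qed.
Lemma rdotDr x y z : rdot z (x + y) = rdot z x + rdot z y.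
Proof. by rewrite /rdot dotDr ReD. Qed.
Lemma rdotNl x y : rdot (- x) y = - rdot x y.
Proof. by rewrite /rdot dotNl ReN. Qed.
Lemma rdotNr x y : rdot x (- y) = - rdot x y.
Proof. by rewrite /rdot dotNr ReN. Qed.
Lemma rdotBl x y z : rdot (x - y) z = rdot x z - rdot y z.
Proof. by rewrite rdotDl rdotNl. Qed.
Lemma rdotBr x y z : rdot z (x - y) = rdot z x - rdot z y.
Proof. by rewrite rdotDr rdotNr. Qed.
Lemma rdotZl (a : R) x y : rdot (a%:C%C *: x) y = a * rdot x y.
Proof. by rewrite /rdot dotZl ReZ. Qed.
Lemma rdotZr (a : R) x y : rdot x (a%:C%C *: y) = a * rdot x y.
Proof. by rewrite rdotC rdotZl rdotC. Qed.
Lemma rdot0l x : rdot 0 x = 0.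
Proof. by rewrite /rdot dot0l. Qed.
Lemma rdot0r x : rdot x 0 = 0.
Proof. by rewrite /rdot dot0r. Qed.
Lemma rdotxx x : rdot x x = rnorm x ^+ 2.
Proof. by rewrite /rdot dotE. Qed.

Lemma rnorm_sqrD x y :
  rnorm (x + y) ^+ 2 = rnorm x ^+ 2 + 2 * rdot x y + rnorm y ^+ 2.
Proof. by rewrite -!rdotxx !rdotDl !rdotDr (rdotC y x); ring. Qed.

Lemma rnorm_sqrB x y :
  rnorm (x - y) ^+ 2 = rnorm x ^+ 2 - 2 * rdot x y + rnorm y ^+ 2.
Proof. by rewrite rnorm_sqrD rdotNr rnormN; ring. Qed.

Lemma rdot_le x y : rdot x y <= rnorm x * rnorm y.
Proof.
have [->|x0] := eqVneq x 0; first by rewrite rdot0l rnorm0 mul0r.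
have [->|y0] := eqVneq y 0; first by rewrite rdot0r rnorm0 mulr0.
(* Cauchy-Schwarz: the square expands to $2\|x\|\|y\|(\|x\|\|y\|-\mathrm{Re}\langle x,y\rangle)$. *)
have h := sqr_ge0 (rnorm ((rnorm y)%:C%C *: x - (rnorm x)%:C%C *: y)).
rewrite rnorm_sqrB !rnormZR rdotZl rdotZr !ger0_norm ?rnorm_ge0// in h.
have p : 0 < rnorm x * rnorm y by rewrite mulr_gt0 ?rnorm_gt0.
rewrite -(ler_pM2l p); move: h; lra.
Qed.

Lemma cabs_dot_le x y : cabs '[x, y] <= rnorm x * rnorm y.
Proof.
have [a a1 aE] := cabs_phase '[x, y].
have -> : cabs '[x, y] = rdot (a *: x) y by rewrite /rdot dotZl aE.
by apply: le_trans (rdot_le _ _) _; rewrite rnormZ a1 mul1r.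
Qed.

Lemma rdot_abs_le x y : `|rdot x y| <= rnorm x * rnorm y.
Proof.
rewrite ler_norml rdot_le andbT.
by rewrite lerNl -rdotNl (le_trans (rdot_le _ _))// rnormN.
Qed.

Lemma dot_inj x y : (forall z, '[z, x] = '[z, y]) -> x = y.
Proof.
move=> h; apply/eqP; rewrite -subr_eq0; apply/eqP/rnorm_eq0/eqP.
by rewrite -sqrf_eq0 -rdotxx /rdot dotBr h subrr.
Qed.

(** Duality: turns weak estimates, tested against every [y], into norm estimates of resolvents. *)
Lemma rnorm_le_rdot x (M : R) : 0 <= M -> (forall y, rdot x y <= M * rnorm y) -> rnorm x <= M.
Proof.
move=> M0 h; have [->|x0] := eqVneq x 0; first by rewrite rnorm0.
by have := h x; rewrite rdotxx expr2 ler_pM2r// rnorm_gt0.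
Qed.

Lemma parallelogram x y :
  rnorm (x + y) ^+ 2 + rnorm (x - y) ^+ 2 = 2 * rnorm x ^+ 2 + 2 * rnorm y ^+ 2.
Proof. by rewrite rnorm_sqrB rnorm_sqrD; ring. Qed.

End InnerProduct.

Section Riesz.
Variable R : realType.
Local Notation C := R[i].
Variables (H : hilbertType R) (L : lmodType C) (P : set L).
Variables (g : L -> H) (phi : L -> C) (M : R).
Hypothesis P0 : P 0.
Hypothesis Plin : forall a u v, P u -> P v -> [/\ P (a *: u + v),
  g (a *: u + v) = a *: g u + g v & phi (a *: u + v) = a * phi u + phi v].
Hypothesis phiM : forall u, P u -> cabs (phi u) <= M * rnorm (g u).

(** The functional [phi] lives on [P] but is measured through [g]. Three cases are used: [g] the
    identity, for adjoints; [g] equal to $A-\bar z$ on [dom A], for the surjectivity of $A-z$; and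
    [g] a bounded operator, for the orthogonal projection onto the closure of its range. *)
Let energy u : R := rnorm (g u) ^+ 2 - 2 * complex.Re (phi u).

Let g0 : g 0 = 0.
Proof.
by have [_ + _] := Plin (-1) P0 P0; rewrite scaleN1r oppr0 addr0 scaleN1r addNr.
Qed.

Let phi0 : phi 0 = 0.
Proof.
by have [_ _] := Plin (-1) P0 P0; rewrite scaleN1r oppr0 addr0 mulN1r addNr.
Qed.

Let PZ a u : P u -> [/\ P (a *: u), g (a *: u) = a *: g u & phi (a *: u) = a * phi u].
Proof. by move=> Pu; have := Plin a Pu P0; rewrite g0 phi0 !addr0. Qed.

(* The energy |g u|^2 - 2 Re (phi u) is bounded below and strictly convex, so
   its minimizing sequences are Cauchy; w is the limit of such a sequence. *)
Lemma riesz_subspace : exists w : H,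
  (forall u, P u -> phi u = '[g u, w]) /\
  forall e, 0 < e -> exists2 u, P u & rnorm (w - g u) < e.
Proof.
have lbE u : P u -> - M ^+ 2 <= energy u.
  move=> Pu; have := phiM Pu; have := Re_le_cabs (phi u).
  rewrite /energy => h1 h2.
  have := sqr_ge0 (rnorm (g u) - M); lra.
pose A := energy @` P.
have Ainf : has_inf A.
  split; first by exists (energy 0), 0.
  by exists (- M ^+ 2) => _ [u Pu <-]; exact: lbE.
pose d := inf A.
have dE u : P u -> d <= energy u by move=> Pu; apply: ge_inf; [case: Ainf|exists u].
pose B (e : R) := g @` [set u | P u /\ energy u < d + e].
have Bne e : 0 < e -> exists2 u, P u & energy u < d + e.
  move=> e0; have := @inf_adherent _ A e e0 Ainf.
  by case=> _ [u Pu <-] h; exists u.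
pose F := filter_from [set e : R | 0 < e] B.
have FF : ProperFilter F.
  apply: filter_from_proper; last first.
    by move=> e /= e0; have [u Pu hu] := Bne e e0; exists (g u), u.
  apply: filter_from_filter; first by exists 1 => /=.
  move=> a b /= a0 b0; exists (Num.min a b); first by rewrite /= lt_min a0.
  move=> _ [u [Pu hu] <-]; split; exists u => //; split => //.
    by apply: lt_le_trans hu _; rewrite lerD2l ge_min lexx.
  by apply: lt_le_trans hu _; rewrite lerD2l ge_min lexx orbT.
(* The midpoint of two near-minimizers has energy at least [d]; the parallelogram law then bounds
   their distance. *)
have close u v e : P u -> P v -> energy u < d + e -> energy v < d + e ->
    rnorm (g u - g v) ^+ 2 <= 4 * e.
  move=> Pu Pv hu hv.
  have [Pm gm pm] := Plin 1 Pu Pv; have [Ph gh ph] := PZ (2^-1)%:C%C Pm.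
  have := dE _ Ph; rewrite /energy gh ph gm pm !scale1r mul1r rnormZR ReZ ReD.
  rewrite ger0_norm ?invr_ge0// exprMn.
  move: hu hv; rewrite /energy; have := parallelogram (g u) (g v).
  lra.
have [w hw] : exists w, forall e : R, 0 < e -> F [set y | rnorm (w - y) < e].
  apply: rcauchy_cvg => e e0; have e2 : 0 < e ^+ 2 / 8 by rewrite divr_gt0// exprn_gt0.
  have [u Pu hu] := Bne _ e2; exists (g u), (e ^+ 2 / 8) => // _ [v [Pv hv] <-] /=.
  rewrite -(@ltr_pXn2r _ 2)// ?nnegrE ?rnorm_ge0 ?(ltW e0)//.
  apply: le_lt_trans (close _ _ _ Pu Pv hu hv) _.
  by have := exprn_gt0 2 e0; lra.
have near e a : 0 < e -> 0 < a ->
    exists u, [/\ P u, rnorm (w - g u) < e & energy u < d + a].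
  move=> e0 a0; have [b /= b0 hb] := hw e e0.
  have ab : 0 < Num.min a b by rewrite lt_min a0.
  have [u Pu hu] := Bne _ ab; exists u; split => //.
    apply: hb; exists u => //; split => //.
    by apply: lt_le_trans hu _; rewrite lerD2l ge_min lexx orbT.
  by apply: lt_le_trans hu _; rewrite lerD2l ge_min lexx.
exists w; split; last first.
  by move=> e e0; have [u [Pu hu _]] := near e 1 e0 ltr01; exists u.
have main v : P v -> complex.Re (phi v) = rdot (g v) w.
  move=> Pv; set D := complex.Re (phi v) - rdot (g v) w.
  set N := rnorm (g v) ^+ 2.
  have N0 : 0 <= N by rewrite exprn_ge0 ?rnorm_ge0.
  (* The energy of $u+sv$ is at least [d] for every near-minimizer [u]; letting the defect of [u]
     tend to 0 gives the variational inequality at the limit [w]. *)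
  have var s : 2 * s * D <= s ^+ 2 * N.
    apply: (@le_eps_mul _ _ _ (1 + 2 * `|s| * rnorm (g v))).
      by rewrite addr_ge0// !mulr_ge0 ?rnorm_ge0.
    move=> e e0; have [u [Pu hu hE]] := near e e e0 e0.
    have [Pw gw pw] := Plin s%:C%C Pv Pu.
    have := dE _ Pw; rewrite /energy gw pw ReD ReZ rnorm_sqrD rdotZl rnormZR exprMn.
    rewrite -normrX ger0_norm ?sqr_ge0//.
    move: hE; rewrite /energy => hE h.
    have k1 : `|rdot (g v) w - rdot (g v) (g u)| <= rnorm (g v) * e.
      rewrite -rdotBr; apply: le_trans (rdot_abs_le _ _) _.
      by rewrite ler_wpM2l ?rnorm_ge0// ltW.
    have k2 : - (s * (rdot (g v) w - rdot (g v) (g u))) <= `|s| * (rnorm (g v) * e).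
      apply: le_trans (ler_norm _) _; rewrite normrN normrM.
      by apply: ler_wpM2l.
    by move: h hE k2; rewrite /D /N; lra.
  by apply/eqP; rewrite -subr_eq0; apply/eqP; exact: quadratic_le0 N0 var.
move=> u Pu; apply: eq_complex_Re => a.
by have [Pa ga <-] := PZ a Pu; rewrite main// ga /rdot dotZl.
Qed.

End Riesz.

Section Adjoint.
Variable R : realType.
Local Notation C := R[i].
Variables (U V : hilbertType R) (f : U -> V).
Hypothesis bf : bounded_operator f.

Lemma badjP u y : '[f u, y] = '[u, badj f y].
Proof.
move: u; apply: (@xgetPex _ 0 [set x | forall u, '[f u, y] = '[u, x]]).
have [lf [M M0 fM]] := (bounded_operatorP f).1 bf.
have [] := @riesz_subspace R U U setT id (fun u => '[f u, y]) (M * rnorm y) I.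
- move=> a u v _ _; split => //.
  by rewrite (linear_mapD lf) (linear_mapZ lf) dotDl dotZl.
- move=> u _; apply: le_trans (cabs_dot_le _ _) _.
  by rewrite mulrAC ler_wpM2r ?rnorm_ge0.
- by move=> w [h _]; exists w => u; apply: h.
Qed.

Lemma badjP' u y : '[y, f u] = '[badj f y, u].
Proof. by rewrite dotC badjP -dotC. Qed.

Lemma badj_unique (h : V -> U) : (forall u y, '[f u, y] = '[u, h y]) -> badj f =1 h.
Proof. by move=> hh y; apply: dot_inj => u; rewrite -badjP hh. Qed.

Lemma badj_linear : linear (badj f).
Proof.
move=> a x y; apply: dot_inj => u.
by rewrite -badjP dotDr dotZr !badjP dotDr dotZr.
Qed.

Lemma badj_opbound M : 0 <= M -> opbound f M -> opbound (badj f) M.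
Proof.
move=> M0 fM y; apply: rnorm_le_rdot; first by rewrite mulr_ge0 ?rnorm_ge0.
move=> u; rewrite rdotC /rdot -badjP; apply: le_trans (rdot_le _ _) _.
by rewrite mulrAC ler_wpM2r ?rnorm_ge0.
Qed.

Lemma badj_bounded : bounded_operator (badj f).
Proof.
have [lf [M M0 fM]] := (bounded_operatorP f).1 bf.
apply/bounded_operatorP; split; first exact: badj_linear.
by exists M => //; exact: badj_opbound.
Qed.

End Adjoint.

(** * Closed graph theorem *)

Section ClosedGraph.
Variable R : realType.
Local Notation C := R[i].
Variables (X Y : completeNormedModType C) (Z : normedModType C).
Variables (G : X -> Y) (i : Y -> Z).
Hypothesis lG : linear G.

(** Linearizes a ball estimate: [h] is rescaled to length [r / 2] and translated to [h0], and the
    approximant of [h0] itself is subtracted from that of the translate, which at most doubles the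
    bound [n]. *)
Let scale_approx (n : nat) (h0 : X) (r : R) : 0 < r ->
  (forall h, rnorm (h - h0) < r -> forall e, 0 < e ->
    exists2 h', rnorm (h - h') < e & rnorm (G h') <= n%:R) ->
  forall h e, 0 < e -> exists2 h', rnorm (h - h') < e &
    rnorm (G h') <= 4 * n%:R / r * rnorm h.
Proof.
move=> r0 A h e e0; have [->|h_neq0] := eqVneq h 0.
  by exists 0; rewrite ?(linear_map0 lG) ?subrr !rnorm0 ?mulr0.
have hn := rnorm_gt0 h_neq0; set s := 2 * rnorm h / r.
have s0 : 0 < s by rewrite divr_gt0// mulr_gt0.
have es : 0 < e / (2 * s) by rewrite divr_gt0// mulr_gt0.
have [|a ha Ga] := A (h0 + s^-1%:C%C *: h) _ _ es.
  rewrite addrC addKr rnormZR ger0_norm ?invr_ge0 ?(ltW s0)//.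
  have -> : s^-1 * rnorm h = r / 2 by rewrite /s; field; rewrite !gt_eqF.
  lra.
have [|b hb Gb] := A h0 _ _ es; first by rewrite subrr rnorm0.
exists (s%:C%C *: (a - b)).
  have -> : h - s%:C%C *: (a - b)
      = s%:C%C *: ((h0 + s^-1%:C%C *: h - a) - (h0 - b)).
    have hu : h = s%:C%C *: (s^-1%:C%C *: h).
      by rewrite scalerA -rmorphM /= divff ?gt_eqF// scale1r.
    rewrite {1}hu -scalerBr; congr (_ *: _).
    rewrite !opprB [h0 + _]addrC -!addrA; congr (_ + _).
    by rewrite addrCA [h0 + (b - h0)]addrCA subrr addr0 addrC.
  rewrite rnormZR ger0_norm ?(ltW s0)//.
  apply: le_lt_trans (ler_wpM2l (ltW s0) (rnormB _ _)) _.
  have -> : e = s * (e / (2 * s) + e / (2 * s)) by field; rewrite gt_eqF.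
  by rewrite ltr_pM2l// ltrD.
rewrite (linear_mapZ lG) (linear_mapB lG) rnormZR ger0_norm ?(ltW s0)//.
apply: le_trans (ler_wpM2l (ltW s0) (le_trans (rnormB _ _) (lerD Ga Gb))) _.
by rewrite /s le_eqVlt; apply/orP; left; apply/eqP; field; rewrite gt_eqF.
Qed.

(* Baire's theorem for the sets [|G h| <= n], by nested balls. *)
Let baire : exists (n : nat) (h0 : X) (r : R), 0 < r /\
  forall h, rnorm (h - h0) < r -> forall e, 0 < e ->
    exists2 h', rnorm (h - h') < e & rnorm (G h') <= n%:R.
Proof.
apply: contrapT => no.
(* The condition on the radius sits under the existential so that [choice] yields a total function.
   The new closed ball lies in the old one and avoids the vectors with $\|Gh'\|\le n$. *)
have step (p : nat * (X * R)) : exists q : X * R, 0 < p.2.2 ->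
    [/\ 0 < q.2, q.2 <= p.2.2 / 2, rnorm (q.1 - p.2.1) <= p.2.2 / 2
      & forall h', rnorm (q.1 - h') <= q.2 -> p.1%:R < rnorm (G h')].
  case: p => n [h0 r] /=; have [r0|r0] := pselect (0 < r); last by exists (h0, r).
  apply: contrapT => no'; apply: no; exists n, h0, (r / 2); split.
    by rewrite divr_gt0.
  move=> h hh e e0; apply: contrapT => no; apply: no'.
  exists (h, Num.min (e / 2) (r / 2)) => _ /=; split.
  - by rewrite lt_min !divr_gt0.
  - by rewrite ge_min lexx orbT.
  - exact: ltW.
  - move=> h'; rewrite le_min => /andP[he _]; rewrite ltNge; apply/negP => hn.
    apply: no; exists h' => //; apply: le_lt_trans he _; lra.
have [f fP] := choice step.
pose s := fix s n := if n is k.+1 then f (k, s k) else (0 : X, 1 : R).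
have s0 n : 0 < (s n).2 by elim: n => [|n IH]//=; have [] := fP (n, s n) IH.
have sP n := fP (n, s n) (s0 n).
have spow n : (s n).2 <= 1 / 2 ^+ n.
  elim: n => [|n IH]; first by rewrite expr0 divr1.
  have [_ h _ _] := sP n; apply: le_trans h _; rewrite exprSr invfM mulrA.
  by rewrite ler_wpM2r ?invr_ge0.
have [l hl] : exists l, forall n, rnorm (l - (s n).1) <= 2 * 2^-1 / 2 ^+ n.
  apply: geometric_cvg => [|n]; first by rewrite invr_ge0.
  have [_ _ h _] := sP n; apply: le_trans h _.
  by rewrite /= mulrC ler_wpM2l ?invr_ge0//; have := spow n; rewrite mul1r.
have nest n k : rnorm ((s (n + k)%N).1 - (s n).1) <= (s n).2 - (s (n + k)%N).2.
  elim: k => [|k IH]; first by rewrite addn0 !subrr rnorm0.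
  rewrite addnS; have [_ h1 h2 _] := sP (n + k)%N.
  apply: le_trans (rnormBt (s (n + k)%N).1 _ _) _.
  move: (lerD h2 IH) h1 => /=; lra.
have near n : rnorm (l - (s n).1) <= (s n).2.
  apply/ler_addgt0Pr => e e0; have [k hk] := half_pow_lt (2 * 2^-1) e0.
  apply: le_trans (rnormBt (s (n + k)%N).1 _ _) _; rewrite addrC; apply: lerD.
    by apply: le_trans (nest _ _) _; rewrite gerBl ltW.
  apply: le_trans (hl _) _; apply: le_trans (ltW hk).
  rewrite ler_wpM2l ?mulr_ge0 ?invr_ge0// lef_pV2 ?posrE ?exprn_gt0//.
  by rewrite ler_eXn2l ?ltr1n// leq_addl.
(* The limit lies in every ball, so $\|Gl\|$ exceeds the index of each step, against the Archimedean
   property. *)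
have [_ _ _ /(_ l)] := sP (Num.bound (rnorm (G l))).
rewrite rdistC => /(_ (near (Num.bound (rnorm (G l))).+1)) h.
by have := archi_boundP (rnorm_ge0 (G l)); rewrite ltNge (ltW h).
Qed.

(** Boundedness of [i \o G] for a bounded injection [i] replaces the closedness of the graph:
    candidates for [G h] are compared after applying [i]. *)
Lemma closed_graph (Mi Mg : R) : linear i -> injective i ->
  opbound i Mi -> opbound (i \o G) Mg -> exists2 M, 0 <= M & opbound G M.
Proof.
move=> li inji hi hg; have [n [h0 [r [r0 A]]]] := baire.
have B := scale_approx r0 A; set K := 4 * n%:R / r in B.
have K0 : 0 <= K by rewrite divr_ge0 ?mulr_ge0 ?ler0n// ltW.
exists (2 * K); first by rewrite mulr_ge0.
move=> h; have [->|h_neq0] := eqVneq h 0.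
  by rewrite (linear_map0 lG) !rnorm0 mulr0.
have hn := rnorm_gt0 h_neq0.
have step (p : nat * X) : exists a, rnorm (p.2 - a) < rnorm h / 2 ^+ p.1.+1 /\
    rnorm (G a) <= K * rnorm p.2.
  by have [|a h1 h2] := B p.2 (rnorm h / 2 ^+ p.1.+1); [rewrite divr_gt0// exprn_gt0|exists a].
have [f fP] := choice step.
(* Remainders of a series of approximants of [h]; they decay geometrically, so the values of [G] on
   the terms are summable. *)
pose res := fix res n := if n is k.+1 then res k - f (k, res k) else h.
have resP k : rnorm (res k) <= rnorm h / 2 ^+ k.
  case: k => [|k]; first by rewrite expr0 divr1.
  by have [/ltW] := fP (k, res k).
have [l hl] : exists l, forall k, rnorm (l - G (h - res k)) <= 2 * (K * rnorm h) / 2 ^+ k.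
  apply: geometric_cvg => [|k]; first by rewrite mulr_ge0// ltW.
  rewrite -(linear_mapB lG).
  have -> : h - res k.+1 - (h - res k) = f (k, res k).
    by rewrite /= !opprB !addrA subrK addrAC subrr add0r.
  have [_ h1] := fP (k, res k); apply: le_trans h1 _.
  rewrite -[leRHS]mulrA; exact: (ler_wpM2l K0 (resP k)).
have -> : G h = l.
  apply: inji; apply/eqP; rewrite -subr_eq0; apply/eqP/rnorm_lt_eps => e e0.
  have [k hk] := half_pow_lt (`|Mg| * rnorm h + `|Mi| * (2 * (K * rnorm h))) e0.
  apply: le_trans (ltW hk).
  have -> : i (G h) - i l = (i \o G) (res k) - i (l - G (h - res k)).
    rewrite /= (linear_mapB li) (linear_mapB lG) (linear_mapB li).
    by rewrite opprB addrA [_ + (_ - _)]addrC subrK.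
  apply: le_trans (rnormB _ _) _; rewrite mulrDl; apply: lerD.
    apply: le_trans (hg _) _; apply: le_trans (ler_wpM2r (rnorm_ge0 _) (ler_norm _)) _.
    by rewrite -mulrA ler_wpM2l.
  apply: le_trans (hi _) _; apply: le_trans (ler_wpM2r (rnorm_ge0 _) (ler_norm _)) _.
  by rewrite -mulrA ler_wpM2l.
by have := hl 0%N; rewrite subrr (linear_map0 lG) subr0 expr0 divr1 mulrA.
Qed.

End ClosedGraph.

(** * Resolvents of self-adjoint operators *)

Section HermitianOperators.
Variable R : realType.
Local Notation C := R[i].
Variable H : hilbertType R.
Implicit Types (A : operator H) (z : C).

Lemma shift_linear (a z : C) (p q u v : H) :
  a *: p + q - z *: (a *: u + v) = a *: (p - z *: u) + (q - z *: v).
Proof. by rewrite scalerBr scalerDr !scalerA [a * z]mulrC opprD addrACA. Qed.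

(* The last clause says that A contains its adjoint. *)
Definition hermitian_op A :=
  [/\ linear_operator A, symmetric_operator A
    & forall v w, (forall u, dom A u -> '[A u, v] = '[u, w]) -> dom A v /\ A v = w].

Definition lower_bound A z (c : R) :=
  forall u, dom A u -> rnorm u <= c * rnorm (A u - z *: u).

Lemma dense_dot_inj (S : set H) v w : dense S ->
  (forall u, S u -> '[u, v] = '[u, w]) -> v = w.
Proof.
move=> dS h; apply/eqP; rewrite -subr_eq0; apply/eqP/rnorm_lt_eps => e e0.
have e0' : 0 < e%:C%C :> C by rewrite ltcR.
have bne : ball (v - w) e%:C%C !=set0 by exists (v - w); exact: ballxx.
have [u [hu Su]] := dS _ bne (ball_open (v - w) e%:C%C).
move: hu; rewrite -ball_normE /= rnormE ltcR => /ltW hu.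
apply: le_trans hu.
have [->|d0] := eqVneq (v - w) 0; first by rewrite rnorm0 rnorm_ge0.
rewrite -(ler_pM2l (rnorm_gt0 d0)) -expr2 -rdotxx.
have -> : rdot (v - w) (v - w) = rdot (v - w) (v - w - u).
  have hz : rdot (v - w) u = 0 by rewrite rdotC /rdot dotBr h// subrr.
  by rewrite [RHS]rdotBr hz subr0.
exact: rdot_le.
Qed.

Lemma selfadjoint_hermitian A : selfadjoint A -> hermitian_op A.
Proof.
case=> lA dA e1 e2.
have adjP v : dom (adjoint A) v -> forall u, dom A u -> '[A u, v] = '[u, adjoint A v].
  by move=> hv; exact: (xgetPex 0 hv).
split=> // [u v du dv|v w h].
  by have [dv' <-] := e1 v dv; exact: adjP.
have dv : dom (adjoint A) v by exists w.
have [dv' E] := e2 _ dv; split=> //; rewrite E.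
by apply: (dense_dot_inj dA) => u du; rewrite -h// -adjP.
Qed.

Lemma hermitian_add A (V : H -> H) : hermitian_op A -> linear V ->
  (forall u v, '[V u, v] = '[u, V v]) -> hermitian_op (operator_add A V).
Proof.
move=> [[d0 lA] sA mA] lV sV; split.
- split=> // a u v du dv /=; have [dw ->] := lA a u v du dv; split=> //.
  by rewrite (linear_mapD lV) (linear_mapZ lV) scalerDr addrACA.
- by move=> u v du dv /=; rewrite dotDl dotDr sA// sV.
- move=> v w h /=; have [|dv ->] := mA v (w - V v); last by rewrite subrK.
  by move=> u du; rewrite dotBr -h//= dotDl sV addrK.
Qed.

Lemma resolvent_setP A z : ~ spectrum A z <->
  (forall x, exists! u, dom A u /\ A u - z *: u = x) /\ bounded_operator (resolvent A z).
Proof. by rewrite /spectrum; split=> [/notP|h /(_ h)]. Qed.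

Section Resolvent.
Variables (A : operator H) (z : C).
Hypothesis rz : ~ spectrum A z.

Lemma resolventP x : dom A (resolvent A z x) /\ A (resolvent A z x) - z *: resolvent A z x = x.
Proof.
have [/(_ x)[u [hu _]] _] := (resolvent_setP A z).1 rz.
by apply: (@xgetPex _ 0 [set u | dom A u /\ A u - z *: u = x]); exists u.
Qed.

Lemma resolvent_dom x : dom A (resolvent A z x).
Proof. by case: (resolventP x). Qed.

Lemma resolvent_eq x : A (resolvent A z x) = x + z *: resolvent A z x.
Proof. by have [_ {2}<-] := resolventP x; rewrite subrK. Qed.

Lemma resolvent_unique u x : dom A u -> A u - z *: u = x -> resolvent A z x = u.
Proof.
move=> du ux; have [/(_ x)[v [_ hv]] _] := (resolvent_setP A z).1 rz.
by rewrite -(hv u)// -(hv _ (resolventP x)).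
Qed.

Lemma resolvent_bounded : bounded_operator (resolvent A z).
Proof. by have [] := (resolvent_setP A z).1 rz. Qed.

Lemma resolvent_lower_bound : exists2 c, 0 < c & lower_bound A z c.
Proof.
have [_ [c c0 h]] := (bounded_operatorP _).1 resolvent_bounded.
exists (c + 1); first by rewrite ltr_wpDl.
move=> u du; rewrite -{1}(resolvent_unique du erefl).
by apply: le_trans (h _) _; rewrite ler_wpM2r ?rnorm_ge0// lerDl.
Qed.

Lemma resolvent_opbound c : lower_bound A z c -> opbound (resolvent A z) c.
Proof. by move=> h x; have [d {2}<-] := resolventP x; exact: h. Qed.

End Resolvent.

Section Hermitian.
Variable A : operator H.
Hypothesis hA : hermitian_op A.

Lemma hermitian_shift z u v : dom A u -> dom A v ->
  '[A u - z *: u, v] = '[u, A v - z^* *: v].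
Proof.
by case: hA => _ sA _ du dv; rewrite dotBl dotBr sA// dotZl dotZr conjCK.
Qed.

Lemma hermitian_dom0 : dom A 0.
Proof. by case: hA => -[]. Qed.

Lemma hermitian_linear a u v : dom A u -> dom A v ->
  dom A (a *: u + v) /\ A (a *: u + v) = a *: A u + A v.
Proof. by case: hA => -[_ + _ _]; apply. Qed.

Lemma hermitian_op0 : A 0 = 0.
Proof.
have [_] := hermitian_linear (-1) hermitian_dom0 hermitian_dom0.
by rewrite scaleN1r oppr0 addr0 scaleN1r addNr.
Qed.

Lemma hermitian_domB u v : dom A u -> dom A v -> dom A (u - v) /\ A (u - v) = A u - A v.
Proof.
move=> du dv; have := hermitian_linear (-1) dv du.
by rewrite !scaleN1r ![- _ + _]addrC.
Qed.

Lemma hermitian_domZ a u : dom A u -> dom A (a *: u) /\ A (a *: u) = a *: A u.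
Proof.
by move=> du; have := hermitian_linear a du hermitian_dom0; rewrite hermitian_op0 !addr0.
Qed.

(** The bound at [z] gives injectivity and the norm of the inverse. The bound at [z^*] gives
    surjectivity: $\langle u,x\rangle$ is bounded in terms of $(A-\bar z)u$, so Riesz represents it,
    and the last clause of [hermitian_op] puts the representing vector into the domain. *)
Lemma resolvent_criterion z c : 0 <= c ->
  lower_bound A z c -> lower_bound A z^* c -> ~ spectrum A z.
Proof.
move=> c0 hz hzb; have [[_ lA] _ mA] := hA.
have uniq u v : dom A u -> dom A v -> A u - z *: u = A v - z *: v -> u = v.
  move=> du dv h; apply/eqP; rewrite -subr_eq0; apply/eqP/rnorm_eq0/eqP.
  rewrite eq_le rnorm_ge0 andbT; have [d E] := hermitian_domB du dv.
  apply: le_trans (hz _ d) _.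
  by rewrite E scalerBr opprB [z *: v - _]addrC addrACA h [- A v + _]addrC -[_ - A v]opprB subrr rnorm0 mulr0.
have surj x : exists u, dom A u /\ A u - z *: u = x.
  have [] := @riesz_subspace R H H (dom A) (fun u => A u - z^* *: u)
    (fun u => '[u, x]) (c * rnorm x).
  - exact: hermitian_dom0.
  - move=> a u v du dv; have [d E] := lA a u v du dv; split=> //.
      by rewrite E shift_linear.
    by rewrite dotDl dotZl.
  - move=> u du; apply: le_trans (cabs_dot_le _ _) _.
    by rewrite mulrAC ler_wpM2r ?rnorm_ge0// hzb.
  - move=> w [hw _]; have [|dw E] := mA w (x + z *: w).
      move=> u du; rewrite dotDr hw// dotZr dotBl dotZl; ring.
    by exists w; rewrite E addrK.
have ex x : exists! u, dom A u /\ A u - z *: u = x.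
  have [u [du E]] := surj x; exists u; split=> // v [dv E'].
  by apply: uniq => //; rewrite E E'.
have resP x : dom A (resolvent A z x) /\ A (resolvent A z x) - z *: resolvent A z x = x.
  apply: (@xgetPex _ 0 [set u | dom A u /\ A u - z *: u = x]).
  by have [u []] := ex x; exists u.
apply/resolvent_setP; split=> //; apply/bounded_operatorP; split.
  move=> a x y; have [d1 E1] := resP x; have [d2 E2] := resP y.
  have [d3 E3] := lA a _ _ d1 d2; have [d4 E4] := resP (a *: x + y).
  by apply: uniq => //; rewrite E4 E3 shift_linear E1 E2.
by exists c => // x; have [d {2}<-] := resP x; exact: hz.
Qed.

(** The resolvents at [z] and [z^*] are adjoint to each other, hence equally bounded; the argument
    is run on forms because [z^*] is not yet known to lie in the resolvent set. *)
Lemma lower_bound_conj z c : 0 <= c -> ~ spectrum A z -> lower_bound A z c ->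
  lower_bound A z^* c.
Proof.
move=> c0 rz hz u du; apply: rnorm_le_rdot; first by rewrite mulr_ge0 ?rnorm_ge0.
move=> y; have [dv E] := resolventP rz y.
rewrite -{1}E rdotC /rdot hermitian_shift// -/(rdot _ _).
apply: le_trans (rdot_le _ _) _; rewrite [leRHS]mulrAC ler_wpM2r ?rnorm_ge0//.
exact: (resolvent_opbound rz hz).
Qed.

Lemma resolvent_set_conj z : ~ spectrum A z -> ~ spectrum A z^*.
Proof.
move=> rz; have [c c0 hc] := resolvent_lower_bound rz.
apply: (resolvent_criterion (ltW c0)); first exact: (lower_bound_conj (ltW c0)).
by rewrite conjCK.
Qed.

Lemma resolvent_adjoint z x y : ~ spectrum A z ->
  '[resolvent A z x, y] = '[x, resolvent A z^* y].
Proof.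
move=> rz; have rzb := resolvent_set_conj rz.
have [d E] := resolventP rz x; have [d' E'] := resolventP rzb y.
by rewrite -{2}E -{1}E' hermitian_shift.
Qed.

Lemma lower_bound_shift z w c : 0 <= c -> lower_bound A z c ->
  c * cabs (z - w) <= 1 / 2 -> lower_bound A w (2 * c).
Proof.
move=> c0 hz zw u du; have := hz u du.
have -> : A u - z *: u = (A u - w *: u) - (z - w) *: u.
  by rewrite scalerBl opprB addrA subrK.
have := ler_wpM2l c0 (rnormB (A u - w *: u) ((z - w) *: u)).
rewrite rnormZ mulrDr mulrA.
have := ler_wpM2r (rnorm_ge0 u) zw; lra.
Qed.

Lemma resolvent_set_open z : ~ spectrum A z ->
  exists2 e, 0 < e & forall w, cabs (z - w) < e -> ~ spectrum A w.
Proof.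
move=> rz; have [c c0 hc] := resolvent_lower_bound rz.
have hcb := lower_bound_conj (ltW c0) rz hc.
exists (c^-1 / 2); first by rewrite divr_gt0 ?invr_gt0.
move=> w hw; have hw' : c * cabs (z - w) <= 1 / 2.
  by rewrite mulrC -ler_pdivlMr// mul1r [leRHS]mulrC ltW.
apply: (@resolvent_criterion _ (2 * c)); first by rewrite mulr_ge0// ltW.
  exact: (lower_bound_shift (ltW c0) hc).
apply: (lower_bound_shift (ltW c0) hcb).
by rewrite -rmorphB /= cabs_conj.
Qed.

Lemma Im_hermitian u : dom A u -> complex.Im '[A u, u] = 0.
Proof.
move=> du; have [_ sA _] := hA; have := dotC (A u) u.
rewrite -sA//; case: '[A u, u] => a b [] /= h; move: h; lra.
Qed.

(** Since $\langle Au,u\rangle$ is real, $\|Au\mp iu\|^2=\|Au\|^2+\|u\|^2$. *)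
Lemma lower_bound_i (a : C) : a = 'i \/ a = - 'i -> lower_bound A a 1.
Proof.
move=> ha u du; rewrite mul1r -(@ler_pXn2r _ 2)// ?nnegrE ?rnorm_ge0//.
have h0 : rdot (A u) (a *: u) = 0.
  have hI := Im_hermitian du; rewrite /rdot dotZr.
  by case: ha => ->; move: hI; case: '[A u, u] => x y /= ->; rewrite ?mulr0 ?mul0r ?oppr0 ?subr0 ?mul0r; ring.
have ca : cabs a = 1.
  by case: ha => ->; rewrite ?cabsN /cabs normCi.
by rewrite rnorm_sqrB h0 rnormZ ca mul1r mulr0 subr0 lerDr exprn_ge0 ?rnorm_ge0.
Qed.

Lemma resolvent_set_i : ~ spectrum A 'i.
Proof.
apply: (@resolvent_criterion _ 1) => //; first by apply: lower_bound_i; left.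
by apply: lower_bound_i; right; rewrite conjCi.
Qed.

Lemma eigenvalue_real z u : eigenkernel A z u -> u != 0 -> complex.Im z = 0.
Proof.
case=> du E u0; have := Im_hermitian du; rewrite E dotZl dotE => h.
have n0 : rnorm u ^+ 2 != 0 by rewrite expf_neq0// gt_eqF// rnorm_gt0.
move: h; case: (z) => a b /=; rewrite mulr0 add0r => /eqP.
by rewrite mulf_eq0 (negbTE n0) orbF => /eqP.
Qed.

End Hermitian.

Lemma opnorm_attained (X Y : normedModType C) (f : X -> Y) : bounded_operator f ->
  exists2 b, 0 <= b & opbound f b /\ forall M, 0 <= M -> opbound f M -> b <= M.
Proof.
move=> bf; have lf := bounded_linear bf; have := opnorm_ge0 lf; case: bf => _.
case E : (opnorm f) => [b||]// _; rewrite lee_fin => b0.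
exists b => //; split; first by apply/opnorm_le => //; rewrite E.
by move=> M M0 h; rewrite -lee_fin -E; apply/opnorm_le.
Qed.

(* The resolvent of a self-adjoint operator at c has norm at most the inverse
   of the distance from c to the spectrum: otherwise, with b the norm of the
   resolvent B, both b - B and b + B would be bounded below, hence so would
   b^2 - B^2, and b would not be the least bound of B. *)
Lemma resolvent_norm_le (A : operator H) (c r : R) : hermitian_op A -> 0 < r ->
  (forall s : R, `|s - c| < r -> ~ spectrum A s%:C%C) -> lower_bound A c%:C%C r^-1.
Proof.
move=> hA r0 gap.
have rc : ~ spectrum A c%:C%C by apply: gap; rewrite subrr normr0.
have [b b0 [hb bmin]] := opnorm_attained (resolvent_bounded rc).
set B := resolvent A c%:C%C in hb bmin.
suff br : b <= r^-1.
  move=> u du; rewrite -{1}(resolvent_unique rc du erefl); apply: le_trans (hb _) _.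
  by rewrite ler_wpM2r ?rnorm_ge0.
rewrite leNgt; apply/negP => rb.
have b0' : 0 < b by apply: lt_trans rb; rewrite invr_gt0.
have bV : b^-1 < r by rewrite -[ltRHS]invrK ltf_pV2 ?posrE ?invr_gt0.
(* The points $c\pm1/b$ are in the gap because $1/b<r$; a lower bound for $A-(c+s/b)$ becomes one
   for $1-(s/b)B$. *)
have low (s : R) : `|s| = 1 -> exists2 K, 1 <= K &
    forall x, rnorm x <= K * rnorm (x - (s / b)%:C%C *: B x).
  move=> s1; have rs : ~ spectrum A (c + s / b)%:C%C.
    apply: gap; rewrite addrAC subrr add0r normrM s1 mul1r ger0_norm// invr_ge0//.
  have [k k0 hk] := resolvent_lower_bound rs.
  exists (1 + k / b); first by rewrite lerDl divr_ge0// ltW.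
  move=> x; have [d E] := resolventP rc x.
  have := hk _ d; rewrite rmorphD scalerDl opprD addrA E => h.
  have t := rnormBt ((s / b)%:C%C *: B x) x 0.
  rewrite !subr0 rnormZR normrM s1 mul1r ger0_norm ?invr_ge0// in t.
  rewrite -/B in h; have := ler_wpM2l (ltW (_ : 0 < b^-1)) h.
  rewrite invr_gt0 => /(_ b0'); rewrite mulrDl mul1r; move: t; lra.
have [K1 K11 h1] := low 1 (normr1 _); have [K2 K21 h2] := low (-1) (normrN1 _).
have lB : linear B := bounded_linear (resolvent_bounded rc).
have sB x y : rdot (B x) y = rdot x (B y).
  by rewrite /rdot /B resolvent_adjoint// conjR.
(* From $\|x\|\le K_1K_2\|(1-b^{-2}B^2)x\|$ the bound $b$ of $B$ improves by the factor
   $\sqrt{1-k}\le1-k/2$. *)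
pose k := (K1 * K2) ^- 2.
have K0 : 0 < K1 * K2 by rewrite mulr_gt0//; apply: lt_le_trans ltr01 _.
have k0 : 0 < k by rewrite invr_gt0 exprn_gt0.
have k1 : k <= 1.
  by rewrite invf_le1 ?exprn_gt0// exprn_ege1//; apply: mulr_ege1.
have key x : rnorm (B x) ^+ 2 <= b ^+ 2 * (1 - k) * rnorm x ^+ 2.
  set y := x - (-1 / b)%:C%C *: B x.
  set w := x - (b ^- 2)%:C%C *: B (B x).
  have yw : y - (1 / b)%:C%C *: B y = w.
    rewrite /y /w mulN1r rmorphN scaleNr opprK mul1r -exprVn rmorphXn expr2.
    by rewrite (linear_mapD lB) (linear_mapZ lB) scalerDr scalerA opprD addrA addrK.
  have xw : rnorm x <= K1 * K2 * rnorm w.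
    apply: le_trans (h2 x) _; rewrite [K1 * _]mulrC -mulrA -yw.
    by rewrite ler_wpM2l// (le_trans _ K21).
  have w2 : rnorm w ^+ 2 <= rnorm x ^+ 2 - b ^- 2 * rnorm (B x) ^+ 2.
    rewrite /w rnorm_sqrB rdotZr -sB rdotxx rnormZR exprMn.
    rewrite ger0_norm ?invr_ge0 ?exprn_ge0//.
    have : rnorm (B (B x)) ^+ 2 <= b ^+ 2 * rnorm (B x) ^+ 2.
      by rewrite -exprMn ler_pXn2r ?nnegrE ?mulr_ge0 ?rnorm_ge0.
    have b4 : 0 <= b ^- 2 ^+ 2 by rewrite exprn_ge0 ?invr_ge0 ?exprn_ge0.
    move=> /(ler_wpM2l b4).
    have -> : b ^- 2 ^+ 2 * (b ^+ 2 * rnorm (B x) ^+ 2) = b ^- 2 * rnorm (B x) ^+ 2.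
      by field; rewrite gt_eqF.
    lra.
  have xw2 : k * rnorm x ^+ 2 <= rnorm w ^+ 2.
    rewrite /k mulrC ler_pdivrMr ?exprn_gt0// mulrC -exprMn.
    apply: lerXn2r; rewrite ?nnegrE ?rnorm_ge0//.
      exact: (mulr_ge0 (ltW K0) (rnorm_ge0 w)).
  have := le_trans xw2 w2.
  have b2 : 0 <= b ^+ 2 by rewrite exprn_ge0.
  move=> /(ler_wpM2l b2).
  have -> : b ^+ 2 * (rnorm x ^+ 2 - b ^- 2 * rnorm (B x) ^+ 2)
      = b ^+ 2 * rnorm x ^+ 2 - rnorm (B x) ^+ 2 by field; rewrite gt_eqF.
  lra.
have : b <= b * (1 - k / 2).
  have p : 0 <= b * (1 - k / 2) by rewrite mulr_ge0//; lra.
  apply: bmin => // x.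
  rewrite -(@ler_pXn2r _ 2)// ?nnegrE ?(mulr_ge0 p) ?rnorm_ge0//.
  apply: le_trans (key x) _; rewrite exprMn ler_wpM2r ?exprn_ge0 ?rnorm_ge0//.
  rewrite exprMn ler_wpM2l ?exprn_ge0//; have := sqr_ge0 k; lra.
by move=> hbb; have := mulr_gt0 b0' k0; lra.
Qed.

End HermitianOperators.

(** * Boundary conditions and the Krein formula *)

Section BoundedAlgebra.
Variable R : realType.
Local Notation C := R[i].
Implicit Types X Y Z : normedModType C.

Lemma bounded_opbound X Y (f : X -> Y) : bounded_operator f ->
  exists2 M, 0 < M & opbound f M.
Proof.
move=> /bounded_operatorP[_ [M M0 h]]; exists (M + 1); first by rewrite ltr_wpDl.
by apply: opboundW h; rewrite lerDl.
Qed.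

Lemma opbound_comp X Y Z (f : Y -> Z) (g : X -> Y) M N : 0 <= M ->
  opbound f M -> opbound g N -> opbound (fun x => f (g x)) (M * N).
Proof.
move=> M0 hf hg x; apply: le_trans (hf _) _.
by rewrite -mulrA ler_wpM2l.
Qed.

Lemma bounded_comp X Y Z (f : Y -> Z) (g : X -> Y) :
  bounded_operator f -> bounded_operator g -> bounded_operator (fun x => f (g x)).
Proof.
move=> /bounded_operatorP[lf [M M0 hM]] /bounded_operatorP[lg [N N0 hN]].
apply/bounded_operatorP; split; first by move=> a x y /=; rewrite lg lf.
by exists (M * N); rewrite ?mulr_ge0//; exact: opbound_comp.
Qed.

Lemma opbound_add X Y (f g : X -> Y) M N :
  opbound f M -> opbound g N -> opbound (fun x => f x + g x) (M + N).
Proof.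
by move=> hf hg x; apply: le_trans (rnormD _ _) _; rewrite mulrDl lerD.
Qed.

Lemma opbound_opp X Y (f : X -> Y) M : opbound f M -> opbound (fun x => - f x) M.
Proof. by move=> hf x; rewrite rnormN. Qed.

Lemma bounded_add X Y (f g : X -> Y) :
  bounded_operator f -> bounded_operator g -> bounded_operator (fun x => f x + g x).
Proof.
move=> /bounded_operatorP[lf [M M0 hM]] /bounded_operatorP[lg [N N0 hN]].
apply/bounded_operatorP; split.
  by move=> a x y /=; rewrite lg lf scalerDr addrACA.
by exists (M + N); rewrite ?addr_ge0//; exact: opbound_add.
Qed.

Lemma bounded_opp X Y (f : X -> Y) : bounded_operator f -> bounded_operator (fun x => - f x).
Proof.
move=> /bounded_operatorP[lf [M M0 hM]]; apply/bounded_operatorP; split.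
  by move=> a x y /=; rewrite lf opprD scalerN.
by exists M => //; exact: opbound_opp.
Qed.

Lemma bounded_sub X Y (f g : X -> Y) :
  bounded_operator f -> bounded_operator g -> bounded_operator (fun x => f x - g x).
Proof. by move=> bf bg; apply: bounded_add => //; exact: bounded_opp. Qed.

Lemma bounded_scale X Y (a : C) (f : X -> Y) : bounded_operator f ->
  bounded_operator (fun x => a *: f x).
Proof.
move=> /bounded_operatorP[lf [M M0 hM]]; apply/bounded_operatorP; split.
  by move=> b x y /=; rewrite lf scalerDr !scalerA mulrC.
exists (cabs a * M); first by rewrite mulr_ge0 ?cabs_ge0.
by move=> x; rewrite rnormZ -mulrA ler_wpM2l ?cabs_ge0.
Qed.

End BoundedAlgebra.

Section HilbertSum.
Variable R : realType.
Variables U V : hilbertType R.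

Lemma hdot_hprod (f g : hprod U V) : '[f, g] = '[f.1, g.1] + '[f.2, g.2].
Proof. by []. Qed.

Lemma rnorm_hprod (f : hprod U V) : rnorm f ^+ 2 = rnorm f.1 ^+ 2 + rnorm f.2 ^+ 2.
Proof. by rewrite -!rdotxx /rdot hdot_hprod ReD. Qed.

Lemma rnorm_fst (f : hprod U V) : rnorm f.1 <= rnorm f.
Proof.
rewrite -(@ler_pXn2r _ 2)// ?nnegrE ?rnorm_ge0// rnorm_hprod lerDl.
by rewrite exprn_ge0 ?rnorm_ge0.
Qed.

Lemma rnorm_snd (f : hprod U V) : rnorm f.2 <= rnorm f.
Proof.
rewrite -(@ler_pXn2r _ 2)// ?nnegrE ?rnorm_ge0// rnorm_hprod lerDr.
by rewrite exprn_ge0 ?rnorm_ge0.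
Qed.

Lemma rnorm_hprod_le (f : hprod U V) : rnorm f <= rnorm f.1 + rnorm f.2.
Proof.
rewrite -(@ler_pXn2r _ 2)// ?nnegrE ?addr_ge0 ?rnorm_ge0// rnorm_hprod.
have := mulr_ge0 (rnorm_ge0 f.1) (rnorm_ge0 f.2); lra.
Qed.

End HilbertSum.

Section BoundaryConditions.
Variable R : realType.
Local Notation C := R[i].
Variable K : hilbertType R.

Lemma Jop_linear : linear (@Jop R K).
Proof.
move=> a f g; rewrite /Jop /=; congr (_, _).
by rewrite opprD -scalerN.
Qed.

Lemma rnorm_Jop (f : hprod K K) : rnorm (Jop f) = rnorm f.
Proof.
apply/eqP; rewrite -(@eqrXn2 _ 2)// ?rnorm_ge0// !rnorm_hprod /=.
by rewrite rnormN addrC.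
Qed.

Lemma Jop_bounded : bounded_operator (@Jop R K).
Proof.
apply/bounded_operatorP; split; first exact: Jop_linear.
by exists 1 => // f; rewrite rnorm_Jop mul1r.
Qed.

(* Parametrizes ker [X, Y], with inverse W(X, Y). *)
Definition kerlift (X Y : K -> K) (phi : K) : hprod K K := (- badj Y phi, badj X phi).

(** Origin of the coefficient in the Krein formula: the symplectic form pairs the kernels of two
    boundary conditions through $X'Y^*-Y'X^*$, which vanishes for equal pairs when $XY^*=YX^*$. *)
Lemma Jop_kerlift (X Y X' Y' : K -> K) a b :
  bounded_operator X -> bounded_operator Y -> bounded_operator X' -> bounded_operator Y' ->
  '[Jop (kerlift X Y a), kerlift X' Y' b]
  = '[X' (badj Y a) - Y' (badj X a), b].
Proof.
move=> bX bY bX' bY'; rewrite hdot_hprod /Jop /kerlift /= opprK dotBl (badjP bX') (badjP bY') dotNr.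
by rewrite addrC.
Qed.

Section OneCondition.
Variables X Y : K -> K.
Hypotheses (bX : bounded_operator X) (bY : bounded_operator Y).

Lemma kerlift_linear : linear (kerlift X Y).
Proof.
move=> a x y; rewrite /kerlift !badj_linear//; congr (_, _).
by rewrite opprD -scalerN.
Qed.

Lemma block_kerlift_adj f phi : '[block_op X Y f, ((0, phi) : hprod K K)] = '[f, kerlift X Y phi].
Proof.
by rewrite !hdot_hprod /kerlift /block_op /= dot0r add0r dotDl dotNl (badjP bX) (badjP bY) dotNr.
Qed.

Hypothesis sXY : forall x, X (badj Y x) = Y (badj X x).

Lemma row_kerlift phi : row_op X Y (kerlift X Y phi) = 0.
Proof. by rewrite /row_op /= (linear_mapN (bounded_linear bX)) sXY addNr. Qed.

(** The operator inverted in [Wop]; its form at [x] is the squared norm of [kerlift X Y x], hence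
    its positivity. *)
Let N (x : K) := X (badj X x) + Y (badj Y x).

Lemma block_kerlift phi : block_op X Y (kerlift X Y phi) = (0, N phi).
Proof.
rewrite /block_op; congr (_, _); first exact: row_kerlift.
by rewrite /= (linear_mapN (bounded_linear bY)) opprK addrC.
Qed.

Hypothesis inv : ~ spectrum (total_operator (block_op X Y)) 0.

Let binj f g : block_op X Y f = block_op X Y g -> f = g.
Proof.
move=> E; have e h : block_op X Y h - 0 *: h = block_op X Y h by rewrite scale0r subr0.
have h := @resolvent_unique _ _ (total_operator (block_op X Y)) 0 inv.
by rewrite -(h f _ I (e f)) E (h g _ I (e g)).
Qed.

(** Solve [block_op X Y f = (0, phi)] with $\|f\|\le c\|\phi\|$. By [block_kerlift_adj],
    $\|\phi\|^2$ is the inner product of [f] with the lift of [phi], and Cauchy-Schwarz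
    concludes. *)
Lemma kerlift_lower_bound : exists2 c, 0 < c & forall phi, rnorm phi <= c * rnorm (kerlift X Y phi).
Proof.
have [c c0 hc] := bounded_opbound (resolvent_bounded inv).
exists c => // phi; pose p : hprod K K := (0, phi).
have np : rnorm p = rnorm phi.
  by apply/eqP; rewrite -(@eqrXn2 _ 2)// ?rnorm_ge0// rnorm_hprod /= rnorm0 expr0n add0r.
have [->|phi0] := eqVneq phi 0; first by rewrite rnorm0 mulr_ge0 ?rnorm_ge0// ltW.
have h : rnorm phi ^+ 2 <= c * rnorm phi * rnorm (kerlift X Y phi).
  have [_] := resolventP inv p; rewrite scale0r subr0 => E.
  rewrite -np -rdotxx -{1}E /rdot block_kerlift_adj -/(rdot _ _).
  apply: le_trans (rdot_le _ _) _; rewrite ler_wpM2r ?rnorm_ge0//.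
  exact: hc.
by rewrite -(ler_pM2l (rnorm_gt0 phi0)) -expr2 mulrCA mulrA.
Qed.

Let N_dot x y : '[N x, y] = '[badj X x, badj X y] + '[badj Y x, badj Y y].
Proof. by rewrite dotDl (badjP bX) (badjP bY). Qed.

Let N_linear : linear N.
Proof.
by move=> a x y; rewrite /N !badj_linear// (bounded_linear bX) (bounded_linear bY) scalerDr addrACA.
Qed.

Let N_hermitian : hermitian_op (total_operator N).
Proof.
split.
- by split=> // a u v _ _; split=> //=; rewrite N_linear.
- move=> u v _ _ /=; rewrite N_dot [RHS]dotC N_dot rmorphD /=.
  by congr (_ + _); rewrite -dotC.
- move=> v w h; split=> //=; apply: dot_inj => z.
  by rewrite -h//= N_dot [LHS]dotC N_dot rmorphD /= -!dotC.
Qed.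

Let N_lower : exists2 c, 0 < c & forall x, rnorm x <= c * rnorm (N x).
Proof.
have [c c0 hc] := kerlift_lower_bound; exists (c ^+ 2); first by rewrite exprn_gt0.
move=> x; have [->|x0] := eqVneq x 0.
  by rewrite rnorm0 mulr_ge0 ?rnorm_ge0// exprn_ge0// ltW.
rewrite -(ler_pM2r (rnorm_gt0 x0)) -expr2.
have : rnorm x ^+ 2 <= (c * rnorm (kerlift X Y x)) ^+ 2.
  by apply: lerXn2r; rewrite ?nnegrE ?mulr_ge0 ?rnorm_ge0// ltW.
move/le_trans; apply; rewrite exprMn -[leRHS]mulrA ler_wpM2l ?exprn_ge0 ?(ltW c0)//.
apply: le_trans (rdot_le _ _).
by rewrite rnorm_hprod /= rnormN /rdot N_dot ReD -!/(rdot _ _) !rdotxx addrC.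
Qed.

Let N_res : ~ spectrum (total_operator N) 0.
Proof.
have [c c0 hc] := N_lower.
have l : lower_bound (total_operator N) 0 c.
  by move=> u _ /=; rewrite scale0r subr0.
by apply: (resolvent_criterion N_hermitian (ltW c0) l); rewrite conjC0.
Qed.

Let N_binv y : N (binv N y) = y.
Proof.
apply: (@xgetPex _ 0 [set x | N x = y]); exists (resolvent (total_operator N) 0 y).
by have [_] := resolventP N_res y; rewrite /= scale0r subr0.
Qed.

Let N_inj x y : N x = N y -> x = y.
Proof.
move=> h; apply/eqP; rewrite -subr_eq0; apply/eqP/rnorm_eq0/eqP.
rewrite eq_le rnorm_ge0 andbT; have [c c0 hc] := N_lower.
by apply: le_trans (hc _) _; rewrite (linear_mapB N_linear) h subrr rnorm0 mulr0.
Qed.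

Lemma Wop_N f : N (Wop X Y f) = - Y f.1 + X f.2.
Proof. exact: N_binv. Qed.

(** Both sides have the same image under the injective block operator: the first components vanish
    and the second agree by the definition of [Wop]. *)
Lemma kerlift_Wop f : row_op X Y f = 0 -> kerlift X Y (Wop X Y f) = f.
Proof.
move=> h; apply: binj; rewrite block_kerlift Wop_N /block_op.
by congr (_, _); rewrite -h.
Qed.

Lemma Wop_kerlift phi : Wop X Y (kerlift X Y phi) = phi.
Proof.
apply: N_inj; rewrite Wop_N /=.
by rewrite (linear_mapN (bounded_linear bY)) opprK addrC.
Qed.

Lemma Wop_bounded : bounded_operator (Wop X Y).
Proof.
have [c c0 hc] := N_lower.
have bF : bounded_operator (fun f : hprod K K => - Y f.1 + X f.2).
  have b1 : bounded_operator (fun f : hprod K K => f.1).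
    apply/bounded_operatorP; split=> //; exists 1 => // f; rewrite mul1r; exact: rnorm_fst.
  have b2 : bounded_operator (fun f : hprod K K => f.2).
    apply/bounded_operatorP; split=> //; exists 1 => // f; rewrite mul1r; exact: rnorm_snd.
  by apply: bounded_add; [apply: bounded_opp|]; exact: bounded_comp.
apply/bounded_operatorP; split.
  move=> a f g; apply: N_inj; rewrite N_linear !Wop_N.
  exact: (bounded_linear bF).
have [_ [M M0 hM]] := (bounded_operatorP _).1 bF.
exists (c * M); first by rewrite mulr_ge0// ltW.
move=> f; apply: le_trans (hc _) _; rewrite Wop_N -mulrA ler_wpM2l ?(ltW c0)//.
Qed.

End OneCondition.

Lemma Zop_bounded (X Y X' Y' : K -> K) :
  bounded_operator X -> bounded_operator Y -> bounded_operator X' -> bounded_operator Y' ->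
  bounded_operator (Wop X Y) -> bounded_operator (Wop X' Y') ->
  bounded_operator (Zop X Y X' Y').
Proof.
move=> bX bY bX' bY' bW bW'; apply: (bounded_comp (badj_bounded bW)).
by apply: bounded_sub; [apply: (bounded_comp bX)|apply: (bounded_comp bY)];
  apply: bounded_comp (badj_bounded _) bW'.
Qed.

Lemma badj_sub_opbound (f g : K -> K) e : bounded_operator f -> bounded_operator g ->
  0 <= e -> opbound (fun x => f x - g x) e -> opbound (fun x => badj f x - badj g x) e.
Proof.
move=> bf bg e0 h x.
rewrite -(@badj_unique _ _ _ _ (bounded_sub bf bg) (fun x => badj f x - badj g x)).
  by apply: badj_opbound => //; exact: bounded_sub.
by move=> u y; rewrite dotBl dotBr (badjP bf) (badjP bg).
Qed.

Lemma kerlift_sub_opbound (X Y X' Y' : K -> K) e :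
  bounded_operator X -> bounded_operator Y -> bounded_operator X' -> bounded_operator Y' ->
  0 <= e -> opbound (fun x => X x - X' x) e -> opbound (fun x => Y x - Y' x) e ->
  opbound (fun x => kerlift X Y x - kerlift X' Y' x) (2 * e).
Proof.
move=> bX bY bX' bY' e0 hX hY x; apply: le_trans (rnorm_hprod_le _) _.
have -> : 2 * e * rnorm x = e * rnorm x + e * rnorm x by ring.
rewrite /kerlift /= -opprD rnormN.
by apply: lerD; exact: badj_sub_opbound.
Qed.

(** The two lifts differ by at most $2e\|\phi\|$, and $2ce\le1/2$ lets half of $\|\phi\|$ be
    absorbed. *)
Lemma kerlift_lower_bound_near (X Y X' Y' : K -> K) c e :
  bounded_operator X -> bounded_operator Y -> bounded_operator X' -> bounded_operator Y' ->
  0 <= e -> opbound (fun x => X x - X' x) e -> opbound (fun x => Y x - Y' x) e ->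
  0 <= c -> c * e <= 4^-1 ->
  (forall phi, rnorm phi <= c * rnorm (kerlift X' Y' phi)) ->
  forall phi, rnorm phi <= 2 * c * rnorm (kerlift X Y phi).
Proof.
move=> bX bY bX' bY' e0 hX hY c0 ce h phi; have := h phi.
have h1 := kerlift_sub_opbound bX bY bX' bY' e0 hX hY phi.
have h2 : rnorm (kerlift X' Y' phi)
    <= rnorm (kerlift X Y phi - kerlift X' Y' phi) + rnorm (kerlift X Y phi).
  by rewrite rdistC -{1}[kerlift X' Y' phi](subrK (kerlift X Y phi)) rnormD.
have := ler_wpM2l c0 (le_trans h2 (lerD h1 (lexx _))).
have := ler_wpM2r (rnorm_ge0 phi) ce; lra.
Qed.

End BoundaryConditions.

Lemma dot_injl (R : realType) (H : hilbertType R) (x y : H) :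
  (forall z, '[x, z] = '[y, z]) -> x = y.
Proof. by move=> h; apply: dot_inj => z; rewrite dotC h -dotC. Qed.

Section Unembed.
Variables (R : realType) (D X : normedModType R[i]) (iD : D -> X).
Hypothesis iD_inj : injective iD.

Lemma unembedK d : unembed iD (iD d) = d.
Proof. by apply: iD_inj; apply: (@xgetPex _ 0 [set x | iD x = iD d]); exists d. Qed.

End Unembed.

(** * Weak and operator forms of the Krein formula *)

Section KreinFormula.
Variable R : realType.
Local Notation C := R[i].
Variables (H K : hilbertType R) (D : completeNormedModType C).
Variables (iD : D -> H) (Astar : operator H).
Hypotheses (iD_linear : linear iD) (iD_inj : injective iD).

(** Everything known about one value of the parameter, with the parameter removed, so that a fixed
    datum can be compared with an arbitrary one. *)
Record boundary_data (T : D -> hprod K K) (Ac : operator H) (V : H -> H)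
    (X Y : K -> K) : Prop := BoundaryData {
  bd_T : bounded_operator T;
  bd_green : forall u v, '[Astar (iD u), iD v] - '[iD u, Astar (iD v)]
    = '[Jop (T u), T v];
  bd_hermitian : hermitian_op Ac;
  bd_Ac : forall u, dom Ac u -> Astar u = Ac u;
  bd_dom : dom Ac = iD @` [set u | row_op X Y (T u) = 0];
  bd_V : bounded_operator V;
  bd_Vsym : forall u v, '[V u, v] = '[u, V v];
  bd_X : bounded_operator X;
  bd_Y : bounded_operator Y;
  bd_sym : forall x, X (badj Y x) = Y (badj X x);
  bd_inv : ~ spectrum (total_operator (block_op X Y)) 0 }.

Section OneParameter.
Variables (T : D -> hprod K K) (Ac : operator H) (V : H -> H) (X Y : K -> K).
Hypothesis bd : boundary_data T Ac V X Y.
Local Notation Hm := (operator_add Ac V).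

Lemma bd_hermitian_add : hermitian_op Hm.
Proof.
exact: (hermitian_add (bd_hermitian bd) (bounded_linear (bd_V bd)) (bd_Vsym bd)).
Qed.

Lemma bd_embedK u : dom Ac u -> iD (unembed iD u) = u.
Proof.
by rewrite (bd_dom bd) => -[d _ <-]; rewrite unembedK.
Qed.

Lemma bd_row d : dom Ac (iD d) -> row_op X Y (T d) = 0.
Proof. by rewrite (bd_dom bd) => -[d' /= h /iD_inj <-]. Qed.

Lemma bd_kerlift d : dom Ac (iD d) -> T d = kerlift X Y (Wop X Y (T d)).
Proof.
by case: bd => *; rewrite kerlift_Wop//; exact: bd_row.
Qed.

Section AtPoint.
Variables (B : operator H) (z : C).
Hypotheses (dB : dom B = dom Ac) (rz : ~ spectrum B z).
Local Notation RD := (fun h => unembed iD (resolvent B z h)).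

(** [B] is meant to be [Ac] or [operator_add Ac V], which share their domain. *)
Lemma embed_resolvent h : iD (RD h) = resolvent B z h.
Proof. by apply: bd_embedK; rewrite -dB; exact: resolvent_dom. Qed.

Lemma dom_embed_resolvent h : dom Ac (iD (RD h)).
Proof. by rewrite embed_resolvent -dB; exact: resolvent_dom. Qed.

Lemma unembed_resolvent_linear : linear RD.
Proof.
move=> a x y; apply: iD_inj.
rewrite embed_resolvent iD_linear !embed_resolvent.
by rewrite (bounded_linear (resolvent_bounded rz)).
Qed.

(** The resolvent is bounded into [H] with values in the range of [iD]; the closed graph theorem
    makes it bounded into [D], where the traces are defined. *)
Lemma unembed_resolvent_bounded Mi : opbound iD Mi -> bounded_operator RD.
Proof.
move=> hi; apply/bounded_operatorP; split; first exact: unembed_resolvent_linear.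
have [M M0 hM] := bounded_opbound (resolvent_bounded rz).
apply: (closed_graph unembed_resolvent_linear iD_linear iD_inj hi).
by move=> h /=; rewrite embed_resolvent; exact: hM.
Qed.

End AtPoint.

(** Second resolvent identity. It transfers what is assumed of $(\mathcal A_t-\mathbf i)^{-1}$ in
    the norm of $\mathcal D$ to the resolvent of $H_t$ at any regular point. *)
Lemma unembed_resolvent_set z h : ~ spectrum Hm z ->
  unembed iD (resolvent Hm z h)
  = unembed iD (resolvent Ac 'i (h - (V (resolvent Hm z h) - (z - 'i) *: resolvent Hm z h))).
Proof.
move=> rz; have ri := resolvent_set_i (bd_hermitian bd).
congr (unembed iD _); symmetry; apply: (resolvent_unique ri).
  exact: (resolvent_dom rz h).
have [_ /= E] := resolventP rz h; rewrite -{3}E scalerBl.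
by rewrite !opprB !addrA subrK [RHS]addrAC addrK.
Qed.

End OneParameter.

Lemma weak_krein T Ac V X Y T' Ac' V' X' Y' u v :
  boundary_data T Ac V X Y -> boundary_data T' Ac' V' X' Y' ->
  dom Ac' (iD u) -> dom Ac (iD v) ->
  '[operator_add Ac' V' (iD u), iD v] - '[iD u, operator_add Ac V (iD v)]
  = '[V' (iD u) - V (iD u), iD v]
    + '[X (badj Y' (Wop X' Y' (T' u))) - Y (badj X' (Wop X' Y' (T' u))), Wop X Y (T v)]
    + '[Jop (T u - T' u), T v].
Proof.
move=> b b' du dv.
have bJ := bounded_linear (Jop_bounded K).
have -> : '[operator_add Ac' V' (iD u), iD v]
  = '[Astar (iD u), iD v] + '[V' (iD u), iD v] by rewrite -dotDl (bd_Ac b' du).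
have -> : '[iD u, operator_add Ac V (iD v)]
  = '[iD u, Astar (iD v)] + '[iD u, V (iD v)] by rewrite -dotDr (bd_Ac b dv).
have -> : '[Astar (iD u), iD v] + '[V' (iD u), iD v]
    - ('[iD u, Astar (iD v)] + '[iD u, V (iD v)])
  = '[V' (iD u), iD v] - '[V (iD u), iD v]
    + ('[Astar (iD u), iD v] - '[iD u, Astar (iD v)]) by rewrite (bd_Vsym b); ring.
rewrite (bd_green b) dotBl -[in RHS]addrA; congr (_ + _).
rewrite -Jop_kerlift; [|exact: bd_X b'|exact: bd_Y b'|exact: bd_X b|exact: bd_Y b].
by rewrite -(bd_kerlift b dv) -(bd_kerlift b' du) -dotDl -(linear_mapD bJ) addrC subrK.
Qed.

Lemma krein_formula T Ac V X Y T' Ac' V' X' Y' z Mi :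
  boundary_data T Ac V X Y -> boundary_data T' Ac' V' X' Y' -> opbound iD Mi ->
  ~ spectrum (operator_add Ac V) z -> ~ spectrum (operator_add Ac' V') z ->
  let R1 z := resolvent (operator_add Ac V) z in
  let R2 z := resolvent (operator_add Ac' V') z in
  let T1 h := T (unembed iD (R1 z^* h)) in
  forall h,
    R1 z h - R2 z h
    = R1 z (V' (R2 z h) - V (R2 z h))
      + badj T1 (Zop X Y X' Y' (T' (unembed iD (R2 z h))))
      + badj T1 (Jop (T (unembed iD (R2 z h)) - T' (unembed iD (R2 z h)))).
Proof.
move=> b b' hi r1 r2 R1 R2 T1 h; have r1b := resolvent_set_conj (bd_hermitian_add b) r1.
have bW := Wop_bounded (bd_X b) (bd_Y b) (bd_inv b).
have bT1 : bounded_operator T1.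
  exact: (bounded_comp (bd_T b) (unembed_resolvent_bounded (B := operator_add Ac V) b erefl r1b hi)).
apply: dot_injl => g.
set u := unembed iD (R2 z h); set v := unembed iD (R1 z^* g).
have uE : iD u = R2 z h by exact: (embed_resolvent (B := operator_add Ac' V') b' erefl r2).
have vE : iD v = R1 z^* g by exact: (embed_resolvent (B := operator_add Ac V) b erefl r1b).
have du : dom Ac' (iD u) by exact: (dom_embed_resolvent (B := operator_add Ac' V') b' erefl r2).
have dv : dom Ac (iD v) by exact: (dom_embed_resolvent (B := operator_add Ac V) b erefl r1b).
have -> : '[R1 z h - R2 z h, g]
    = '[operator_add Ac' V' (iD u), iD v] - '[iD u, operator_add Ac V (iD v)].
  rewrite dotBl (resolvent_adjoint (bd_hermitian_add b))// -/(R1 _ _) uE vE.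
  rewrite /R1 /R2 !resolvent_eq// dotDl dotDr dotZl dotZr conjCK; ring.
rewrite (weak_krein b b' du dv) 2![in RHS]dotDl -!(badjP' bT1).
rewrite (resolvent_adjoint (bd_hermitian_add b))// uE vE.
by rewrite /Zop -(badjP' bW).
Qed.

End KreinFormula.

(** * Stability and differentiability of resolvents *)

Section Perturbation.
Variable R : realType.
Local Notation C := R[i].
Variables (H K : hilbertType R) (D : completeNormedModType C).
Variables (iD : D -> H) (Astar : operator H).
Hypotheses (iD_linear : linear iD) (iD_inj : injective iD).
Variable Mi : R.
Hypotheses (Mi0 : 0 <= Mi) (iD_bound : opbound iD Mi).
Variables (T0 : D -> hprod K K) (Ac0 : operator H) (V0 : H -> H) (X0 Y0 : K -> K).
Hypothesis bd0 : boundary_data iD Astar T0 Ac0 V0 X0 Y0.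
Local Notation H0 := (operator_add Ac0 V0).

Record close_data (e : R) (T : D -> hprod K K) (V : H -> H) (X Y : K -> K) : Prop :=
  CloseData {
    cd_T : opbound (fun x => T x - T0 x) e;
    cd_V : opbound (fun x => V x - V0 x) e;
    cd_X : opbound (fun x => X x - X0 x) e;
    cd_Y : opbound (fun x => Y x - Y0 x) e }.

Lemma opbound_near (A B : normedModType C) (f g : A -> B) e M :
  opbound (fun x => f x - g x) e -> opbound g M -> opbound f (M + e).
Proof.
by move=> h hg x; have := opbound_add hg h x; rewrite addrC subrK.
Qed.

(** One constant for all data near the fixed one. It is 4 times that of [kerlift_lower_bound], so
    that $ce\le1$ becomes the smallness condition $1/4$ of [kerlift_lower_bound_near]. *)
Lemma phi_bound : exists2 c, 0 < c &
  forall T Ac V X Y e, boundary_data iD Astar T Ac V X Y -> 0 <= e -> c * e <= 1 ->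
    close_data e T V X Y -> forall f, row_op X Y f = 0 -> rnorm (Wop X Y f) <= c * rnorm f.
Proof.
have [c c0 hc] := kerlift_lower_bound (bd_X bd0) (bd_Y bd0) (bd_inv bd0).
exists (4 * c); first by rewrite mulr_gt0.
move=> T Ac V X Y e b e0 ce cd f hf.
have h : forall phi, rnorm phi <= 2 * c * rnorm (kerlift X Y phi).
  apply: (@kerlift_lower_bound_near _ _ X Y X0 Y0 c e).
  - exact: bd_X b.
  - exact: bd_Y b.
  - exact: bd_X bd0.
  - exact: bd_Y bd0.
  - by [].
  - exact: cd_X cd.
  - exact: cd_Y cd.
  - exact: ltW.
  - by move: ce; lra.
  - exact: hc.
have := h (Wop X Y f).
rewrite kerlift_Wop//; [|exact: bd_X b|exact: bd_Y b|exact: bd_sym b|exact: bd_inv b].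
have := mulr_ge0 (ltW c0) (rnorm_ge0 f); lra.
Qed.

Lemma form_estimate : exists e0 k, [/\ 0 < e0, 0 <= k &
  forall T Ac V X Y e, boundary_data iD Astar T Ac V X Y -> 0 <= e -> e <= e0 ->
    close_data e T V X Y -> forall u v, dom Ac0 (iD u) -> dom Ac (iD v) ->
    cabs ('[H0 (iD u), iD v] - '[iD u, operator_add Ac V (iD v)])
      <= e * k * (rnorm u * rnorm v)].
Proof.
have [c c0 hc] := phi_bound.
have [t t0 ht] := bounded_opbound (bd_T bd0).
have [mx mx0 hmx] := bounded_opbound (bd_X bd0).
have [my my0 hmy] := bounded_opbound (bd_Y bd0).
exists (Num.min 1 c^-1), (Mi ^+ 2 + (mx + my) * (c * t) * (c * (t + 1)) + (t + 1)).
split; first by rewrite lt_min ltr01 invr_gt0.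
  by rewrite !addr_ge0 ?exprn_ge0 ?mulr_ge0 ?addr_ge0// ltW.
move=> T Ac V X Y e b e0; rewrite le_min => /andP[e1 ec] cd u v du dv.
have ce : c * e <= 1 by rewrite mulrC -ler_pdivlMr// mul1r.
have hT : opbound T (t + 1).
  by apply: opboundW (opbound_near (cd_T cd) ht); rewrite lerD2l.
have ph0 : rnorm (Wop X0 Y0 (T0 u)) <= c * t * rnorm u.
  apply: le_trans (hc _ _ _ _ _ 0 bd0 (lexx _) _ _ _ (bd_row iD_inj bd0 du)) _.
  - by rewrite mulr0.
  - by split=> x; rewrite subrr rnorm0 mul0r.
  - by rewrite -mulrA ler_wpM2l// ltW.
have ph : rnorm (Wop X Y (T v)) <= c * (t + 1) * rnorm v.
  apply: le_trans (hc _ _ _ _ _ e b e0 ce cd _ (bd_row iD_inj b dv)) _.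
  by rewrite -mulrA ler_wpM2l// ltW.
rewrite (weak_krein iD_inj b bd0 du dv).
set a := Wop X0 Y0 (T0 u) in ph0 *; set p := Wop X Y (T v) in ph *.
have t1 : cabs '[V0 (iD u) - V (iD u), iD v] <= e * Mi ^+ 2 * (rnorm u * rnorm v).
  apply: le_trans (cabs_dot_le _ _) _; rewrite rdistC.
  apply: le_trans (ler_pM (rnorm_ge0 _) (rnorm_ge0 _) (cd_V cd _) (iD_bound v)) _.
  have -> : e * Mi ^+ 2 * (rnorm u * rnorm v) = e * (Mi * rnorm u) * (Mi * rnorm v) by ring.
  by rewrite ler_wpM2r ?mulr_ge0 ?rnorm_ge0// ler_wpM2l.
have t2 : cabs '[X (badj Y0 a) - Y (badj X0 a), p]
    <= e * ((mx + my) * (c * t) * (c * (t + 1))) * (rnorm u * rnorm v).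
  (* Subtracting $X_0Y_0^*=Y_0X_0^*$ shows that the boundary coefficient is of first order in
     [e]. *)
  have -> : X (badj Y0 a) - Y (badj X0 a)
      = (X (badj Y0 a) - X0 (badj Y0 a)) - (Y (badj X0 a) - Y0 (badj X0 a)).
    by rewrite (bd_sym bd0) opprB addrA subrK.
  apply: le_trans (cabs_dot_le _ _) _.
  have n1 : rnorm (X (badj Y0 a) - X0 (badj Y0 a) - (Y (badj X0 a) - Y0 (badj X0 a)))
      <= e * (my * rnorm a) + e * (mx * rnorm a).
    apply: le_trans (rnormB _ _) _; apply: lerD.
      apply: le_trans (cd_X cd _) _; rewrite ler_wpM2l//.
      exact: badj_opbound (bd_Y bd0) _ (ltW my0) hmy _.
    apply: le_trans (cd_Y cd _) _; rewrite ler_wpM2l//.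
    exact: badj_opbound (bd_X bd0) _ (ltW mx0) hmx _.
  apply: le_trans (ler_pM (rnorm_ge0 _) (rnorm_ge0 _) n1 ph) _.
  have -> : e * ((mx + my) * (c * t) * (c * (t + 1))) * (rnorm u * rnorm v)
      = e * (my + mx) * (c * t * rnorm u) * (c * (t + 1) * rnorm v) by ring.
  have -> : e * (my * rnorm a) + e * (mx * rnorm a) = e * (my + mx) * rnorm a by ring.
  apply: ler_wpM2r; first by rewrite !mulr_ge0 ?addr_ge0 ?rnorm_ge0// ltW.
  by apply: ler_wpM2l => //; rewrite mulr_ge0// addr_ge0// ltW.
have t3 : cabs '[Jop (T u - T0 u), T v] <= e * (t + 1) * (rnorm u * rnorm v).
  apply: le_trans (cabs_dot_le _ _) _; rewrite rnorm_Jop.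
  apply: le_trans (ler_pM (rnorm_ge0 _) (rnorm_ge0 _) (cd_T cd _) (hT v)) _.
  by rewrite le_eqVlt; apply/orP; left; apply/eqP; ring.
apply: le_trans (cabsD _ _) _.
apply: le_trans (lerD (le_trans (cabsD _ _) (lerD t1 t2)) t3) _.
by rewrite le_eqVlt; apply/orP; left; apply/eqP; ring.
Qed.

(** Writes $v=(\mathcal A-\mathbf i)^{-1}(\mathcal A-\mathbf i)v$; the three summands of
    [k + cabs w + 1] pay for [V], [w] and $\mathbf i$. *)
Lemma unembed_bound (T : D -> hprod K K) Ac V (X Y : K -> K) w M k c : boundary_data iD Astar T Ac V X Y ->
  0 <= M -> opbound (fun h => unembed iD (resolvent Ac 'i h)) M ->
  opbound V k -> 0 <= k -> 
  forall v, dom Ac (iD v) -> rnorm (iD v) <= c ->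
  rnorm v <= M * (rnorm (operator_add Ac V (iD v) - w *: iD v) + (k + cabs w + 1) * c).
Proof.
move=> b M0 hM hV k0 v dv vc; have ri := resolvent_set_i (bd_hermitian b).
have {1}-> : v = unembed iD (resolvent Ac 'i (Ac (iD v) - 'i *: iD v)).
  by rewrite (resolvent_unique ri dv erefl) unembedK.
apply: le_trans (hM _) _; rewrite ler_wpM2l//.
have -> : Ac (iD v) - 'i *: iD v
    = (operator_add Ac V (iD v) - w *: iD v) - V (iD v) + w *: iD v - 'i *: iD v.
  by rewrite [_ - V _]addrAC subrK /= addrK.
have ci : cabs ('i : C) = 1 by rewrite /cabs normCi.
have w0 := cabs_ge0 w.
apply: le_trans (rnormB _ _) _; rewrite rnormZ ci mul1r.
have e1 := rnormD (operator_add Ac V (iD v) - w *: iD v - V (iD v)) (w *: iD v).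
have e2 := rnormB (operator_add Ac V (iD v) - w *: iD v) (V (iD v)).
have e3 : rnorm (V (iD v)) <= k * c by apply: le_trans (hV _) _; rewrite ler_wpM2l.
have e4 : rnorm (w *: iD v) <= cabs w * c by rewrite rnormZ ler_wpM2l.
move: e1 e2 e3 e4 vc; lra.
Qed.

Lemma stability_at w M : 0 <= M -> ~ spectrum H0 w -> exists e0 c, [/\ 0 < e0, 0 <= c &
  forall T Ac V X Y e, boundary_data iD Astar T Ac V X Y -> 0 <= e -> e <= e0 ->
    close_data e T V X Y -> opbound (fun h => unembed iD (resolvent Ac 'i h)) M ->
    lower_bound (operator_add Ac V) w c].
Proof.
move=> M0 rw; have [e1 [k [e10 k0 hk]]] := form_estimate.
have hH0 := bd_hermitian_add bd0; have rwb := resolvent_set_conj hH0 rw.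
have [c1 c10 hc1] := bounded_opbound (resolvent_bounded rwb).
have [cd cd0 hcd] := bounded_opbound (unembed_resolvent_bounded (B := H0)
  iD_linear iD_inj bd0 erefl rwb iD_bound).
have [v0 v00 hv0] := bounded_opbound (bd_V bd0).
set q := v0 + 1 + cabs w + 1.
have q0 : 0 < q by rewrite /q; have := cabs_ge0 w; lra.
set s := k * cd * M.
have s0 : 0 <= s by rewrite !mulr_ge0// ltW.
(* The last entry gives $e\,sq\le1/2$, so that half of the norm of [iD v] is absorbed on the left of
   the final inequality. *)
exists (Num.min (Num.min 1 e1) (2 * (s * q) + 1)^-1), (2 * (s + c1)).
have sq0 : 0 <= s * q by rewrite mulr_ge0// ltW.
have sq1 : 0 < 2 * (s * q) + 1 by rewrite ltr_wpDl// mulr_ge0.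
split; first by rewrite !lt_min ltr01 e10 invr_gt0.
  by rewrite mulr_ge0// addr_ge0// ltW.
move=> T Ac V X Y e b e0; rewrite !le_min => /andP[/andP[ee1 ee2] ee3] cdt hAR x dx.
have esq : e * (s * q) <= 1 / 2.
  have : e * (2 * (s * q) + 1) <= 1 by rewrite -ler_pdivlMr// mul1r.
  move: e0; lra.
have xE := bd_embedK iD_inj b dx; set v := unembed iD x in xE.
rewrite -xE in dx *.
have hV : opbound V (v0 + 1).
  by apply: opboundW (opbound_near (cd_V cdt) hv0); rewrite lerD2l.
set y := operator_add Ac V (iD v) - w *: iD v.
have bv : rnorm v <= M * (rnorm y + q * rnorm (iD v)).
  by apply: (unembed_bound w b M0 hAR hV) => //; rewrite addr_ge0// ltW.
have main : rnorm (iD v) <= e * k * (cd * rnorm v) + c1 * rnorm y.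
  apply: rnorm_le_rdot; first by rewrite !addr_ge0 ?mulr_ge0 ?rnorm_ge0// ltW.
  move=> g; apply: le_trans (Re_le_cabs _) _; rewrite dotC cabs_conj.
  set u := unembed iD (resolvent H0 w^* g).
  have uE : iD u = resolvent H0 w^* g by exact: (embed_resolvent (B := H0) iD_inj bd0 erefl rwb).
  have du : dom Ac0 (iD u) by exact: (dom_embed_resolvent (B := H0) iD_inj bd0 erefl rwb).
  have -> : '[g, iD v] = ('[H0 (iD u), iD v] - '[iD u, operator_add Ac V (iD v)]) + '[iD u, y].
    rewrite /y uE resolvent_eq// dotBr dotDl dotZl dotZr; ring.
  apply: le_trans (cabsD _ _) _.
  rewrite mulrDl; apply: lerD.
    apply: le_trans (hk _ _ _ _ _ e b e0 ee2 cdt _ _ du dx) _.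
    rewrite -[leRHS]mulrA ler_wpM2l ?mulr_ge0//.
    by rewrite -[leRHS]mulrA [rnorm v * _]mulrC mulrA ler_wpM2r ?rnorm_ge0// hcd.
  apply: le_trans (cabs_dot_le _ _) _; rewrite [leRHS]mulrAC ler_wpM2r ?rnorm_ge0//.
  by rewrite uE.
have ek : 0 <= e * k * cd by rewrite !mulr_ge0// ltW.
have bve := ler_wpM2l ek bv.
have E : e * k * cd * (M * (rnorm y + q * rnorm (iD v)))
    = e * s * rnorm y + e * (s * q) * rnorm (iD v) by rewrite /s; ring.
have h1 := ler_wpM2r (rnorm_ge0 (iD v)) esq.
have h2 : e * s * rnorm y <= s * rnorm y.
  by rewrite ler_wpM2r ?rnorm_ge0// ler_piMl.
move: main bve; rewrite E [e * k * (cd * _)]mulrA; move: h1 h2; lra.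
Qed.

(** [resolvent_criterion] asks for the lower bound at [w] and at [w^*], hence two applications and
    the sum of two constants. *)
Lemma stability w M : 0 <= M -> ~ spectrum H0 w -> exists e0 c, [/\ 0 < e0, 0 <= c &
  forall T Ac V X Y e, boundary_data iD Astar T Ac V X Y -> 0 <= e -> e <= e0 ->
    close_data e T V X Y -> opbound (fun h => unembed iD (resolvent Ac 'i h)) M ->
    ~ spectrum (operator_add Ac V) w /\ lower_bound (operator_add Ac V) w c].
Proof.
move=> M0 rw; have rwb := resolvent_set_conj (bd_hermitian_add bd0) rw.
have [e1 [c1 [e10 c10 h1]]] := stability_at M0 rw.
have [e2 [c2 [e20 c20 h2]]] := stability_at M0 rwb.
exists (Num.min e1 e2), (c1 + c2); split; rewrite ?lt_min ?e10// ?addr_ge0//.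
move=> T Ac V X Y e b e0; rewrite le_min => /andP[ee1 ee2] cd hAR.
have l1 := h1 T Ac V X Y e b e0 ee1 cd hAR.
have l2 := h2 T Ac V X Y e b e0 ee2 cd hAR.
have l1' : lower_bound (operator_add Ac V) w (c1 + c2).
  by move=> u du; apply: le_trans (l1 u du) _; rewrite ler_wpM2r ?rnorm_ge0// lerDl.
split=> //; apply: (resolvent_criterion (bd_hermitian_add b) _ l1').
  by rewrite addr_ge0.
by move=> u du; apply: le_trans (l2 u du) _; rewrite ler_wpM2r ?rnorm_ge0// lerDr.
Qed.

Lemma unembed_resolvent_near w M : 0 <= M -> ~ spectrum H0 w ->
  exists e0 k, [/\ 0 < e0, 0 <= k &
  forall T Ac V X Y e, boundary_data iD Astar T Ac V X Y -> 0 <= e -> e <= e0 ->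
    close_data e T V X Y -> opbound (fun h => unembed iD (resolvent Ac 'i h)) M ->
    [/\ ~ spectrum (operator_add Ac V) w,
        opbound (resolvent (operator_add Ac V) w) k &
        opbound (fun h => unembed iD (resolvent (operator_add Ac V) w h)) k]].
Proof.
move=> M0 rw; have [e1 [c [e10 c0 hc]]] := stability M0 rw.
have [v0 v00 hv0] := bounded_opbound (bd_V bd0).
have cw := cabs_ge0 w.
have k0 : 0 <= M * (1 + (v0 + 1 + cabs w + 1) * c).
  by rewrite mulr_ge0// addr_ge0// mulr_ge0// !addr_ge0// ltW.
exists (Num.min 1 e1), (c + M * (1 + (v0 + 1 + cabs w + 1) * c)).
split; rewrite ?lt_min ?ltr01// ?addr_ge0//.
move=> T Ac V X Y e b e0; rewrite le_min => /andP[e1' ee1] cd hAR.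
have [rT lT] := hc T Ac V X Y e b e0 ee1 cd hAR.
have hR := resolvent_opbound rT lT.
have hV : opbound V (v0 + 1).
  by apply: opboundW (opbound_near (cd_V cd) hv0); rewrite lerD2l.
split=> //; first by apply: opboundW hR; rewrite lerDl.
move=> h; set v := unembed iD _.
have vE : iD v = resolvent (operator_add Ac V) w h.
  exact: (embed_resolvent (B := operator_add Ac V) iD_inj b erefl rT).
have dv : dom Ac (iD v).
  exact: (dom_embed_resolvent (B := operator_add Ac V) iD_inj b erefl rT).
have vb : rnorm (iD v) <= c * rnorm h by rewrite vE; exact: hR.
have v1 : 0 <= v0 + 1 by rewrite addr_ge0// ltW.
apply: le_trans (unembed_bound w b M0 hAR hV v1 dv vb) _.
rewrite vE (resolvent_eq rT) addrK.
have -> : M * (rnorm h + (v0 + 1 + cabs w + 1) * (c * rnorm h))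
   = M * (1 + (v0 + 1 + cabs w + 1) * c) * rnorm h by ring.
by rewrite ler_wpM2r ?rnorm_ge0// lerDr.
Qed.

(** The uniform bound on $R_t(\bar w)$ in the norm of [D] turns the form estimate into a Lipschitz
    estimate of the resolvent. *)
Lemma resolvent_near w M : 0 <= M -> ~ spectrum H0 w ->
  exists e0 k, [/\ 0 < e0, 0 <= k &
  forall T Ac V X Y e, boundary_data iD Astar T Ac V X Y -> 0 <= e -> e <= e0 ->
    close_data e T V X Y -> opbound (fun h => unembed iD (resolvent Ac 'i h)) M ->
    ~ spectrum (operator_add Ac V) w /\
    opbound (fun h => resolvent (operator_add Ac V) w h - resolvent H0 w h) (e * k)].
Proof.
move=> M0 rw; have hH0 := bd_hermitian_add bd0; have rwb := resolvent_set_conj hH0 rw.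
have [e1 [k1 [e10 k10 h1]]] := unembed_resolvent_near M0 rwb.
have [e2 [k2 [e20 k20 h2]]] := form_estimate.
have [cd cd0 hcd] := bounded_opbound (unembed_resolvent_bounded (B := H0)
  iD_linear iD_inj bd0 erefl rw iD_bound).
exists (Num.min e1 e2), (k2 * (cd * k1)); split; rewrite ?lt_min ?e10//.
  by rewrite !mulr_ge0// ltW.
move=> T Ac V X Y e b e0; rewrite le_min => /andP[ee1 ee2] cdt hAR.
have [rTb hR hD] := h1 T Ac V X Y e b e0 ee1 cdt hAR.
have rT : ~ spectrum (operator_add Ac V) w.
  by rewrite -[w]conjCK; exact: (resolvent_set_conj (bd_hermitian_add b)).
split=> // h; apply: rnorm_le_rdot; first by rewrite !mulr_ge0 ?rnorm_ge0// ltW.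
move=> g; apply: le_trans (Re_le_cabs _) _.
set u := unembed iD (resolvent H0 w h).
set v := unembed iD (resolvent (operator_add Ac V) w^* g).
have uE : iD u = resolvent H0 w h by exact: (embed_resolvent (B := H0) iD_inj bd0 erefl rw).
have du : dom Ac0 (iD u) by exact: (dom_embed_resolvent (B := H0) iD_inj bd0 erefl rw).
have vE : iD v = resolvent (operator_add Ac V) w^* g.
  exact: (embed_resolvent (B := operator_add Ac V) iD_inj b erefl rTb).
have dv : dom Ac (iD v).
  exact: (dom_embed_resolvent (B := operator_add Ac V) iD_inj b erefl rTb).
have -> : '[resolvent (operator_add Ac V) w h - resolvent H0 w h, g]
    = '[H0 (iD u), iD v] - '[iD u, operator_add Ac V (iD v)].
  rewrite dotBl (resolvent_adjoint (bd_hermitian_add b))// uE vE.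
  by rewrite !resolvent_eq// dotDl dotDr dotZl dotZr conjCK; ring.
apply: le_trans (h2 _ _ _ _ _ e b e0 ee2 cdt _ _ du dv) _.
have -> : e * (k2 * (cd * k1)) * rnorm h * rnorm g
    = e * k2 * (cd * rnorm h * (k1 * rnorm g)) by ring.
rewrite ler_wpM2l ?mulr_ge0//.
by apply: ler_pM; rewrite ?rnorm_ge0//; [exact: hcd|exact: hD].
Qed.

(** Continuity into [D], and not only into [H]: for the derivative, the traces of $R_t(\bar w)g$
    must converge. *)
Lemma unembed_resolvent_close w M : 0 <= M -> ~ spectrum H0 w ->
  exists e0 k, [/\ 0 < e0, 0 <= k &
  forall T Ac V X Y e, boundary_data iD Astar T Ac V X Y -> 0 <= e -> e <= e0 ->
    close_data e T V X Y -> opbound (fun h => unembed iD (resolvent Ac 'i h)) M ->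
    opbound (fun h => unembed iD (resolvent Ac 'i h) - unembed iD (resolvent Ac0 'i h)) e ->
    opbound (fun h => unembed iD (resolvent (operator_add Ac V) w h)
                      - unembed iD (resolvent H0 w h)) (e * k)].
Proof.
move=> M0 rw.
have [e1 [k1 [e10 k10 h1]]] := unembed_resolvent_near M0 rw.
have [e2 [k2 [e20 k20 h2]]] := resolvent_near M0 rw.
have [v0 v00 hv0] := bounded_opbound (bd_V bd0).
have [c c0 hc] := bounded_opbound (resolvent_bounded rw).
have cw := cabs_ge0 (w - 'i); set q := cabs (w - 'i) in cw *.
exists (Num.min e1 e2), (M * (k1 + v0 * k2 + q * k2) + (1 + (v0 + q) * c)).
split; rewrite ?lt_min ?e10//.
  by rewrite !(addr_ge0, mulr_ge0)// ltW.
move=> T Ac V X Y e b e0; rewrite le_min => /andP[ee1 ee2] cdt hAR hARe h.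
have [rT hR hD] := h1 T Ac V X Y e b e0 ee1 cdt hAR.
have [_ hRR] := h2 T Ac V X Y e b e0 ee2 cdt hAR.
rewrite (unembed_resolvent_set b _ rT) (unembed_resolvent_set bd0 _ rw).
set r := resolvent (operator_add Ac V) w h; set r0 := resolvent H0 w h.
set p := h - (V r - _); set p0 := h - (V0 r0 - _).
have lAR : linear (fun h => unembed iD (resolvent Ac 'i h)).
  exact: (unembed_resolvent_linear (B := Ac) iD_linear iD_inj b erefl
    (resolvent_set_i (bd_hermitian b))).
(* First the argument changes under the operator of the new datum, then the operator changes at the
   argument [p0]. *)
apply: le_trans (rnormBt (unembed iD (resolvent Ac 'i p0)) _ _) _.
have rr : rnorm (r - r0) <= e * k2 * rnorm h by exact: hRR.
have b1 : rnorm (unembed iD (resolvent Ac 'i p) - unembed iD (resolvent Ac 'i p0))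
    <= M * (e * (k1 + v0 * k2 + q * k2) * rnorm h).
  rewrite -(linear_mapB lAR); apply: le_trans (hAR _) _; rewrite ler_wpM2l//.
  have -> : p - p0 = (w - 'i) *: (r - r0) - ((V r - V0 r) + V0 (r - r0)).
    rewrite (linear_mapB (bounded_linear (bd_V bd0))) /p /p0 scalerBr.
    rewrite [V r - V0 r + _]addrA subrK.
    rewrite [- (h - _)]opprD addrACA subrr add0r opprK [- (V r - (w - 'i) *: r)]opprB.
    rewrite [- (V r - V0 r0)]opprB addrACA [in RHS]addrACA.
    by rewrite [- V r + _]addrC.
  apply: le_trans (rnormB _ _) _; rewrite rnormZ -/q.
  have f1 := ler_wpM2l cw rr.
  have f2 := rnormD (V r - V0 r) (V0 (r - r0)).
  have f3 : rnorm (V r - V0 r) <= e * (k1 * rnorm h).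
    by apply: le_trans (cd_V cdt r) _; rewrite ler_wpM2l//; exact: hR.
  have f4 : rnorm (V0 (r - r0)) <= v0 * (e * k2 * rnorm h).
    by apply: le_trans (hv0 _) _; rewrite ler_wpM2l// ltW.
  by move: f1 f2 f3 f4; lra.
have b2 : rnorm (unembed iD (resolvent Ac 'i p0) - unembed iD (resolvent Ac0 'i p0))
    <= e * ((1 + (v0 + q) * c) * rnorm h).
  apply: le_trans (hARe _) _; rewrite ler_wpM2l//.
  apply: le_trans (rnormB _ _) _.
  have g1 : rnorm r0 <= c * rnorm h by exact: hc.
  have g2 := rnormB (V0 r0) ((w - 'i) *: r0); rewrite rnormZ -/q in g2.
  have g3 : rnorm (V0 r0) <= v0 * (c * rnorm h).
    by apply: le_trans (hv0 _) _; rewrite ler_wpM2l// ltW.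
  have g4 := ler_wpM2l cw g1.
  by move: g1 g2 g3 g4; lra.
apply: le_trans (lerD b1 b2) _.
by rewrite le_eqVlt; apply/orP; left; apply/eqP; ring.
Qed.

(* The three quantities entering the weak form of the Krein formula at the
   second argument: the vector, its trace and the parameter of the trace. *)
Lemma trace_close w M : 0 <= M -> ~ spectrum H0 w ->
  exists e0 k, [/\ 0 < e0, 0 <= k &
  forall T Ac V X Y e, boundary_data iD Astar T Ac V X Y -> 0 <= e -> e <= e0 ->
    close_data e T V X Y -> opbound (fun h => unembed iD (resolvent Ac 'i h)) M ->
    opbound (fun h => unembed iD (resolvent Ac 'i h) - unembed iD (resolvent Ac0 'i h)) e ->
    forall h, let v := unembed iD (resolvent (operator_add Ac V) w h) in
      let v0 := unembed iD (resolvent H0 w h) in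
      [/\ rnorm (iD v) <= k * rnorm h /\ rnorm (iD v - iD v0) <= e * k * rnorm h,
          rnorm (T v) <= k * rnorm h /\ rnorm (T v - T0 v0) <= e * k * rnorm h &
          rnorm (Wop X Y (T v)) <= k * rnorm h /\
          rnorm (Wop X Y (T v) - Wop X0 Y0 (T0 v0)) <= e * k * rnorm h]].
Proof.
move=> M0 rw.
have [e1 [k1 [e10 k10 h1]]] := unembed_resolvent_near M0 rw.
have [e2 [k2 [e20 k20 h2]]] := unembed_resolvent_close M0 rw.
have [c c0 hc] := phi_bound.
have [t t0 ht] := bounded_opbound (bd_T bd0).
have [cd cd0 hcd] := bounded_opbound (unembed_resolvent_bounded (B := H0)
  iD_linear iD_inj bd0 erefl rw iD_bound).
have t1 : 0 < t + 1 by rewrite addr_gt0.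
pose kT := k1 + t * k2.
have kT0 : 0 <= kT by rewrite addr_ge0// mulr_ge0// ltW.
pose kW := c * (kT + 2 * (c * (t * cd))).
have kW0 : 0 <= kW by rewrite mulr_ge0 ?(ltW c0)// addr_ge0// !mulr_ge0// ltW.
pose a1 := Mi * k1; pose a2 := Mi * k2; pose a3 := (t + 1) * k1; pose a4 := c * a3.
have a10 : 0 <= a1 by rewrite mulr_ge0.
have a20 : 0 <= a2 by rewrite mulr_ge0.
have a30 : 0 <= a3 by rewrite mulr_ge0// ltW.
have a40 : 0 <= a4 by rewrite mulr_ge0// ltW.
exists (Num.min (Num.min e1 e2) (Num.min 1 c^-1)), (a1 + a2 + a3 + a4 + kT + kW); split.
- by rewrite !lt_min e10 e20 ltr01 invr_gt0.
- by do 5 (apply: addr_ge0 => //).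
move=> T Ac V X Y e b e0; rewrite !le_min => /andP[/andP[ee1 ee2] /andP[e1' ec]] cdt hAR hARe h.
have [rT _ hD] := h1 T Ac V X Y e b e0 ee1 cdt hAR.
have hDe := h2 T Ac V X Y e b e0 ee2 cdt hAR hARe.
have hT : opbound T (t + 1).
  by apply: opboundW (opbound_near (cd_T cdt) ht); rewrite lerD2l.
have ce : c * e <= 1 by rewrite mulrC -ler_pdivlMr// mul1r.
move=> v v0; have n0 := rnorm_ge0 h.
have vk : rnorm v <= k1 * rnorm h by exact: hD.
have vv : rnorm (v - v0) <= e * k2 * rnorm h by exact: hDe.
have v0k : rnorm v0 <= cd * rnorm h by exact: hcd.
have dv : dom Ac (iD v).
  exact: (dom_embed_resolvent (B := operator_add Ac V) iD_inj b erefl rT).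
have dv0 : dom Ac0 (iD v0).
  exact: (dom_embed_resolvent (B := H0) iD_inj bd0 erefl rw).
have w1 : rnorm (iD v) <= a1 * rnorm h.
  by apply: le_trans (iD_bound _) _; rewrite -mulrA ler_wpM2l.
have w2 : rnorm (iD v - iD v0) <= e * a2 * rnorm h.
  rewrite -(linear_mapB iD_linear); apply: le_trans (iD_bound _) _.
  by apply: le_trans (ler_wpM2l Mi0 vv) _; rewrite /a2 le_eqVlt; apply/orP; left; apply/eqP; ring.
have w3 : rnorm (T v) <= a3 * rnorm h.
  by apply: le_trans (hT _) _; rewrite -mulrA ler_wpM2l// ltW.
have w4 : rnorm (T v - T0 v0) <= e * kT * rnorm h.
  apply: le_trans (rnormBt (T0 v) _ _) _.
  rewrite -(linear_mapB (bounded_linear (bd_T bd0))).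
  have f1 := le_trans (cd_T cdt v) (ler_wpM2l e0 vk).
  have f2 := le_trans (ht _) (ler_wpM2l (ltW t0) vv).
  by apply: le_trans (lerD f1 f2) _; rewrite /kT le_eqVlt; apply/orP; left; apply/eqP; ring.
have rv := bd_row iD_inj b dv.
have w5 : rnorm (Wop X Y (T v)) <= a4 * rnorm h.
  apply: le_trans (hc _ _ _ _ _ e b e0 ce cdt _ rv) _.
  by rewrite -mulrA ler_wpM2l// ltW.
set p0 := Wop X0 Y0 (T0 v0).
have cd00 : close_data 0 T0 V0 X0 Y0 by split=> x; rewrite subrr rnorm0 mul0r.
have p0k : rnorm p0 <= c * (t * cd) * rnorm h.
  apply: le_trans (hc _ _ _ _ _ 0 bd0 (lexx _) _ cd00 _ (bd_row iD_inj bd0 dv0)) _.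
    by rewrite mulr0.
  rewrite -!mulrA ler_wpM2l ?(ltW c0)//; apply: le_trans (ht _) _.
  by rewrite ler_wpM2l// ltW.
have w6 : rnorm (Wop X Y (T v) - p0) <= e * kW * rnorm h.
  (* The lift of [d] is in $\ker[X,Y]$, so [phi_bound] applies to it; it is a difference of traces
     up to the change of the lift at [p0]. *)
  set d := Wop X Y (T v) - p0.
  have rd : row_op X Y (kerlift X Y d) = 0.
    exact: (row_kerlift (bd_X b) (bd_sym b)).
  have := hc _ _ _ _ _ e b e0 ce cdt _ rd.
  rewrite (Wop_kerlift (bd_X b) (bd_Y b) (bd_inv b)).
  move/le_trans; apply.
  have -> : kerlift X Y d = (T v - T0 v0) - (kerlift X Y p0 - kerlift X0 Y0 p0).
    rewrite (linear_mapB (kerlift_linear (bd_X b) (bd_Y b))) -(bd_kerlift iD_inj b dv).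
    by rewrite -(bd_kerlift iD_inj bd0 dv0) opprB addrA subrK.
  have f1 := rnormB (T v - T0 v0) (kerlift X Y p0 - kerlift X0 Y0 p0).
  have f2 := kerlift_sub_opbound (bd_X b) (bd_Y b) (bd_X bd0) (bd_Y bd0) e0
    (cd_X cdt) (cd_Y cdt) p0.
  have e2' : 0 <= 2 * e by rewrite mulr_ge0.
  have f3 := ler_wpM2l e2' p0k.
  have := ler_wpM2l (ltW c0) (le_trans f1 (lerD w4 (le_trans f2 f3))).
  move/le_trans; apply.
  by rewrite /kW le_eqVlt; apply/orP; left; apply/eqP; ring.
have up (a b' : R) : a <= b' -> e * a * rnorm h <= e * b' * rnorm h.
  by move=> ab; rewrite ler_wpM2r// ler_wpM2l.
have up' (a b' : R) : a <= b' -> a * rnorm h <= b' * rnorm h.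
  by move=> ab; rewrite ler_wpM2r.
split; split.
- by apply: le_trans w1 _; apply: up'; lra.
- by apply: le_trans w2 _; apply: up; lra.
- by apply: le_trans w3 _; apply: up'; lra.
- by apply: le_trans w4 _; apply: up; lra.
- by apply: le_trans w5 _; apply: up'; lra.
- by apply: le_trans w6 _; apply: up; lra.
Qed.

End Perturbation.

(** * The derivative of the resolvent *)

Section ResolventDerivative.
Variable R : realType.
Local Notation C := R[i].
Variables (H K : hilbertType R) (D : completeNormedModType C).
Variables (iD : D -> H) (Astar : operator H).
Hypotheses (iD_linear : linear iD) (iD_inj : injective iD).
Variable Mi : R.
Hypotheses (Mi0 : 0 <= Mi) (iD_bound : opbound iD Mi).
Variables (T0 : D -> hprod K K) (Ac0 : operator H) (V0 : H -> H) (X0 Y0 : K -> K).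
Hypothesis bd0 : boundary_data iD Astar T0 Ac0 V0 X0 Y0.
Local Notation H0 := (operator_add Ac0 V0).
Variables (T' : D -> hprod K K) (V' : H -> H) (X' Y' : K -> K).
Hypotheses (bT' : bounded_operator T') (bV' : bounded_operator V').
Hypotheses (bX' : bounded_operator X') (bY' : bounded_operator Y').

Lemma dot_sub_le (X : hilbertType R) (x x' y y0 : X) (a b c d : R) :
  rnorm (x - x') <= a -> rnorm y <= b -> rnorm x' <= c -> rnorm (y - y0) <= d ->
  cabs ('[x, y] - '[x', y0]) <= a * b + c * d.
Proof.
move=> ha hb hc hd.
have -> : '[x, y] - '[x', y0] = '[x - x', y] + '[x', y - y0].
  by rewrite dotBl dotBr addrA subrK.
apply: le_trans (cabsD _ _) _.
by apply: lerD; apply: le_trans (cabs_dot_le _ _) _; apply: ler_pM; rewrite ?rnorm_ge0.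
Qed.

Section Formula.
Variable w : C.
Hypothesis rw : ~ spectrum H0 w.
Let R0 := resolvent H0 w.
Let TRb h := T0 (unembed iD (resolvent H0 w^* h)).
Let W0 := Wop X0 Y0.
Let u h := unembed iD (R0 h).

Definition resolvent_dot (h : H) : H :=
  - R0 (V' (R0 h))
  + badj TRb (badj W0 (X' (badj Y0 (W0 (T0 (u h)))) - Y' (badj X0 (W0 (T0 (u h))))))
  + badj TRb (Jop (T' (u h))).

Let rwb : ~ spectrum H0 w^*.
Proof. exact: (resolvent_set_conj (bd_hermitian_add bd0)). Qed.

Let bTRb : bounded_operator TRb.
Proof.
exact: (bounded_comp (bd_T bd0) (unembed_resolvent_bounded (B := H0)
  iD_linear iD_inj bd0 erefl rwb iD_bound)).
Qed.

Let bu : bounded_operator u.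
Proof.
exact: (unembed_resolvent_bounded (B := H0) iD_linear iD_inj bd0 erefl rw iD_bound).
Qed.

Let bW0 : bounded_operator W0.
Proof. exact: (Wop_bounded (bd_X bd0) (bd_Y bd0) (bd_inv bd0)). Qed.

Lemma resolvent_dot_bounded : bounded_operator resolvent_dot.
Proof.
have bR := resolvent_bounded rw.
have bWT : bounded_operator (fun h => W0 (T0 (u h))).
  exact: (bounded_comp bW0 (bounded_comp (bd_T bd0) bu)).
apply: bounded_add; first apply: bounded_add.
- exact: (bounded_opp (bounded_comp bR (bounded_comp bV' bR))).
- apply: (bounded_comp (badj_bounded bTRb)); apply: (bounded_comp (badj_bounded bW0)).
  apply: bounded_sub; [apply: (bounded_comp bX')|apply: (bounded_comp bY')].
    exact: (bounded_comp (badj_bounded (bd_Y bd0)) bWT).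
  exact: (bounded_comp (badj_bounded (bd_X bd0)) bWT).
- apply: (bounded_comp (badj_bounded bTRb)); apply: (bounded_comp (Jop_bounded K)).
  exact: (bounded_comp bT' bu).
Qed.

Lemma dot_resolvent_dot h g :
  let v := unembed iD (resolvent H0 w^* g) in
  '[resolvent_dot h, g] = - '[V' (R0 h), iD v]
    + '[X' (badj Y0 (W0 (T0 (u h)))) - Y' (badj X0 (W0 (T0 (u h)))), W0 (T0 v)]
    + '[Jop (T' (u h)), T0 v].
Proof.
move=> v; have vE : iD v = resolvent H0 w^* g.
  exact: (embed_resolvent (B := H0) iD_inj bd0 erefl rwb).
rewrite /resolvent_dot 2![in LHS]dotDl -!(badjP' bTRb) -(badjP' bW0) dotNl.
by rewrite (resolvent_adjoint (bd_hermitian_add bd0))// vE.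
Qed.

(** [s] plays the role of $(t-t_0)^{-1}$. In the weak formula $u=R_0h$ stays fixed, so the
    difference quotients act on fixed vectors, and only $v=R_t(\bar w)g$ with its trace and
    parameter has to converge, which is [trace_close]. *)
Lemma resolvent_derivative M : 0 <= M -> exists e0 k, [/\ 0 < e0, 0 <= k &
  forall T Ac V X Y e (s : R), boundary_data iD Astar T Ac V X Y -> 0 <= e -> e <= e0 ->
    close_data T0 V0 X0 Y0 e T V X Y ->
    opbound (fun h => unembed iD (resolvent Ac 'i h)) M ->
    opbound (fun h => unembed iD (resolvent Ac 'i h) - unembed iD (resolvent Ac0 'i h)) e ->
    opbound (fun x => s%:C%C *: (T x - T0 x) - T' x) e ->
    opbound (fun x => s%:C%C *: (V x - V0 x) - V' x) e ->
    opbound (fun x => s%:C%C *: (X x - X0 x) - X' x) e ->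
    opbound (fun x => s%:C%C *: (Y x - Y0 x) - Y' x) e ->
    opbound (fun h => s%:C%C *: (resolvent (operator_add Ac V) w h - R0 h)
                      - resolvent_dot h) (e * k)].
Proof.
move=> M0.
have [e1 [k [e10 k0 h1]]] := trace_close iD_linear iD_inj Mi0 iD_bound bd0 M0 rwb.
have [e2 [k2 [e20 k20 h2]]] := stability iD_linear iD_inj Mi0 iD_bound bd0 M0 rw.
have [r r0 hr] := bounded_opbound (resolvent_bounded rw).
have [cu cu0 hcu] := bounded_opbound bu.
have [a a0 ha] := bounded_opbound (bounded_comp bW0 (bounded_comp (bd_T bd0) bu)).
have [mx mx0 hmx] := bounded_opbound (bd_X bd0).
have [my my0 hmy] := bounded_opbound (bd_Y bd0).
have [t' t'0 ht'] := bounded_opbound bT'.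
have [v' v'0 hv'] := bounded_opbound bV'.
have [x' x'0 hx'] := bounded_opbound bX'.
have [y' y'0 hy'] := bounded_opbound bY'.
exists (Num.min e1 e2), ((r + v' * r + (my * a + mx * a) + (x' * (my * a) + y' * (mx * a))
  + cu + t' * cu) * k).
split; first by rewrite lt_min e10.
  by rewrite mulr_ge0// !(addr_ge0, mulr_ge0)// ltW.
move=> T Ac V X Y e s b e0; rewrite le_min => /andP[ee1 ee2] cdt hAR hARe qT qV qX qY h.
have [rT _] := h2 T Ac V X Y e b e0 ee2 cdt hAR.
have rTb := resolvent_set_conj (bd_hermitian_add b) rT.
have n0 := rnorm_ge0 h.
apply: rnorm_le_rdot.
  by rewrite !mulr_ge0// !(addr_ge0, mulr_ge0)// ltW.
move=> g; apply: le_trans (Re_le_cabs _) _.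
have [] := h1 T Ac V X Y e b e0 ee1 cdt hAR hARe g.
set v := unembed iD (resolvent (operator_add Ac V) w^* g).
set v0 := unembed iD (resolvent H0 w^* g).
move=> [iv iv0] [Tv Tv0] [Wv Wv0].
rewrite dotBl dotZl dot_resolvent_dot -/v0.
have uE : iD (u h) = R0 h by exact: (embed_resolvent (B := H0) iD_inj bd0 erefl rw).
have du : dom Ac0 (iD (u h)) by exact: (dom_embed_resolvent (B := H0) iD_inj bd0 erefl rw).
have vE : iD v = resolvent (operator_add Ac V) w^* g.
  exact: (embed_resolvent (B := operator_add Ac V) iD_inj b erefl rTb).
have dv : dom Ac (iD v).
  exact: (dom_embed_resolvent (B := operator_add Ac V) iD_inj b erefl rTb).
have -> : '[resolvent (operator_add Ac V) w h - R0 h, g]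
    = '[H0 (iD (u h)), iD v] - '[iD (u h), operator_add Ac V (iD v)].
  rewrite dotBl (resolvent_adjoint (bd_hermitian_add b))// uE vE.
  by rewrite /R0 !resolvent_eq// dotDl dotDr dotZl dotZr conjCK; ring.
rewrite (weak_krein iD_inj b bd0 du dv) uE -/(R0 h) -/(W0 _).
set p := W0 (T0 (u h)).
have pk : rnorm p <= a * rnorm h by exact: ha.
set B1 := (X' (badj Y0 p) - Y' (badj X0 p)).
set B := (X (badj Y0 p) - Y (badj X0 p)).
have hY0 : rnorm (badj Y0 p) <= my * (a * rnorm h).
  by apply: le_trans (badj_opbound (bd_Y bd0) (ltW my0) hmy p) _; rewrite ler_wpM2l// ltW.
have hX0 : rnorm (badj X0 p) <= mx * (a * rnorm h).
  by apply: le_trans (badj_opbound (bd_X bd0) (ltW mx0) hmx p) _; rewrite ler_wpM2l// ltW.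
have uk : rnorm (u h) <= cu * rnorm h by exact: hcu.
have rk : rnorm (R0 h) <= r * rnorm h by exact: hr.
have t1 : cabs (s%:C%C * '[V0 (R0 h) - V (R0 h), iD v] + '[V' (R0 h), iD v0])
    <= e * (r * rnorm h) * (k * rnorm g) + v' * (r * rnorm h) * (e * k * rnorm g).
  have -> : s%:C%C * '[V0 (R0 h) - V (R0 h), iD v] + '[V' (R0 h), iD v0]
     = - ('[s%:C%C *: (V (R0 h) - V0 (R0 h)), iD v] - '[V' (R0 h), iD v0]).
    by rewrite dotZl !dotBl; ring.
  rewrite cabsN; apply: dot_sub_le => //.
    by apply: le_trans (qV _) _; rewrite ler_wpM2l.
  by apply: le_trans (hv' _) _; rewrite ler_wpM2l// ltW.
have t2 : cabs (s%:C%C * '[B, Wop X Y (T v)] - '[B1, W0 (T0 v0)])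
    <= (e * (my * (a * rnorm h)) + e * (mx * (a * rnorm h))) * (k * rnorm g)
       + (x' * (my * (a * rnorm h)) + y' * (mx * (a * rnorm h))) * (e * k * rnorm g).
  rewrite -dotZl; apply: dot_sub_le => //.
    have -> : s%:C%C *: B - B1 = (s%:C%C *: (X (badj Y0 p) - X0 (badj Y0 p)) - X' (badj Y0 p))
        - (s%:C%C *: (Y (badj X0 p) - Y0 (badj X0 p)) - Y' (badj X0 p)).
      (* The term $X_0Y_0^*p=Y_0X_0^*p$ is inserted to form both difference quotients. *)
      rewrite -(bd_sym bd0) /B /B1.
      move: (X (badj Y0 p)) (Y (badj X0 p)) (X' (badj Y0 p)) (Y' (badj X0 p)) (X0 _).
      move=> xx yy xx' yy' zz; apply: dot_injl => q.
      rewrite !(dotBl, dotZl); ring.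
    apply: le_trans (rnormB _ _) _; apply: lerD.
      by apply: le_trans (qX _) _; rewrite ler_wpM2l.
    by apply: le_trans (qY _) _; rewrite ler_wpM2l.
  apply: le_trans (rnormB _ _) _; apply: lerD.
    by apply: le_trans (hx' _) _; rewrite ler_wpM2l// ltW.
  by apply: le_trans (hy' _) _; rewrite ler_wpM2l// ltW.
have t3 : cabs (s%:C%C * '[Jop (T (u h) - T0 (u h)), T v] - '[Jop (T' (u h)), T0 v0])
    <= e * (cu * rnorm h) * (k * rnorm g) + t' * (cu * rnorm h) * (e * k * rnorm g).
  have lJ := bounded_linear (Jop_bounded K).
  rewrite -dotZl -(linear_mapZ lJ); apply: dot_sub_le => //.
    rewrite -(linear_mapB lJ) rnorm_Jop.
    by apply: le_trans (qT _) _; rewrite ler_wpM2l.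
  by rewrite rnorm_Jop; apply: le_trans (ht' _) _; rewrite ler_wpM2l// ltW.
set d1 := '[V0 (R0 h) - V (R0 h), iD v] in t1 *; set d2 := '[B, Wop X Y (T v)] in t2 *.
set d3 := '[Jop (T (u h) - T0 (u h)), T v] in t3 *.
set d1' := '[V' (R0 h), iD v0] in t1 *; set d2' := '[B1, W0 (T0 v0)] in t2 *.
set d3' := '[Jop (T' (u h)), T0 v0] in t3 *.
have -> : s%:C%C * (d1 + d2 + d3) - (- d1' + d2' + d3')
  = (s%:C%C * d1 + d1') + (s%:C%C * d2 - d2') + (s%:C%C * d3 - d3') by ring.
apply: le_trans (cabsD _ _) _.
apply: le_trans (lerD (le_trans (cabsD _ _) (lerD t1 t2)) t3) _.
by rewrite le_eqVlt; apply/orP; left; apply/eqP; ring.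
Qed.

End Formula.

End ResolventDerivative.

(** * Top eigenvectors of a bounded symmetric operator *)

Lemma ultra_fmap (T1 T2 : Type) (f : T1 -> T2) (U : set_system T1) :
  UltraFilter U -> UltraFilter (f @ U).
Proof.
move=> UU; split; first exact: fmap_proper_filter.
move=> G PG UG; apply/seteqP; split; last exact: UG.
move=> A GA; have [//|nA] := in_ultra_setVsetC (f @^-1` A) UU.
have GC : G (~` A) by apply: UG.
have : G set0 by rewrite -(setICr A); exact: filterI.
by move/filter_ex => [].
Qed.

Section RealLemmas.
Variable R : realType.

Lemma cabs_le_ReIm (z : R[i]) : cabs z <= `|complex.Re z| + `|complex.Im z|.
Proof.
rewrite -(@ler_pXn2r _ 2)// ?nnegrE ?cabs_ge0 ?addr_ge0// cabs_sqr.
rewrite -[complex.Re z ^+ 2]real_normK ?num_real// -[complex.Im z ^+ 2]real_normK ?num_real//.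
by have := mulr_ge0 (normr_ge0 (complex.Re z)) (normr_ge0 (complex.Im z)); lra.
Qed.

Lemma abs_Re_le (z : R[i]) : `|complex.Re z| <= cabs z.
Proof. by rewrite ler_norml Re_le_cabs andbT lerNl -ReN -(cabsN z) Re_le_cabs. Qed.

Lemma abs_Im_le (z : R[i]) : `|complex.Im z| <= cabs z.
Proof.
rewrite Im_Re_i; apply: le_trans (abs_Re_le _) _.
by rewrite cabsM cabsN /cabs normCi mul1r.
Qed.

Lemma ultra_real_lim (T : Type) (U : set_system T) (g : T -> R) (M : R) : UltraFilter U ->
  U [set x | `|g x| <= M] -> exists c, forall e, 0 < e -> U [set x | `|g x - c| < e].
Proof.
move=> UU UM.
have := @segment_compact R (- M) M; rewrite compact_ultra => /(_ (g @ U) _).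
have h : U [set x | g x \in `[- M, M]].
  by apply: filterS UM => x gx; rewrite /= in_itv /= -ler_norml.
have UI : UltraFilter (g @ U) by exact: ultra_fmap.
move=> /(_ UI h)[c [_ hc]]; exists c => e e0.
have := hc [set y | `|y - c| < e]; apply.
apply/nbhs_ballP; exists e => // y; rewrite -ball_normE /= distrC; exact.
Qed.

Lemma ultra_complex_lim (T : Type) (U : set_system T) (g : T -> R[i]) (M : R) :
  UltraFilter U -> U [set x | cabs (g x) <= M] ->
  exists c, forall e, 0 < e -> U [set x | cabs (g x - c) < e].
Proof.
move=> UU UM.
have [a ha] : exists c, forall e, 0 < e -> U [set x | `|complex.Re (g x) - c| < e].
  by apply: (@ultra_real_lim _ _ _ M); apply: filterS UM => x /=; apply/le_trans/abs_Re_le.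
have [b hb] : exists c, forall e, 0 < e -> U [set x | `|complex.Im (g x) - c| < e].
  by apply: (@ultra_real_lim _ _ _ M); apply: filterS UM => x /=; apply/le_trans/abs_Im_le.
exists (a +i* b)%C => e e0; have e2 : 0 < e / 2 by rewrite divr_gt0.
apply: filterS2 (ha _ e2) (hb _ e2) => x /= h1 h2.
apply: le_lt_trans (cabs_le_ReIm _) _.
by move: h1 h2; case: (g x) => r i /=; lra.
Qed.

End RealLemmas.

Section OrthonormalFamilies.
Variable R : realType.
Local Notation C := R[i].
Variable H : hilbertType R.
Implicit Types (e f : nat -> H) (c : nat -> C) (x y : H).

(** Families are functions on [nat] of which the first [m] values count, so that truncation and
    extension need no casts. *)
Definition onb (m : nat) e :=
  forall i j, (i < m)%N -> (j < m)%N -> '[e i, e j] = (i == j)%:R.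

Definition comb (m : nat) e c : H := \sum_(i < m) c i *: e i.

Definition in_span m e x := exists c, x = comb m e c.

Definition orth_to m e x := forall i, (i < m)%N -> '[x, e i] = 0.

Definition proj m e x := comb m e (fun i => '[x, e i]).

Lemma dot_suml m (F : 'I_m -> H) y : '[\sum_i F i, y] = \sum_i '[F i, y].
Proof. by rewrite linear_sumlz. Qed.

Lemma dot_sumr m (F : 'I_m -> H) y : '[y, \sum_i F i] = \sum_i '[y, F i].
Proof. by rewrite linear_sumr. Qed.

Lemma dot_comb m e c j : onb m e -> (j < m)%N -> '[comb m e c, e j] = c j.
Proof.
move=> oe jm; rewrite /comb dot_suml (bigD1 (Ordinal jm))//= dotZl oe// eqxx mulr1.
rewrite big1 ?addr0// => i ij; rewrite dotZl oe//.
by rewrite (_ : (i == j :> nat) = false) ?mulr0//; apply/negbTE.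
Qed.

Lemma orth_proj m e x : onb m e -> orth_to m e (x - proj m e x).
Proof. by move=> oe i im; rewrite dotBl dot_comb// subrr. Qed.

Lemma orth_comb m e c x : orth_to m e x -> '[x, comb m e c] = 0.
Proof.
by move=> ox; rewrite /comb dot_sumr big1// => i _; rewrite dotZr ox// mulr0.
Qed.

Lemma comb_diag m e c (B : H -> H) (mu : nat -> R) : linear B ->
  (forall i j, (i < m)%N -> (j < m)%N -> '[B (e i), e j] = (i == j)%:R * (mu i)%:C%C) ->
  rdot (B (comb m e c)) (comb m e c) = \sum_(i < m) mu i * cabs (c i) ^+ 2.
Proof.
move=> lB dB; have linB (F : 'I_m -> H) : B (\sum_i F i) = \sum_i B (F i).
  by elim/big_rec2: _ => [|i a b _ <-]; rewrite ?(linear_map0 lB)// (linear_mapD lB).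
rewrite /comb linB /rdot dot_suml.
have -> : \sum_(i < m) '[B (c i *: e i), \sum_(j < m) c j *: e j]
    = \sum_(i < m) (mu i * cabs (c i) ^+ 2)%:C%C.
  apply: eq_bigr => i _; rewrite dot_sumr (bigD1 i)//= big1 => [|j ji].
    rewrite addr0 (linear_mapZ lB) dotZl dotZr dB// eqxx mul1r [RHS]rmorphM rmorphXn /=.
    by rewrite mulrA -normCK cabsE mulrC.
  rewrite (linear_mapZ lB) dotZl dotZr dB//.
  by rewrite (_ : (i == j :> nat) = false) ?mul0r ?mulr0//; apply/negbTE; rewrite eq_sym.
by rewrite -rmorph_sum.
Qed.

Lemma rnorm_comb m e c : onb m e -> rnorm (comb m e c) ^+ 2 = \sum_(i < m) cabs (c i) ^+ 2.
Proof.
move=> oe; rewrite -rdotxx.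
rewrite (@comb_diag m e c id (fun=> 1)) => [|//|i j im jm]; last by rewrite oe// mulr1.
by apply: eq_bigr => i _; rewrite mul1r.
Qed.

Lemma pythagoras x y : '[x, y] = 0 -> rnorm (x + y) ^+ 2 = rnorm x ^+ 2 + rnorm y ^+ 2.
Proof. by move=> h; rewrite rnorm_sqrD /rdot h mulr0 addr0. Qed.

Lemma in_span_widen k m e x : (k <= m)%N -> in_span k e x -> in_span m e x.
Proof.
move=> km [c ->]; exists (fun i => if (i < k)%N then c i else 0).
rewrite /comb (big_ord_widen m (fun i => c i *: e i) km) big_mkcond /=.
by apply: eq_bigr => i _; case: ifP => // _; rewrite scale0r.
Qed.

(** Dimension count, via the nonzero kernel of a $(k+1)\times k$ matrix; it supplies the trial
    vectors of the min-max arguments. *)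
Lemma exists_orth k e f : onb k.+1 f ->
  exists x, [/\ in_span k.+1 f x, x != 0 & orth_to k e x].
Proof.
move=> of_; pose M : 'M[C]_(k.+1, k) := \matrix_(i, j) '[f i, e j].
have : kermx M != 0.
  rewrite -mxrank_eq0 mxrank_ker subn_eq0 -ltnNge.
  by apply: leq_ltn_trans (rank_leq_col M) _.
case/rowV0Pn => v /sub_kermxP vM v0.
exists (comb k.+1 f (fun i => v 0 (inord i))); split; first by exists (fun i => v 0 (inord i)).
  apply: contra v0 => /eqP h; apply/eqP/rowP => i; rewrite mxE.
  have := dot_comb (fun i => v 0 (inord i)) of_ (ltn_ord i).
  by rewrite h dot0l inord_val => <-.
move=> j jk; rewrite /comb dot_suml.
have := congr1 (fun A : 'rV_k => A 0 (Ordinal jk)) vM.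
rewrite mxE [RHS]mxE => E; apply: etrans E.
by apply: eq_bigr => i _; rewrite dotZl mxE inord_val.
Qed.

Lemma span_norm m e x : onb m e -> in_span m e x ->
  rnorm x ^+ 2 = \sum_(i < m) cabs '[x, e i] ^+ 2.
Proof.
move=> oe [c ->]; rewrite rnorm_comb//; apply: eq_bigr => i _.
by rewrite dot_comb.
Qed.

Lemma in_span_orth k m e x : onb m e -> (k <= m)%N -> in_span k e x ->
  forall i, (k <= i)%N -> (i < m)%N -> '[x, e i] = 0.
Proof.
move=> oe km [c ->] i ki im; rewrite /comb dot_suml big1// => j _.
have jm : (j < m)%N by apply: leq_trans km.
rewrite dotZl oe// (_ : (j == i :> nat) = false) ?mulr0//.
by apply/negbTE; rewrite neq_ltn (leq_trans (ltn_ord j) ki).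
Qed.

End OrthonormalFamilies.

Section VariationalEigenvalues.
Variable R : realType.
Local Notation C := R[i].
Variable H : hilbertType R.
Variable B : H -> H.
Hypotheses (bB : bounded_operator B) (sB : forall x y, '[B x, y] = '[x, B y]).
Implicit Types (e f : nat -> H) (x y : H).

Let lB : linear B := bounded_linear bB.

Lemma sym_rdot x y : rdot (B x) y = rdot x (B y).
Proof. by rewrite /rdot sB. Qed.

Lemma quad_real x : '[B x, x] = (rdot (B x) x)%:C%C.
Proof.
apply: real_of_Im0; have := dotC (B x) x; rewrite -sB.
by case: '[B x, x] => a b [] /=; lra.
Qed.

Lemma quadD x y : rdot (B (x + y)) (x + y)
  = rdot (B x) x + 2 * rdot (B x) y + rdot (B y) y.
Proof.
rewrite (linear_mapD lB) rdotDl !rdotDr [rdot (B y) x]sym_rdot [rdot y _]rdotC; ring.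
Qed.

Lemma quadZ (a : R) x : rdot (B (a%:C%C *: x)) (a%:C%C *: x) = a ^+ 2 * rdot (B x) x.
Proof. by rewrite (linear_mapZ lB) rdotZl rdotZr mulrA expr2. Qed.

Lemma quad_le M x : opbound B M -> `|rdot (B x) x| <= M * rnorm x ^+ 2.
Proof.
move=> hM; apply: le_trans (rdot_abs_le _ _) _.
by rewrite expr2 mulrA ler_wpM2r ?rnorm_ge0.
Qed.

(* B attains its supremum a on the orthogonal complement of f because a exceeds
   q: along an ultrafilter of maximizing vectors the components in the span of
   e converge, and a - B is coercive on the complement of that span. *)
Lemma max_attained m e k f (q a : R) :
  onb m e -> (forall y, orth_to m e y -> rdot (B y) y <= q * rnorm y ^+ 2) -> q < a ->
  (forall x, orth_to k f x -> orth_to k f (B x)) ->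
  (forall x, orth_to k f x -> rdot (B x) x <= a * rnorm x ^+ 2) ->
  (forall r, 0 < r -> exists x, [/\ orth_to k f x, rnorm x = 1 & a - r < rdot (B x) x]) ->
  exists x, [/\ orth_to k f x, rnorm x = 1 & B x = a%:C%C *: x].
Proof.
move=> oe hq qa inv ha sup.
have [b b0 hb] := bounded_opbound bB.
pose S (r : R) := [set x | [/\ orth_to k f x, rnorm x = 1 & a - r < rdot (B x) x]].
pose F := filter_from [set r : R | 0 < r] S.
have FF : ProperFilter F.
  apply: filter_from_proper; last by move=> r /= r0; have [x hx] := sup r r0; exists x.
  apply: filter_from_filter; first by exists 1 => /=.
  move=> r s /= r0 s0; exists (Num.min r s); first by rewrite /= lt_min r0.
  move=> x [ox nx hx]; split; split=> //; apply: le_lt_trans hx; rewrite lerD2l lerN2.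
    by rewrite ge_min lexx.
  by rewrite ge_min lexx orbT.
have [U [UU FU]] := ultraFilterLemma FF.
have US r : 0 < r -> U (S r) by move=> r0; apply: FU; exists r.
have comp i : exists c : C, (i < m)%N -> forall r, 0 < r -> U [set x | cabs ('[x, e i] - c) < r].
  have [im|_] := boolP (i < m)%N; last by exists 0.
  have [|c hc] := @ultra_complex_lim R H U (fun x => '[x, e i]) 1 UU; last by exists c.
  apply: filterS (US 1 ltr01) => x [_ nx _] /=.
  apply: le_trans (cabs_dot_le _ _) _; rewrite nx mul1r.
  rewrite -(@ler_pXn2r _ 2)// ?nnegrE ?rnorm_ge0// -rdotxx /rdot oe// eqxx /=.
  by rewrite expr1n.
have [c hc] := choice comp.
have near r : 0 < r -> U [set x | forall i, (i < m)%N -> cabs ('[x, e i] - c i) < r].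
  move=> r0; suff : forall n, (n <= m)%N ->
      U [set x | forall i, (i < n)%N -> cabs ('[x, e i] - c i) < r] by apply.
  elim=> [_|n IH nm]; first by apply: filterS filterT.
  apply: filterS2 (IH (ltnW nm)) (hc n nm r r0) => x /= h1 h2 i.
  by rewrite ltnS leq_eqVlt => /orP[/eqP ->|/h1].
pose G := `|a| + b.
have G0 : 0 < G by rewrite ltr_wpDl.
have qad : 0 < a - q by rewrite subr_gt0.
have [l hl] : exists l, forall r : R, 0 < r -> U [set y | rnorm (l - y) < r].
  apply: rcauchy_cvg => r r0.
  (* For a difference $d$ of two maximizing vectors and its component $p$ in the span of [e],
     $(a-q)\|d-p\|^2\le4s+5G\pi$. Both summands are at most $(a-q)r^2/16$, so $\|d-p\|\le r/2$,
     while $\|p\|\le\pi\le r/4$. *)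
  pose pi := Num.min (r / 4) (Num.min 1 ((a - q) * r ^+ 2 / (80 * G))).
  have p0 : 0 < pi.
    by rewrite !lt_min ltr01 !divr_gt0// ?mulr_gt0// exprn_gt0.
  have p1 : pi <= 1 by rewrite !ge_min lexx orbT.
  have p2 : pi <= r / 4 by rewrite !ge_min lexx.
  have p3 : G * pi <= (a - q) * r ^+ 2 / 80.
    have : pi <= (a - q) * r ^+ 2 / (80 * G) by rewrite !ge_min lexx !orbT.
    by rewrite invfM mulrA ler_pdivlMr// mulrC.
  pose s := (a - q) * r ^+ 2 / 64.
  have s0 : 0 < s by rewrite divr_gt0// mulr_gt0// exprn_gt0.
  pose h := pi / (2 * (m%:R + 1)).
  have m0 : 0 < m%:R + 1 :> R by rewrite ltr_wpDl.
  have h0 : 0 < h by rewrite divr_gt0// mulr_gt0.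
  have UA : U (S s `&` [set x | forall i, (i < m)%N -> cabs ('[x, e i] - c i) < h]).
    by apply: filterI; [exact: US|exact: near].
  have [x0 [[ox nx hx] cx]] := filter_ex UA; exists x0.
  apply: filterS UA => y [[oy ny hy] cy] /=.
  set d := x0 - y.
  have od : orth_to k f d by move=> i ik; rewrite dotBl ox// oy// subrr.
  have os : orth_to k f (x0 + y) by move=> i ik; rewrite dotDl ox// oy// addr0.
  have pl := parallelogram x0 y; rewrite nx ny -/d in pl.
  (* Parallelogram law for the form of $a-B$, which is nonnegative on the complement of [f]. *)
  have qd : a * rnorm d ^+ 2 - rdot (B d) d <= 4 * s.
    have e1 := ha _ os; have e2 := quadD x0 y; have e3 := quadD x0 (- y).
    rewrite -/d (linear_mapN lB) !rdotNr rdotNl opprK in e3.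
    have pl' : a * rnorm (x0 + y) ^+ 2 + a * rnorm d ^+ 2 = 4 * a.
      by rewrite -mulrDr pl !expr1n; ring.
    by move: pl' hx hy e1 e2 e3; lra.
  set p := proj m e d.
  have np : rnorm p <= pi.
    have b1 (n : nat) : (n <= m)%N -> rnorm (\sum_(i < n) '[d, e i] *: e i) <= n%:R * (2 * h).
      elim: n => [_|n IH nm]; first by rewrite big_ord0 rnorm0 mul0r.
      rewrite big_ord_recr /=; apply: le_trans (rnormD _ _) _.
      rewrite -natr1 mulrDl mul1r; apply: lerD; first exact: IH (ltnW nm).
      rewrite rnormZ; have -> : rnorm (e n) = 1.
        by apply/eqP; rewrite -(@eqrXn2 _ 2)// ?rnorm_ge0// -rdotxx /rdot oe// eqxx expr1n.
      rewrite mulr1 /d dotBl.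
      have -> : '[x0, e n] - '[y, e n] = ('[x0, e n] - c n) - ('[y, e n] - c n).
        by rewrite opprB addrA subrK.
      apply: le_trans (cabsD _ _) _; rewrite cabsN mulrDl mul1r.
      by apply: lerD; apply: ltW; [exact: cx|exact: cy].
    apply: le_trans (b1 m (leqnn m)) _.
    have -> : m%:R * (2 * h) = pi * (m%:R / (m%:R + 1)) by rewrite /h; field; rewrite gt_eqF.
    by rewrite ler_piMr ?(ltW p0)// ler_pdivrMr// mul1r lerDl.
  have ow : orth_to m e (d - p) by exact: orth_proj.
  have hw := hq _ ow.
  have nd : rnorm d <= 2 by apply: le_trans (rnormB _ _) _; rewrite nx ny; lra.
  have n0 := rnorm_ge0 d; have np0 := rnorm_ge0 p.
  have qw : (a - q) * rnorm (d - p) ^+ 2 <= 4 * s + 5 * (G * pi).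
    have e1 := quadD d (- p).
    rewrite (linear_mapN lB) !rdotNr rdotNl opprK in e1.
    have e2 := rnorm_sqrB d p.
    have e3 := rdot_abs_le d p; have e4 := rdot_abs_le (B d) p.
    have e5 := quad_le p hb; have e6 := hb d.
    have dp2 : rnorm d * rnorm p <= 2 * pi by apply: ler_pM.
    have pp : rnorm p ^+ 2 <= pi.
      by rewrite expr2; apply: le_trans (ler_pM np0 np0 np (le_trans np p1)) _; rewrite mulr1.
    have f1 : - (2 * (a * rdot d p)) <= 2 * (`|a| * (2 * pi)).
      apply: le_trans (ler_norm _) _; rewrite normrN !normrM ger0_norm// ler_wpM2l//.
      by rewrite ler_wpM2l// (le_trans e3).
    have f2 : 2 * rdot (B d) p <= 2 * (b * (2 * pi)).
      rewrite ler_wpM2l//; apply: le_trans (ler_norm _) _; apply: le_trans e4 _.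
      apply: le_trans (ler_wpM2r np0 e6) _; rewrite -mulrA ler_wpM2l// ltW//.
    have f3 : a * rnorm p ^+ 2 <= `|a| * pi.
      apply: le_trans (ler_wpM2r (exprn_ge0 2 np0) (ler_norm a)) _.
      by rewrite ler_wpM2l.
    have f4 : - rdot (B p) p <= b * pi.
      apply: le_trans (ler_norm _) _; rewrite normrN; apply: le_trans e5 _.
      by rewrite ler_wpM2l// ltW.
    have E : a * rnorm (d - p) ^+ 2 - rdot (B (d - p)) (d - p)
      = (a * rnorm d ^+ 2 - rdot (B d) d) - 2 * (a * rdot d p) + 2 * rdot (B d) p
        + a * rnorm p ^+ 2 - rdot (B p) p by rewrite e1 e2; ring.
    by move: hw E qd f1 f2 f3 f4; rewrite /G; lra.
  have wr : rnorm (d - p) <= r / 2.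
    rewrite -(@ler_pXn2r _ 2)// ?nnegrE ?rnorm_ge0 ?divr_ge0 ?(ltW r0)//.
    rewrite -(ler_pM2l qad); apply: le_trans qw _.
    by rewrite /s expr_div_n; move: p3 (mulr_gt0 qad (exprn_gt0 2 r0)); lra.
  rewrite -[d](subrK p); apply: le_lt_trans (rnormD _ _) _.
  by move: wr np p2 r0; lra.
have hs r s : 0 < r -> 0 < s -> exists y,
    [/\ orth_to k f y, rnorm y = 1, a - s < rdot (B y) y & rnorm (l - y) < r].
  move=> r0 s0; have UA : U (S s `&` [set y | rnorm (l - y) < r]).
    by apply: filterI; [exact: US|exact: hl].
  by have [y [[? ? ?] ?]] := filter_ex UA; exists y.
have ol : orth_to k f l.
  move=> i ik; apply: cabs_eq0; apply/eqP; rewrite eq_le cabs_ge0 andbT.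
  apply: (@le_eps_mul _ _ _ (rnorm (f i)) (rnorm_ge0 _)) => r r0.
  have [y [oy _ _ /ltW ly]] := hs r 1 r0 ltr01.
  have -> : '[l, f i] = '[l - y, f i] by rewrite dotBl (oy i ik) subr0.
  by rewrite add0r; apply: le_trans (cabs_dot_le _ _) _; rewrite ler_wpM2r ?rnorm_ge0.
have nl : rnorm l = 1.
  apply/eqP; rewrite eq_le; apply/andP; split; apply/ler_addgt0Pr => r r0;
    have [y [_ ny _ /ltW ly]] := hs r 1 r0 ltr01.
    by have := rnormBt y l 0; rewrite !subr0 ny; move: ly; lra.
  by have := rnormBt l y 0; rewrite !subr0 ny [rnorm (y - l)]rdistC; move: ly; lra.
have ql : a <= rdot (B l) l.
  apply: (@le_eps_mul _ _ _ (1 + 3 * b)); first by rewrite addr_ge0// mulr_ge0// ltW.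
  move=> r r0; pose r' := Num.min r 1.
  have r'0 : 0 < r' by rewrite lt_min r0 ltr01.
  have [y [_ ny hy /ltW ly]] := hs r' r r'0 r0.
  have r'r : r' <= r by rewrite ge_min lexx.
  have E := quadD y (l - y); rewrite [y + _]addrC subrK in E.
  have f1 := rdot_abs_le (B y) (l - y); have f2 := quad_le (l - y) hb.
  have f3 := hb y; rewrite ny mulr1 in f3.
  have g1 : rnorm (B y) * rnorm (l - y) <= b * r.
    by apply: ler_pM; rewrite ?rnorm_ge0// (le_trans ly).
  have g2 : rnorm (l - y) ^+ 2 <= r.
    have r'1 : r' <= 1 by rewrite ge_min lexx orbT.
    rewrite expr2; apply: le_trans (ler_pM (rnorm_ge0 _) (rnorm_ge0 _)
      (le_trans ly r'r) (le_trans ly r'1)) _.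
    by rewrite mulr1.
  have g3 : b * rnorm (l - y) ^+ 2 <= b * r by rewrite ler_wpM2l// ltW.
  have h1 : - rdot (B y) (l - y) <= b * r.
    by apply: le_trans (ler_norm _) _; rewrite normrN (le_trans f1).
  have h2 : - rdot (B (l - y)) (l - y) <= b * r.
    by apply: le_trans (ler_norm _) _; rewrite normrN (le_trans f2).
  by move: E hy h1 h2; lra.
exists l; split=> //; apply/eqP; rewrite -subr_eq0; apply/eqP/rnorm_eq0.
set z := B l - a%:C%C *: l.
have oz : orth_to k f z.
  by move=> i ik; rewrite dotBl dotZl (inv l ol)// (ol i ik) mulr0 subrr.
apply/eqP; rewrite -sqrf_eq0; apply/eqP.
(* First variation of $a-B$ at the maximizer [l] in the direction [z], admissible because [B]
   preserves the complement of [f]. *)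
apply: (@quadratic_le0 _ _ ((`|a| + b) * rnorm z ^+ 2)).
  by rewrite mulr_ge0 ?exprn_ge0 ?rnorm_ge0// addr_ge0// ltW.
move=> s; have oz' : orth_to k f (l + s%:C%C *: z).
  by move=> i ik; rewrite dotDl dotZl (oz i ik) (ol i ik) mulr0 addr0.
have := ha _ oz'; rewrite quadD quadZ rdotZr rnorm_sqrD rdotZr rnormZR exprMn.
rewrite real_normK ?num_real// nl expr1n.
have -> : rdot (B l) z = rnorm z ^+ 2 + a * rdot l z.
  by rewrite -rdotxx {2}/z rdotBl rdotZl subrK.
have f1 := quad_le z hb.
have f2 : - rdot (B z) z <= b * rnorm z ^+ 2.
  by apply: le_trans (ler_norm _) _; rewrite normrN.
have f3 : a * rnorm z ^+ 2 <= `|a| * rnorm z ^+ 2.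
  by rewrite ler_wpM2r ?exprn_ge0 ?rnorm_ge0// ler_norm.
have s2 : 0 <= s ^+ 2 by rewrite sqr_ge0.
have := ler_wpM2l s2 f2; have := ler_wpM2l s2 f3; move: ql; lra.
Qed.

End VariationalEigenvalues.

Section TopEigenvalues.
Variable R : realType.
Local Notation C := R[i].
Variable H : hilbertType R.
Variable B : H -> H.
Hypotheses (bB : bounded_operator B) (sB : forall x y, '[B x, y] = '[x, B y]).
Implicit Types (e f : nat -> H) (x y : H).

Let lB : linear B := bounded_linear bB.

(* Eigenvectors obtained by successive maximization of the quadratic form. *)
Record eigensystem (k : nat) f (mu : nat -> R) : Prop := Eigensystem {
  es_onb : onb k f;
  es_eig : forall i, (i < k)%N -> B (f i) = (mu i)%:C%C *: f i;
  es_max : forall i x, (i < k)%N -> orth_to i f x -> rdot (B x) x <= mu i * rnorm x ^+ 2 }.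

Lemma es_diag k f mu : eigensystem k f mu ->
  forall i j, (i < k)%N -> (j < k)%N -> '[B (f i), f j] = (i == j)%:R * (mu i)%:C%C.
Proof. by move=> [oe ee _] i j ik jk; rewrite ee// dotZl oe// mulrC. Qed.

Lemma es_inv k f mu x : eigensystem k f mu -> orth_to k f x -> orth_to k f (B x).
Proof. by move=> [_ ee _] ox i ik; rewrite sB ee// dotZr ox// mulr0. Qed.

Lemma es_mono k f mu i j : eigensystem k f mu -> (i <= j)%N -> (j < k)%N -> mu j <= mu i.
Proof.
move=> es ij jk; have [oe ee em] := es.
have := em i (f j) (leq_ltn_trans ij jk) _.
have n1 : rnorm (f j) ^+ 2 = 1 by rewrite -rdotxx /rdot oe// eqxx.
rewrite ee// rdotZl rdotxx n1 !mulr1; apply => l li.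
rewrite oe ?(ltn_trans li) ?(leq_ltn_trans ij)//.
by rewrite (_ : (j == l) = false)//; apply/negbTE; rewrite neq_ltn (leq_trans li ij) orbT.
Qed.

(** While $k<m$, the span of [e] contains a unit vector orthogonal to the [k] vectors found so far,
    so the next supremum is at least $p>q$ and [max_attained] applies. *)
Lemma top_eigenvectors m e (q p : R) : onb m e -> q < p ->
  (forall y, orth_to m e y -> rdot (B y) y <= q * rnorm y ^+ 2) ->
  (forall x, in_span m e x -> p * rnorm x ^+ 2 <= rdot (B x) x) ->
  exists f mu, eigensystem m f mu /\ forall i, (i < m)%N -> p <= mu i.
Proof.
move=> oe qp hq hp.
suff : forall k, (k <= m)%N -> exists f mu, eigensystem k f mu /\
    forall i, (i < k)%N -> p <= mu i by apply.
elim=> [_|k IH km].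
  by exists (fun=> 0), (fun=> 0); split=> //; split.
have [f [mu [es pmu]]] := IH (ltnW km); have [of_ ef mf] := es.
have [b b0 hb] := bounded_opbound bB.
pose A := [set r | exists x, [/\ orth_to k f x, rnorm x = 1 & r = rdot (B x) x]].
have oek : onb k.+1 e by move=> i j ik jk; apply: oe; exact: leq_trans km.
have [x1 [sx1 x10 ox1]] := exists_orth f oek.
have nx1 := rnorm_gt0 x10.
pose x2 := (rnorm x1)^-1%:C%C *: x1.
have nx2 : rnorm x2 = 1.
  by rewrite rnormZR ger0_norm ?invr_ge0 ?rnorm_ge0// mulVf// gt_eqF.
have ox2 : orth_to k f x2 by move=> i ik; rewrite dotZl ox1// mulr0.
have px2 : p <= rdot (B x2) x2.
  have -> : rdot (B x2) x2 = (rnorm x1)^-1 ^+ 2 * rdot (B x1) x1 by rewrite quadZ.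
  have := hp _ (in_span_widen km sx1).
  rewrite -(ler_pM2l (_ : 0 < (rnorm x1)^-1 ^+ 2)) ?exprn_gt0 ?invr_gt0//.
  by rewrite mulrCA -exprMn mulVf ?gt_eqF// expr1n mulr1.
have Aub : ubound A b.
  move=> _ [x [_ nx ->]]; apply: le_trans (ler_norm _) _.
  by apply: le_trans (quad_le x hb) _; rewrite nx expr1n mulr1.
have A0 : A !=set0 by exists (rdot (B x2) x2), x2.
have Asup : has_sup A by split=> //; exists b.
set a := sup A.
have ha x : orth_to k f x -> rdot (B x) x <= a * rnorm x ^+ 2.
  move=> ox; have [->|x0] := eqVneq x 0.
    by rewrite rdot0r rnorm0 expr0n mulr0.
  have nx := rnorm_gt0 x0.
  rewrite -(ler_pM2l (_ : 0 < (rnorm x)^-1 ^+ 2)) ?exprn_gt0 ?invr_gt0//.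
  rewrite mulrCA -exprMn mulVf ?gt_eqF// expr1n mulr1 -quadZ//.
  apply: sup_upper_bound => //; exists ((rnorm x)^-1%:C%C *: x); split=> //.
    by move=> i ik; rewrite dotZl ox// mulr0.
  by rewrite rnormZR ger0_norm ?invr_ge0 ?rnorm_ge0// mulVf// gt_eqF.
have pa : p <= a.
  by apply: le_trans px2 _; apply: sup_upper_bound => //; exists x2.
have [||||x [ox nx Bx]] := @max_attained R H B bB sB m e k f q a oe hq.
- exact: lt_le_trans pa.
- by move=> x; exact: (es_inv es).
- exact: ha.
- move=> r r0; have [_ [x [ox nx ->]] hx] := sup_adherent r0 Asup.
  by exists x; split.
exists (fun i => if i == k then x else f i), (fun i => if i == k then a else mu i).
split; last first.
  by move=> i; rewrite ltnS leq_eqVlt; case: eqP => [_ _|_ /= /pmu].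
split.
- move=> i j; rewrite !ltnS (leq_eqVlt i) (leq_eqVlt j).
  have [->|ik] := eqVneq i k; have [->|jk] := eqVneq j k => //=.
  + by move=> _ _; rewrite dotE nx expr1n ?eqxx.
  + by move=> _ jk'; rewrite ox.
  + by move=> ik' _; rewrite dotC ox// conjC0 (negbTE ik).
  + by move=> ik' jk'; rewrite of_.
- move=> i; rewrite ltnS leq_eqVlt.
  by have [->|ik] := eqVneq i k => //= /ef.
- move=> i y; rewrite ltnS leq_eqVlt; have [->|ik] := eqVneq i k => [_ oy|/= ik' oy].
    by apply: ha => j jk; have := oy j jk; rewrite (ltn_eqF jk).
  apply: mf => // j ji; have := oy j ji.
  by rewrite (ltn_eqF (ltn_trans ji ik')).
Qed.

(** Otherwise a unit vector violating the bound, added to [f], gives [m + 1] orthonormal vectors on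
    whose span the form is diagonal with entries above [q]; but some nonzero vector of that span is
    orthogonal to [e]. *)
Lemma complement_bound m e f mu (q : R) : onb m e ->
  (forall y, orth_to m e y -> rdot (B y) y <= q * rnorm y ^+ 2) ->
  eigensystem m f mu -> (forall i, (i < m)%N -> q < mu i) ->
  forall x, orth_to m f x -> rdot (B x) x <= q * rnorm x ^+ 2.
Proof.
move=> oe hq es qmu x ox; have [of_ ef _] := es.
have [->|x0] := eqVneq x 0; first by rewrite rdot0r rnorm0 expr0n mulr0.
have nx := rnorm_gt0 x0; rewrite leNgt; apply/negP => hx.
set y := (rnorm x)^-1%:C%C *: x.
have ny : rnorm y = 1.
  by rewrite rnormZR ger0_norm ?invr_ge0 ?rnorm_ge0// mulVf// gt_eqF.
have oy : orth_to m f y by move=> i ik; rewrite dotZl ox// mulr0.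
have oBy := es_inv es oy.
have qy : q < rdot (B y) y.
  rewrite /y quadZ// -(ltr_pM2l (_ : 0 < (rnorm x) ^+ 2)) ?exprn_gt0//.
  by rewrite mulrA -exprMn mulfV ?gt_eqF// expr1n mul1r mulrC.
pose g i := if (i == m)%N then y else f i.
pose nu i := if (i == m)%N then rdot (B y) y else mu i.
have og : onb m.+1 g.
  move=> i j; rewrite /g !ltnS (leq_eqVlt i) (leq_eqVlt j).
  have [->|ik] := eqVneq i m; have [->|jk] := eqVneq j m => //=.
  + by move=> _ _; rewrite dotE ny expr1n ?eqxx.
  + by move=> _ jk'; rewrite oy.
  + by move=> ik' _; rewrite dotC oy// conjC0 (negbTE ik).
  + by move=> ik' jk'; rewrite of_.
have dg i j : (i < m.+1)%N -> (j < m.+1)%N -> '[B (g i), g j] = (i == j)%:R * (nu i)%:C%C.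
  rewrite /g /nu !ltnS (leq_eqVlt i) (leq_eqVlt j).
  have [->|ik] := eqVneq i m; have [->|jk] := eqVneq j m => //=.
  + by move=> _ _; rewrite (quad_real sB) ?eqxx mul1r.
  + by move=> _ jk'; rewrite oBy// mul0r.
  + by move=> ik' _; rewrite dotC -sB oBy// conjC0 (negbTE ik) mul0r.
  + by move=> ik' jk'; rewrite (es_diag es).
have qnu i : (i < m.+1)%N -> q < nu i.
  by rewrite /nu ltnS leq_eqVlt; case: eqP => //= _ /qmu.
have [z [[c zE] z0 oz]] := exists_orth e og.
have := hq _ oz; rewrite zE (comb_diag _ lB dg) (rnorm_comb _ og) leNgt => /negP; apply.
rewrite mulr_sumr.
have [i ci] : exists i : 'I_m.+1, c i != 0.
  apply/existsP; apply: contraNT z0 => /existsPn h; apply/eqP.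
  by rewrite zE /comb big1// => i _; have /eqP -> := negbNE (h i); rewrite scale0r.
rewrite (bigD1 i)//= [ltRHS](bigD1 i)//=; apply: ltr_leD.
  rewrite ltr_pM2r ?qnu// exprn_gt0// lt_neqAle cabs_ge0 andbT eq_sym.
  by apply: contra ci => /eqP/cabs_eq0/eqP.
by apply: ler_sum => j _; rewrite ler_wpM2r ?exprn_ge0 ?cabs_ge0// ltW ?qnu.
Qed.

(* Courant-Fischer comparison: B is close to diag(nu) on the span of e, almost
   decouples this span from its complement, and is at most q there. *)
Lemma minmax_bounds m e f mu (nu : nat -> R) (q r k : R) : onb m e -> eigensystem m f mu ->
  (forall i j, (i <= j)%N -> (j < m)%N -> nu j <= nu i) ->
  (forall i, (i < m)%N -> q < nu i + r) -> 0 <= r -> 0 <= k ->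
  (forall x, in_span m e x ->
    `|rdot (B x) x - \sum_(i < m) nu i * cabs '[x, e i] ^+ 2| <= r * rnorm x ^+ 2) ->
  (forall x y, in_span m e x -> orth_to m e y -> rdot (B x) y <= k * rnorm x * rnorm y) ->
  (forall y, orth_to m e y -> rdot (B y) y <= q * rnorm y ^+ 2) ->
  forall i, (i < m)%N -> nu i - r <= mu i /\ mu i <= nu i + r + k ^+ 2 / (nu i + r - q).
Proof.
move=> oe es mono qnu r0 k0 h1 h2 h3 i im; have [of_ ef mf] := es; split.
  (* Lower bound: the trial vector is in the span of $e_0,\dots,e_i$ and orthogonal to
     $f_0,\dots,f_{i-1}$. *)
  have oei : onb i.+1 e by move=> a b ai bi; apply: oe; apply: leq_trans im.
  have [x [sx x0 ox]] := exists_orth f oei; have nx := rnorm_gt0 x0.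
  have sxm := in_span_widen im sx.
  have := h1 x sxm; rewrite ler_norml => /andP[hl _].
  rewrite -(ler_pM2r (exprn_gt0 2 nx)); apply: le_trans (mf i x im ox).
  have : nu i * rnorm x ^+ 2 <= \sum_(j < m) nu j * cabs '[x, e j] ^+ 2.
    rewrite (span_norm oe sxm) mulr_sumr; apply: ler_sum => j _.
    have [ij|ji] := leqP j i; first by rewrite ler_wpM2r ?exprn_ge0 ?cabs_ge0// mono.
    by rewrite (in_span_orth oe im sx ji (ltn_ord j)) /cabs normr0 expr0n /= !mulr0.
  by move: hl; lra.
(* Upper bound: the roles of [e] and [f] are exchanged, and the trial vector is split along the span
   of [e]. *)
have ofi : onb i.+1 f by move=> a b ai bi; apply: of_; apply: leq_trans im.
have [x [[c xE] x0 ox]] := exists_orth e ofi; have nx := exprn_gt0 2 (rnorm_gt0 x0).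
have lo : mu i * rnorm x ^+ 2 <= rdot (B x) x.
  rewrite xE (rnorm_comb _ ofi) (@comb_diag _ _ _ _ _ B mu lB); last first.
    by move=> a b ai bi; apply: (es_diag es); apply: leq_trans im.
  rewrite mulr_sumr; apply: ler_sum => j _; rewrite ler_wpM2r ?exprn_ge0 ?cabs_ge0//.
  by apply: (es_mono es) => //; rewrite -ltnS.
set g := proj m e x; set y := x - g.
have oy : orth_to m e y by exact: orth_proj.
have sg : in_span m e g by exists (fun j => '[x, e j]).
have xgy : x = g + y by rewrite addrC subrK.
have ogy : '[g, y] = 0 by rewrite dotC (orth_comb _ oy) conjC0.
have := h1 g sg; rewrite ler_norml => /andP[_ hg].
have hs : \sum_(j < m) nu j * cabs '[g, e j] ^+ 2 <= nu i * rnorm g ^+ 2.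
  rewrite (span_norm oe sg) mulr_sumr; apply: ler_sum => j _.
  have [ij|ji] := leqP i j; first by rewrite ler_wpM2r ?exprn_ge0 ?cabs_ge0// mono.
  by rewrite dot_comb// ox// /cabs normr0 expr0n /= !mulr0.
have hgy := h2 g y sg oy; have hy := h3 y oy.
set N := nu i + r; have Nq : 0 < N - q by rewrite subr_gt0 qnu.
have E := quadD bB sB g y; rewrite -xgy in E.
have P := pythagoras ogy; rewrite -xgy in P.
rewrite -(ler_pM2r nx); apply: le_trans lo _; rewrite E P.
(* AM-GM: 2 k |g| |y| <= k^2 / (N - q) |g|^2 + (N - q) |y|^2 *)
have amgm : 2 * (k * rnorm g * rnorm y)
    <= k ^+ 2 / (N - q) * rnorm g ^+ 2 + (N - q) * rnorm y ^+ 2.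
  have sq := sqr_ge0 (k * rnorm g - (N - q) * rnorm y).
  have -> : k ^+ 2 / (N - q) * rnorm g ^+ 2 = (k * rnorm g) ^+ 2 / (N - q).
    by rewrite exprMn mulrAC.
  rewrite -(ler_pM2r Nq) [leRHS]mulrDl divfK ?gt_eqF//; lra.
have kq : 0 <= k ^+ 2 / (N - q) * rnorm y ^+ 2.
  by rewrite mulr_ge0 ?divr_ge0 ?exprn_ge0 ?rnorm_ge0// ltW.
move: hg hs hgy hy amgm kq; rewrite -/N /N; lra.
Qed.

End TopEigenvalues.

(** * Spectral gaps and eigenspaces *)

Section SpectralGap.
Variable R : realType.
Local Notation C := R[i].
Variable H : hilbertType R.
Variables (A : operator H) (l d g : R).
Hypotheses (hA : hermitian_op A) (d0 : 0 < d) (dg : d < g).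
Hypothesis gap : forall s, s != l -> `|s - l| < g -> ~ spectrum A s%:C%C.
Let z : C := (l - d)%:C%C.

Lemma gap_resolvent : ~ spectrum A z.
Proof.
apply: gap; first by rewrite -subr_eq0 addrAC subrr add0r oppr_eq0 gt_eqF.
by rewrite addrAC subrr add0r normrN gtr0_norm.
Qed.

Let B := resolvent A z.
(** The map $s\mapsto1/d-1/(s-l+d)$ sends [l] to 0 and the rest of the spectrum into
    $[1/d-1/(d+g),\,1/d+1/(g-d)]$; [gap_upper] and [gap_lower] express the two ends of this interval
    by forms. *)
Let T x := d^-1%:C%C *: x - B x.
Let rz := gap_resolvent.
Let lB : linear B := bounded_linear (resolvent_bounded rz).

Lemma gap_symmetric x y : '[B x, y] = '[x, B y].
Proof. by rewrite /B resolvent_adjoint// conjR. Qed.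

Let T_linear : linear T.
Proof.
by move=> a x y; rewrite /T lB scalerDr scalerBr !scalerA [_ * a]mulrC opprD addrACA.
Qed.

Let T_sym x y : '[T x, y] = '[x, T y].
Proof. by rewrite dotBl dotBr dotZl dotZr conjR gap_symmetric. Qed.

Let rdot_TT x : rnorm (T x) ^+ 2
  = d^-1 ^+ 2 * rnorm x ^+ 2 - 2 * d^-1 * rdot x (B x) + rnorm (B x) ^+ 2.
Proof.
by rewrite /T rnorm_sqrB rnormZR exprMn real_normK ?num_real// rdotZl; ring.
Qed.

Let rdot_Tx x : rdot (T x) x = d^-1 * rnorm x ^+ 2 - rdot x (B x).
Proof. by rewrite rdotBl rdotZl rdotxx [rdot (B x) x]rdotC. Qed.

(* The interval of radius g/2 around c avoids the spectrum. *)
Let half_gap (c : R) x : `|c - l| = g / 2 ->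
  (g / 2) ^+ 2 * rnorm (B x) ^+ 2
  <= rnorm x ^+ 2 - 2 * (c - l + d) * rdot x (B x) + (c - l + d) ^+ 2 * rnorm (B x) ^+ 2.
Proof.
move=> hc; have g0 : 0 < g by apply: lt_trans dg.
have g2 : 0 < g / 2 by rewrite divr_gt0.
have lb : lower_bound A c%:C%C (g / 2)^-1.
  apply: (resolvent_norm_le hA g2) => s hs; apply: gap.
    by apply/eqP => sl; move: hs; rewrite sl distrC hc ltxx.
  rewrite -(subrKA c); apply: le_lt_trans (ler_normD _ _) _.
  by rewrite hc [ltRHS]splitr ltrD2r.
have [dB E] := resolventP rz x; have := lb _ dB.
have -> : A (resolvent A z x) - c%:C%C *: resolvent A z x
    = x - (c - l + d)%:C%C *: B x.
  rewrite resolvent_eq// -addrA -scalerBl; congr (_ + _).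
  by rewrite -scaleNr /z -rmorphB -rmorphN; congr (_%:C%C *: _); ring.
rewrite mulrC ler_pdivlMr// mulrC -/(B x) => h.
have := rnorm_sqrB x ((c - l + d)%:C%C *: B x).
rewrite rnormZR exprMn real_normK ?num_real// rdotZr mulrA => <-.
by rewrite -exprMn; apply: lerXn2r; rewrite ?nnegrE ?mulr_ge0 ?rnorm_ge0// ltW.
Qed.

(** The gap between $l$ and $l+g$: after multiplication by $d(d+g)$ the claim is [half_gap] at its
    centre. *)
Let gap_upper x : (d^-1 - (d + g)^-1) * rdot (T x) x <= rnorm (T x) ^+ 2.
Proof.
have g0 : 0 < g by apply: lt_trans dg.
have := @half_gap (l + g / 2) x.
rewrite [l + _ - l]addrAC subrr add0r ger0_norm ?divr_ge0 ?(ltW g0)// => /(_ erefl) h.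
rewrite rdot_TT rdot_Tx.
have dd : 0 < d * (d + g) by rewrite mulr_gt0// addr_gt0.
rewrite -(ler_pM2l dd).
have -> : d * (d + g) * ((d^-1 - (d + g)^-1) * (d^-1 * rnorm x ^+ 2 - rdot x (B x)))
    = g * (d^-1 * rnorm x ^+ 2 - rdot x (B x)).
  by field; rewrite !gt_eqF// addr_gt0.
have -> : d * (d + g) * (d^-1 ^+ 2 * rnorm x ^+ 2 - 2 * d^-1 * rdot x (B x) + rnorm (B x) ^+ 2)
   = (d + g) * d^-1 * rnorm x ^+ 2 - 2 * (d + g) * rdot x (B x) + d * (d + g) * rnorm (B x) ^+ 2.
  by field; rewrite gt_eqF.
have E : (d + g) * d^-1 * rnorm x ^+ 2 = rnorm x ^+ 2 + g * (d^-1 * rnorm x ^+ 2).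
  by field; rewrite gt_eqF.
by move: h; rewrite E; lra.
Qed.

(** The gap between $l-g$ and $l$. The left side is nonnegative and the factor on the right
    positive, so $T\ge0$ follows as well. *)
Let gap_lower x : rnorm (T x) ^+ 2 <= (d^-1 + (g - d)^-1) * rdot (T x) x.
Proof.
have g0 : 0 < g by apply: lt_trans dg.
have gd0 : 0 < g - d by rewrite subr_gt0.
have := @half_gap (l - g / 2) x.
rewrite [l - _ - l]addrAC subrr add0r normrN ger0_norm ?divr_ge0 ?(ltW g0)// => /(_ erefl) h.
rewrite rdot_TT rdot_Tx.
have dd : 0 < d * (g - d) by rewrite mulr_gt0.
rewrite -(ler_pM2l dd).
have -> : d * (g - d) * ((d^-1 + (g - d)^-1) * (d^-1 * rnorm x ^+ 2 - rdot x (B x)))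
    = g * (d^-1 * rnorm x ^+ 2 - rdot x (B x)).
  by field; rewrite !gt_eqF.
have -> : d * (g - d) * (d^-1 ^+ 2 * rnorm x ^+ 2 - 2 * d^-1 * rdot x (B x) + rnorm (B x) ^+ 2)
   = (g - d) * d^-1 * rnorm x ^+ 2 - 2 * (g - d) * rdot x (B x) + d * (g - d) * rnorm (B x) ^+ 2.
  by field; rewrite gt_eqF.
have E : (g - d) * d^-1 * rnorm x ^+ 2 = g * (d^-1 * rnorm x ^+ 2) - rnorm x ^+ 2.
  by field; rewrite gt_eqF.
by move: h; rewrite E; lra.
Qed.

Lemma resolvent_form_lower x : - (g - d)^-1 * rnorm x ^+ 2 <= rdot (B x) x.
Proof.
have g0 : 0 < g by apply: lt_trans dg.
have G0 : 0 < d^-1 + (g - d)^-1 by rewrite addr_gt0 ?invr_gt0 ?subr_gt0.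
have TG : rnorm (T x) <= (d^-1 + (g - d)^-1) * rnorm x.
  have [->|T0] := eqVneq (T x) 0; first by rewrite rnorm0 mulr_ge0 ?rnorm_ge0// ltW.
  rewrite -(ler_pM2l (rnorm_gt0 T0)) -expr2; apply: le_trans (gap_lower x) _.
  by rewrite mulrCA ler_wpM2l ?(ltW G0)// rdot_le.
have := le_trans (rdot_le (T x) x) (ler_wpM2r (rnorm_ge0 x) TG).
by rewrite rdot_Tx rdotC; lra.
Qed.

Lemma eigenkernel_resolvent x : eigenkernel A l%:C%C x <-> B x = d^-1%:C%C *: x.
Proof.
have dn : d%:C%C != 0 :> C by rewrite (_ : 0 = 0%:C%C)// (inj_eq (@complexI R)) gt_eqF.
split=> [[dx Ax]|Bx].
  have [dx' E'] := hermitian_domZ hA d^-1%:C%C dx.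
  apply: (resolvent_unique rz dx').
  rewrite E' Ax !scalerA -scalerBl (_ : _ - _ = 1) ?scale1r//.
  rewrite /z -!rmorphM -rmorphB -[1]/(1%:C%C); congr (_%:C%C); field; by rewrite gt_eqF.
have [dB E] := resolventP rz x; rewrite -/(B x) Bx in dB E.
have xE : x = d%:C%C *: (d^-1%:C%C *: x).
  by rewrite scalerA -rmorphM mulfV ?gt_eqF// scale1r.
have [dx E'] := hermitian_domZ hA d%:C%C dB; rewrite -xE in dx E'.
split=> //; rewrite E'.
have -> : A (d^-1%:C%C *: x) = x + z *: (d^-1%:C%C *: x) by rewrite -{2}E subrK.
rewrite {1}xE -scalerDl scalerA [RHS](congr1 (fun v => l%:C%C *: v) xE) !scalerA.
congr (_ *: _); rewrite /z -rmorphD -!rmorphM; congr (_%:C%C); field; by rewrite gt_eqF.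
Qed.

(* For T = 1/d - B >= 0 with T^2 >= c T: expanding the form of T at
   x - c^-1 T x gives <T w, w> >= c |w|^2 for every w = T x, hence on the
   closure of the range of T, the complement of its kernel. *)
Lemma resolvent_form_upper y : (forall x, eigenkernel A l%:C%C x -> '[y, x] = 0) ->
  rdot (B y) y <= (g + d)^-1 * rnorm y ^+ 2.
Proof.
move=> oy; have g0 : 0 < g by apply: lt_trans dg.
set c := d^-1 - (d + g)^-1.
have c0 : 0 < c.
  by rewrite subr_gt0 ltf_pV2 ?posrE ?addr_gt0// ltrDl.
have Tpos x : 0 <= rdot (T x) x.
  have G0 : 0 < d^-1 + (g - d)^-1 by rewrite addr_gt0 ?invr_gt0 ?subr_gt0.
  by rewrite -(pmulr_rge0 _ G0); apply: le_trans (gap_lower x); rewrite exprn_ge0 ?rnorm_ge0.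
have TT x : c * rnorm (T x) ^+ 2 <= rdot (T (T x)) (T x).
  have h := Tpos (x - c^-1%:C%C *: T x).
  rewrite (linear_mapB T_linear) (linear_mapZ T_linear) in h.
  have ex (k : R) (a b u v : H) : rdot (a - k%:C%C *: b) (u - k%:C%C *: v)
      = rdot a u - k * rdot a v - k * (rdot b u - k * rdot b v).
    by rewrite !(rdotBl, rdotBr, rdotZl, rdotZr); ring.
  rewrite ex in h.
  have s : rdot (T (T x)) x = rnorm (T x) ^+ 2 by rewrite /rdot T_sym -/(rdot _ _) rdotxx.
  rewrite rdotxx s in h; have gu := gap_upper x; rewrite -/c in gu.
  move: h; rewrite -(ler_pM2l c0) -(ler_pM2l c0) !mulr0.
  have -> : c * (c * (rdot (T x) x - c^-1 * rnorm (T x) ^+ 2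
     - c^-1 * (rnorm (T x) ^+ 2 - c^-1 * rdot (T (T x)) (T x))))
   = c * (c * rdot (T x) x) - 2 * (c * rnorm (T x) ^+ 2) + rdot (T (T x)) (T x).
    by field; rewrite gt_eqF.
  have := ler_wpM2l (ltW c0) gu; lra.
(* Riesz projects [y] to the closure of the range of [T]. The rest [y - w] lies in the kernel of
   [T], which is the eigenspace; [y] is orthogonal to it, hence [y = w]. *)
have [w [hw aw]] : exists w : H, (forall u, setT u -> '[T u, y] = '[T u, w]) /\
    forall e, 0 < e -> exists2 u, setT u & rnorm (w - T u) < e.
  apply: (@riesz_subspace R H H setT T (fun u => '[T u, y]) (rnorm y)) => //.
    by move=> a u v _ _; split; rewrite ?T_linear// dotDl dotZl.
  by move=> u _; rewrite mulrC; exact: cabs_dot_le.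
have Tk : T (y - w) = 0.
  by apply: dot_inj => v; rewrite -T_sym dotBr hw// subrr dot0r.
have kyw : eigenkernel A l%:C%C (y - w).
  by apply/eigenkernel_resolvent; apply/eqP; rewrite eq_sym -subr_eq0 -/(T _) Tk.
have yw : y = w.
  apply/eqP; rewrite -subr_eq0; apply/eqP/rnorm_eq0/eqP; rewrite -sqrf_eq0 -rdotxx.
  rewrite rdotBl {1}/rdot oy// sub0r oppr_eq0.
  suff -> : rdot w (y - w) = 0 by [].
  rewrite /rdot; suff -> : '[w, y - w] = 0 by [].
  apply: cabs_eq0; apply/eqP; rewrite eq_le cabs_ge0 andbT.
  apply: (@le_eps_mul _ _ _ (rnorm (y - w)) (rnorm_ge0 _)) => e e0.
  have [u _ /ltW hu] := aw e e0; rewrite add0r.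
  have -> : '[w, y - w] = '[w - T u, y - w] by rewrite dotBl T_sym Tk dot0r subr0.
  by apply: le_trans (cabs_dot_le _ _) _; rewrite ler_wpM2r ?rnorm_ge0.
have aprox e : 0 < e -> exists u, rnorm (y - T u) < e.
  by move=> e0; have [u _ hu] := aw e e0; exists u; rewrite yw.
(* The form of [S] is nonnegative on the range of [T]; continuity extends this to the limit point
   [y]. *)
pose S x := T x - c%:C%C *: x.
have bid (a : R) : bounded_operator (fun x : H => a%:C%C *: x).
  apply/bounded_operatorP; split; first by move=> k u v; rewrite scalerDr !scalerA mulrC.
  by exists `|a| => // u; rewrite rnormZR.
have bS : bounded_operator S.
  by apply: bounded_sub (bid c); exact: (bounded_sub (bid d^-1) (resolvent_bounded rz)).
have sS u v : '[S u, v] = '[u, S v].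
  by rewrite dotBl dotBr dotZl dotZr conjR T_sym.
have qS u : rdot (S u) u = rdot (T u) u - c * rnorm u ^+ 2.
  by rewrite rdotBl rdotZl rdotxx.
have [b b0 hb] := bounded_opbound bS.
have main : 0 <= rdot (S y) y.
  apply: (@le_eps_mul _ _ _ (2 * b * (rnorm y + 1) + b)).
    by rewrite addr_ge0 ?mulr_ge0 ?addr_ge0 ?rnorm_ge0// ltW.
  move=> e e0; pose e' := Num.min e 1.
  have e'0 : 0 < e' by rewrite lt_min e0 ltr01.
  have [u /ltW hu] := aprox e' e'0.
  have hue : rnorm (y - T u) <= e by apply: le_trans hu _; rewrite ge_min lexx.
  have hu1 : rnorm (y - T u) <= 1 by apply: le_trans hu _; rewrite ge_min lexx orbT.
  have E := quadD bS sS (T u) (y - T u); rewrite [T u + _]addrC subrK in E.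
  have p1 : 0 <= rdot (S (T u)) (T u) by rewrite qS subr_ge0.
  have Tu : rnorm (T u) <= rnorm y + 1.
    by have := rnormB y (y - T u); rewrite opprB addrC subrK; lra.
  have p2 : - rdot (S (T u)) (y - T u) <= b * (rnorm y + 1) * e.
    apply: le_trans (ler_norm _) _; rewrite normrN; apply: le_trans (rdot_abs_le _ _) _.
    apply: ler_pM; rewrite ?rnorm_ge0//; apply: le_trans (hb _) _.
    by rewrite ler_wpM2l// ltW.
  have p3 : - rdot (S (y - T u)) (y - T u) <= b * e.
    apply: le_trans (ler_norm _) _; rewrite normrN; apply: le_trans (quad_le _ hb) _.
    rewrite ler_wpM2l ?(ltW b0)// expr2.
    by apply: le_trans (ler_pM (rnorm_ge0 _) (rnorm_ge0 _) hue hu1) _; rewrite mulr1.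
  by rewrite E; move: p1 p2 p3; lra.
rewrite qS in main.
by move: main; rewrite rdot_Tx /c rdotC [g + d]addrC; lra.
Qed.

End SpectralGap.

(** * Dimensions of eigenspaces and diagonalization on a finite-dimensional span *)

Section Dimension.
Variable R : realType.
Local Notation C := R[i].
Variable H : hilbertType R.
Implicit Types (S : set H) (e f : nat -> H) (x y : H).

Lemma onb_orthonormal k e : onb k e ->
  orthonormal (@hdot R H) [seq e i | i <- iota 0 k].
Proof.
move=> oe; apply/orthonormalP.
have inj i j : (i < k)%N -> (j < k)%N -> e i = e j -> i = j.
  move=> ik jk E; have := oe i j ik jk; rewrite E oe// eqxx.
  by case: eqP => // _ /eqP; rewrite oner_eq0.
split.
  rewrite map_inj_in_uniq ?iota_uniq// => i j; rewrite !mem_iota /= !add0n.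
  exact: inj.
move=> _ _ /mapP[i + ->] /mapP[j + ->]; rewrite !mem_iota /= !add0n => ik jk.
rewrite oe//; congr (nat_of_bool _)%:R.
by apply/eqP/eqP => [->//|]; exact: inj.
Qed.

Lemma orthonormal_onb (s : seq H) : orthonormal (@hdot R H) s -> onb (size s) (nth 0 s).
Proof.
move=> /orthonormalP[us os] i j il jl; rewrite os ?mem_nth//.
by rewrite nth_uniq.
Qed.

Lemma onb_take k m e : (k <= m)%N -> onb m e -> onb k e.
Proof. by move=> km oe i j ik jk; rewrite oe// (leq_trans _ km). Qed.

Lemma in_span_onb m e x : onb m e -> in_span m e x -> orth_to m e x -> x = 0.
Proof.
move=> oe [c ->] o; rewrite /comb big1// => i _.
by have := o i (ltn_ord i); rewrite dot_comb// => ->; rewrite scale0r.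
Qed.

Lemma in_span_comb k m e f x : (forall i, (i < k)%N -> in_span m e (f i)) ->
  in_span k f x -> in_span m e x.
Proof.
move=> h [c ->]; elim: k h => [|k IH] h.
  by exists (fun=> 0); rewrite /comb big_ord0 big1// => i _; rewrite scale0r.
have [i ik|a Ea] := IH; first exact: h (ltnW ik).
have [b Eb] := h k (ltnSn k).
exists (fun i => a i + c k * b i); rewrite /comb big_ord_recr /=.
rewrite -/(comb k f c) Ea Eb /comb scaler_sumr -big_split /=.
by apply: eq_bigr => i _; rewrite scalerDl scalerA.
Qed.

Lemma onb_size_le k m e f : onb k f -> onb m e ->
  (forall i, (i < k)%N -> in_span m e (f i)) -> (k <= m)%N.
Proof.
move=> of_ oe h; rewrite leqNgt; apply/negP => mk.
have [x [sx x0 ox]] := exists_orth e (onb_take mk of_).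
move/eqP: x0; apply; apply: (in_span_onb oe) ox.
by apply: in_span_comb sx => i im; apply: h; exact: leq_trans mk.
Qed.

Definition unit_of x : H := (rnorm x)^-1%:C%C *: x.

Lemma rnorm_unit_of x : x != 0 -> rnorm (unit_of x) = 1.
Proof.
move=> x0; have nx := rnorm_gt0 x0.
by rewrite rnormZR ger0_norm ?invr_ge0 ?rnorm_ge0// mulVf// gt_eqF.
Qed.

Lemma onb_extend m e y : onb m e -> orth_to m e y -> y != 0 ->
  onb m.+1 (fun i => if i == m then unit_of y else e i).
Proof.
move=> oe oy y0 i j; rewrite !ltnS (leq_eqVlt i) (leq_eqVlt j).
have ou : orth_to m e (unit_of y) by move=> l lm; rewrite dotZl oy// mulr0.
have [->|im] := eqVneq i m; have [->|jm] := eqVneq j m => //=.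
- by move=> _ _; rewrite dotE rnorm_unit_of// expr1n ?eqxx.
- by move=> _ jk'; rewrite ou.
- by move=> ik' _; rewrite dotC ou// conjC0 (negbTE im).
- by move=> ik' jk'; rewrite oe.
Qed.

Lemma onb_span_eq m e f : onb m e -> onb m f -> (forall i, (i < m)%N -> in_span m e (f i)) ->
  forall x, in_span m e x -> in_span m f x.
Proof.
move=> oe of_ h x sx; exists (fun i => '[x, f i]); apply/eqP; rewrite -subr_eq0.
apply/negPn/negP => y0; set y := x - _ in y0.
have oy : orth_to m f y by exact: orth_proj.
suff h' i : (i < m.+1)%N -> in_span m e (if i == m then unit_of y else f i).
  by have := onb_size_le (onb_extend of_ oy y0) oe h'; rewrite ltnn.
rewrite ltnS leq_eqVlt; case: eqP => [_ _|_ /= im]; last exact: h.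
have sp : in_span m e (proj m f x).
  by apply: in_span_comb h _; exists (fun i => '[x, f i]).
have [a Ea] := sx; have [b Eb] := sp.
exists (fun i => (rnorm y)^-1%:C%C * (a i - b i)).
have yE : y = comb m e a - comb m e b by rewrite -Ea -Eb.
rewrite /unit_of {2}yE /comb -sumrB scaler_sumr.
by apply: eq_bigr => j _; rewrite -scalerBl scalerA.
Qed.

Lemma hdim_span S k e : onb k e -> (forall i, (i < k)%N -> S (e i)) ->
  (forall x, S x -> in_span k e x) -> hdim S = (k%:R)%:E.
Proof.
move=> oe Se sS; apply/eqP; rewrite eq_le; apply/andP; split.
  apply: ge_ereal_sup => _ [s [os Ss] <-]; rewrite lee_fin ler_nat.
  apply: (onb_size_le (orthonormal_onb os) oe) => i il.
  by apply: sS; apply: Ss; exact: mem_nth.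
apply: ereal_sup_ubound; exists [seq e i | i <- iota 0 k].
  split; first exact: onb_orthonormal.
  by move=> _ /mapP[i + ->]; rewrite mem_iota /= add0n => ik; exact: Se.
by rewrite size_map size_iota.
Qed.

Lemma hdim_basis S (m : nat) :
  (forall a x y, S x -> S y -> S (a *: x + y)) ->
  hdim S = (m%:R)%:E ->
  exists e, [/\ onb m e, forall i, (i < m)%N -> S (e i) & forall x, S x -> in_span m e x].
Proof.
move=> lS hS.
have ub (s : seq H) : orthonormal (@hdot R H) s -> (forall u, u \in s -> S u) -> (size s <= m)%N.
  move=> os Ss; rewrite -(ler_nat R) -lee_fin -hS; apply: ereal_sup_ubound.
  by exists s.
have [s [os Ss] sm] : exists2 s : seq H, orthonormal (@hdot R H) s /\
    (forall u, u \in s -> S u) & size s = m.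
  (* A supremum of integers with value [m] is attained: otherwise it would be at most [m - 1]. *)
  apply: contrapT => no.
  have : (hdim S <= (m%:R - 1 : R)%:E)%E.
    apply: ge_ereal_sup => _ [s [os Ss] <-]; rewrite lee_fin lerBrDr natr1 ler_nat.
    rewrite ltn_neqAle ub// andbT; apply/eqP => sm; apply: no; by exists s.
  by rewrite hS lee_fin lerBrDr gerDl ler10.
have oe := orthonormal_onb os; rewrite sm in oe.
have Se i : (i < m)%N -> S (nth 0 s i) by rewrite -sm => im; apply: Ss; exact: mem_nth.
exists (nth 0 s); split=> // x Sx; apply: contrapT => nx.
set y := x - proj m (nth 0 s) x.
have y0 : y != 0.
  rewrite subr_eq0; apply/eqP => E; apply: nx; rewrite E.
  by exists (fun i => '[x, nth 0 s i]).
have Sp (k : nat) (c : nat -> C) z : (k <= m)%N -> S z -> S (z - \sum_(i < k) c i *: nth 0 s i).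
  elim: k => [_|k IH km] Sz; first by rewrite big_ord0 subr0.
  rewrite big_ord_recr /= opprD addrA addrC -scaleNr.
  by apply: (lS (- c k) (nth 0 s k)); [exact: (Se k km)|exact: IH (ltnW km) Sz].
have Sy : S y by exact: Sp.
have Su : S (unit_of y).
  have := lS (rnorm y)^-1%:C%C y (y - y) Sy; rewrite subrr addr0; apply.
  by have := lS (-1) y y Sy Sy; rewrite scaleN1r addNr.
have oy := onb_extend oe (orth_proj x oe) y0.
suff h v : v \in [seq (if i == m then unit_of y else nth 0 s i) | i <- iota 0 m.+1] -> S v.
  by have := ub _ (onb_orthonormal oy) h; rewrite size_map size_iota ltnn.
move=> /mapP[i + ->]; rewrite mem_iota leq0n add0n andTb ltnS leq_eqVlt.
by case: eqP => //= _ im; exact: Se.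
Qed.

(** Obtained from [top_eigenvectors]: [S] is compressed to the span of [e] and replaced by
    [-(b + 1)] on the complement, below the lower bound [-b] of the compression. *)
Lemma diagonalize m e (S : H -> H) : onb m e -> bounded_operator S ->
  (forall x y, '[S x, y] = '[x, S y]) ->
  exists u rho, [/\ onb m u, forall i, (i < m)%N -> in_span m e (u i),
    forall i j, (i < m)%N -> (j < m)%N -> '[S (u i), u j] = (i == j)%:R * (rho i)%:C%C &
    forall i j, (i <= j)%N -> (j < m)%N -> rho j <= rho i].
Proof.
move=> oe bS sS; have lS := bounded_linear bS.
have [b b0 hb] := bounded_opbound bS.
pose P := proj m e.
have Pspan x : in_span m e (P x) by exists (fun i => '[x, e i]).
have Porth x : orth_to m e (x - P x) by exact: orth_proj.
have sP x y : '[P x, y] = '[x, P y].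
  have h a c : '[P a, c] = '[P a, P c].
    by rewrite -[c in LHS](subrK (P c)) dotDr (_ : '[P a, c - P c] = 0) ?add0r//
      dotC orth_comb ?conjC0.
  by rewrite (h x y) [RHS]dotC (h y x) -dotC.
have lP : linear P.
  move=> a x y; apply: dot_inj => z; rewrite -sP dotDr dotZr.
  by rewrite dotDr dotZr !sP.
have bP : bounded_operator P.
  apply/bounded_operatorP; split=> //; exists 1 => // x; rewrite mul1r.
  rewrite -(@ler_pXn2r _ 2)// ?nnegrE ?rnorm_ge0//.
  rewrite -[x in leRHS](subrK (P x)) addrC pythagoras ?lerDl ?exprn_ge0 ?rnorm_ge0//.
  by rewrite dotC orth_comb ?conjC0.
have Pid x : in_span m e x -> P x = x.
  move=> sx; apply/eqP; rewrite eq_sym -subr_eq0; apply/eqP/(in_span_onb oe); last exact: Porth.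
  have [a Ea] := sx; have [c Ec] := Pspan x; exists (fun i => a i - c i).
  rewrite {1}Ea Ec /comb -sumrB; by apply: eq_bigr => i _; rewrite scalerBl.
pose N x := P (S (P x)) - (b + 1)%:C%C *: (x - P x).
have bN : bounded_operator N.
  apply: bounded_sub; first exact: (bounded_comp bP (bounded_comp bS bP)).
  apply: bounded_scale; apply: bounded_sub bP; apply/bounded_operatorP.
  by split=> //; exists 1 => // x; rewrite mul1r.
have sN x y : '[N x, y] = '[x, N y].
  by rewrite dotBl dotBr sP sS sP dotZl dotZr conjR dotBl dotBr sP.
have Nspan x : in_span m e x -> N x = P (S x).
  by move=> sx; rewrite /N (Pid x sx) subrr scaler0 subr0.
have Northo y : orth_to m e y -> P y = 0.
  by move=> oy; rewrite /P /proj /comb big1// => i _; rewrite oy// scale0r.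
have [|||u [rho [es hrho]]] := @top_eigenvectors R H N bN sN m e (- (b + 1)) (- b) oe.
- by rewrite ltrN2 ltrDl.
- move=> y oy; rewrite /N (Northo y oy) subr0 (linear_map0 lS) (linear_map0 lP) sub0r.
  by rewrite rdotNl rdotZl rdotxx mulNr.
- move=> x sx; rewrite Nspan// /rdot sP (Pid x sx) -/(rdot _ _).
  have := quad_le x hb; rewrite ler_norml mulNr => /andP[]; lra.
have [ou eu _] := es.
(* On the component [w] of [u i] in the complement, [N] acts as [-(b + 1)], which differs from
   [rho i >= -b]; hence [w = 0]. *)
have su i : (i < m)%N -> in_span m e (u i).
  move=> im; suff -> : u i = P (u i) by exact: Pspan.
  apply/eqP; rewrite -subr_eq0; set w := u i - P (u i).
  have E : N (u i) = (rho i)%:C%C *: u i by exact: eu.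
  have Pw : P w = 0 by apply: Northo; exact: Porth.
  have NE : '[N (u i), w] = - ((b + 1)%:C%C * '[w, w]).
    by rewrite /N dotBl sP Pw dot0r sub0r dotZl.
  have uw : '[u i, w] = '[w, w].
    by rewrite -[u i in LHS](subrK (P (u i))) dotDl sP Pw dot0r addr0.
  move: NE; rewrite E dotZl uw -mulNr -rmorphN dotE => /eqP.
  rewrite -!rmorphM (inj_eq (@complexI R)) -subr_eq0 -mulrBl mulf_eq0 => /orP[|].
    have := hrho i im => h /eqP h'; move: h h'; lra.
  by rewrite sqrf_eq0 => /eqP/rnorm_eq0 ->.
exists u, rho; split=> //.
  move=> i j im jm; rewrite -(es_diag es im jm) Nspan; last exact: su.
  by rewrite sP (Pid (u j) (su j jm)).
by move=> i j ij jm; exact: (es_mono es).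
Qed.

Lemma eigenkernel_linear (A : operator H) z : hermitian_op A ->
  forall a x y, eigenkernel A z x -> eigenkernel A z y -> eigenkernel A z (a *: x + y).
Proof.
move=> hA a x y [dx Ex] [dy Ey]; have [d E] := hermitian_linear hA a dx dy.
by split=> //; rewrite E Ex Ey scalerDr !scalerA mulrC.
Qed.

(** From an eigenvector for [z] subtract its components along the [f j] with eigenvalue [z]. The
    remainder is orthogonal to these by construction and to the other [f j] because eigenvalues
    differ, so it vanishes by assumption. *)
Lemma hdim_eigenkernel (A : operator H) m f (lam : 'I_m -> R) z : hermitian_op A -> onb m f ->
  (forall i : 'I_m, eigenkernel A (lam i)%:C%C (f i)) ->
  (forall x, eigenkernel A z x -> orth_to m f x -> x = 0) ->
  hdim (eigenkernel A z) = (#|[set j : 'I_m | (lam j)%:C%C == z]|%:R)%:E.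
Proof.
move=> hA of_ ef hz; have [_ sA _] := hA.
pose J := enum [set j : 'I_m | (lam j)%:C%C == z].
pose g i := nth 0 [seq f (nat_of_ord j) | j <- J] i.
have sJ : size J = #|[set j : 'I_m | (lam j)%:C%C == z]| by rewrite cardE.
have zero i x : eigenkernel A z x -> (lam i)%:C%C != z -> '[x, f i] = 0.
  move=> [dx Ex] li; have [df Ef] := ef i; have := sA x (f i) dx df.
  rewrite Ex Ef dotZl dotZr conjR => /eqP; rewrite -subr_eq0 -mulrBl mulf_eq0 subr_eq0.
  by rewrite [z == _]eq_sym (negbTE li) => /eqP.
have uJ : uniq J by exact: enum_uniq.
have og : onb (size J) g.
  (* [nth_map] takes a default ordinal, which exists only for positive [m]. *)
  case: (posnP m) => m0 i j iJ jJ.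
    have J0 : size J = 0%N.
      by rewrite sJ; apply: eq_card0 => -[l lm]; exfalso; have := lm; rewrite [X in (_ < X)%N]m0.
    by have := iJ; rewrite J0.
  pose o : 'I_m := Ordinal m0.
  rewrite /g !(nth_map o)// of_//; congr (nat_of_bool _)%:R.
  by rewrite -(nth_uniq o iJ jJ uJ).
have gE i : (i < size J)%N -> exists2 j, j \in J & g i = f j.
  move=> iJ; have := mem_nth 0 (s := [seq f (nat_of_ord j) | j <- J]) (n := i).
  by rewrite size_map => /(_ iJ) /mapP[j jJ E]; exists j.
rewrite -sJ; apply: (@hdim_span _ _ g) => //.
- move=> i iJ; have [j jJ ->] := gE i iJ; move: jJ; rewrite mem_enum inE => /eqP <-.
  exact: ef.
- move=> x kx; exists (fun i => '[x, g i]); apply/eqP; rewrite -subr_eq0; apply/eqP.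
  set y := x - _.
  have Sg (k : nat) (c : nat -> C) v : (k <= size J)%N -> eigenkernel A z v ->
      eigenkernel A z (v - \sum_(i < k) c i *: g i).
    elim: k => [_|k IH kJ] kv; first by rewrite big_ord0 subr0.
    rewrite big_ord_recr /= opprD addrA addrC -scaleNr.
    apply: (eigenkernel_linear hA); last exact: IH (ltnW kJ) kv.
    have [j jJ ->] := gE k kJ; move: jJ; rewrite mem_enum inE => /eqP <-.
    exact: ef.
  have ky : eigenkernel A z y by exact: (Sg (size J) (fun i => '[x, g i])).
  apply: (hz _ ky) => i im; have [zi|nzi] := eqVneq (lam (Ordinal im))%:C%C z; last first.
    exact: (zero (Ordinal im) y ky nzi).
  have iJ : Ordinal im \in J by rewrite mem_enum inE; apply/eqP.
  have [k kJ gk] : exists2 k, (k < size J)%N & g k = f i.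
    exists (index (Ordinal im) J); first by rewrite index_mem.
    by rewrite /g (nth_map (Ordinal im)) ?index_mem// nth_index.
  rewrite -gk; exact: (orth_proj x og kJ).
Qed.

End Dimension.

(** * Bifurcating eigenvalues *)

Section ParameterFilters.
Variable R : realType.
Variable t0 : R.

Lemma near01_filter : Filter (near01 t0).
Proof. exact: within_filter. Qed.

Lemma dnear01_filter : Filter (dnear01 t0).
Proof. exact: within_filter. Qed.

Lemma near01P (P : set R) : near01 t0 P <->
  exists2 e, 0 < e & forall t, t \in `[0, 1] -> `|t - t0| < e -> P t.
Proof.
split=> [/nbhs_ballP[e /= e0 h]|[e e0 h]].
  by exists e => // t t01 te; apply: h t01; rewrite -ball_normE /= distrC.
apply/nbhs_ballP; exists e => // t; rewrite -ball_normE /= distrC => te t01.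
exact: h.
Qed.

Lemma dnear01P (P : set R) : dnear01 t0 P <->
  exists2 e, 0 < e & forall t, t \in `[0, 1] -> t != t0 -> `|t - t0| < e -> P t.
Proof.
split=> [/nbhs_ballP[e /= e0 h]|[e e0 h]].
  by exists e => // t t01 tn te; apply: h tn t01; rewrite -ball_normE /= distrC.
apply/nbhs_ballP; exists e => // t; rewrite -ball_normE /= distrC => te tn t01.
exact: h.
Qed.

Lemma near01_in : near01 t0 [set t | t \in `[0, 1]].
Proof. by apply/near01P; exists 1. Qed.

Lemma dnear01_in : dnear01 t0 [set t | t \in `[0, 1]].
Proof. by apply/dnear01P; exists 1. Qed.

Lemma dnear01_neq : dnear01 t0 [set t | t != t0].
Proof. by apply/dnear01P; exists 1. Qed.

Lemma dnear01_dist e : 0 < e -> dnear01 t0 [set t | `|t - t0| < e].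
Proof. by move=> e0; apply/dnear01P; exists e. Qed.

Lemma near01_dnear01 (P : set R) : near01 t0 P -> dnear01 t0 P.
Proof.
by move=> /near01P[e e0 h]; apply/dnear01P; exists e => // t t01 _; exact: h.
Qed.

Lemma dnear01_near01 (P : set R) : dnear01 t0 P -> P t0 -> near01 t0 P.
Proof.
move=> /dnear01P[e e0 h] h0; apply/near01P; exists e => // t t01 te.
by have [->//|tn] := eqVneq t t0; exact: h.
Qed.

Hypothesis t01 : t0 \in `[0, 1].

Lemma near01_at (P : set R) : near01 t0 P -> P t0.
Proof. by move=> /near01P[e e0]; apply; rewrite ?subrr ?normr0. Qed.

(** The point is found by stepping towards the interior of the interval: to the right if
    [t0 <= 1 / 2], otherwise to the left. *)
Lemma dnear01_ex (P : set R) : dnear01 t0 P -> exists t, P t.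
Proof.
move=> /dnear01P[e e0 h]; move: t01; rewrite in_itv /= => /andP[a b].
pose s := Num.min (e / 2) (1 / 2).
have s0 : 0 < s by rewrite lt_min !divr_gt0.
have se : s < e.
  have : s <= e / 2 by rewrite ge_min lexx.
  by move: e0; lra.
have s1 : s <= 1 / 2 by rewrite ge_min lexx orbT.
have [l|l] := lerP t0 (1 / 2).
  exists (t0 + s); apply: h.
  - by rewrite in_itv /=; apply/andP; split; move: s0 s1 a l; lra.
  - by rewrite -subr_eq0 addrAC subrr add0r gt_eqF.
  - by rewrite addrAC subrr add0r gtr0_norm.
exists (t0 - s); apply: h.
- by rewrite in_itv /=; apply/andP; split; move: s0 s1 b l; lra.
- by rewrite -subr_eq0 addrAC subrr add0r oppr_eq0 gt_eqF.
- by rewrite addrAC subrr add0r normrN gtr0_norm.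
Qed.

End ParameterFilters.

#[export] Existing Instance near01_filter.
#[export] Existing Instance dnear01_filter.

Section BifurcationLabels.
Variable R : realType.

(* The labels are reversed to the left of t0, where increasing slopes
   correspond to decreasing perturbations. *)
Definition flip (m : nat) (t0 t : R) (j : nat) : nat :=
  if t < t0 then (m - j.+1)%N else j.

Lemma flip_lt m t0 t j : (j < m)%N -> (flip m t0 t j < m)%N.
Proof. by rewrite /flip; case: ifP => // _ jm; rewrite subnS prednK ?subn_gt0// leq_subr. Qed.

Lemma flipK m t0 t j : (j < m)%N -> flip m t0 t (flip m t0 t j) = j.
Proof. by rewrite /flip; case: (t < t0) => // jm; rewrite subnSK// subKn// ltnW. Qed.

Lemma onb_flip (H : hilbertType R) m t0 t (e : nat -> H) :
  onb m e -> onb m (fun i => e (flip m t0 t i)).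
Proof.
move=> oe i j im jm; rewrite oe ?flip_lt//; congr (nat_of_bool _)%:R.
by apply/eqP/eqP => [E|->//]; rewrite -(flipK t0 t im) E flipK.
Qed.

End BifurcationLabels.

Lemma eigenkernel_of_resolvent (R : realType) (H : hilbertType R) (A : operator H)
    (z mu : R) (f : H) : hermitian_op A -> ~ spectrum A z%:C%C -> mu != 0 ->
  resolvent A z%:C%C f = mu%:C%C *: f -> eigenkernel A (z + mu^-1)%:C%C f.
Proof.
move=> hA rz mu0 E; have [dB EB] := resolventP rz f; rewrite E in dB EB.
have [df E'] := hermitian_domZ hA mu^-1%:C%C dB.
have fE : mu^-1%:C%C *: (mu%:C%C *: f) = f.
  by rewrite scalerA -rmorphM mulVf// scale1r.
rewrite fE in df E'; split=> //; rewrite E'.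
have -> : A (mu%:C%C *: f) = f + z%:C%C *: (mu%:C%C *: f) by rewrite -{2}EB subrK.
rewrite scalerDr !scalerA -!rmorphM -scalerDl -rmorphD.
by congr (_%:C%C *: _); rewrite addrC mulrA mulrAC mulVf// mul1r.
Qed.

Lemma resolvent_symmetric (R : realType) (H : hilbertType R) (A : operator H) (s : R) x y :
  hermitian_op A ->
  ~ spectrum A s%:C%C -> '[resolvent A s%:C%C x, y] = '[x, resolvent A s%:C%C y].
Proof. by move=> hA rs; rewrite resolvent_adjoint// conjR. Qed.

(** Used for the derivative of the resolvent at a real point and for $\dot V_{t_0}$. *)
Lemma limit_symmetric (R : realType) (H : hilbertType R) (F : set_system R)
    (f : R -> H -> H) (g : H -> H) : Filter F ->
  (forall P, F P -> exists t, P t) ->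
  (\forall t \near F, forall x y, '[f t x, y] = '[x, f t y]) ->
  (forall e, 0 < e -> \forall t \near F, opbound (fun x => f t x - g x) e) ->
  forall x y, '[g x, y] = '[x, g y].
Proof.
move=> FF ex fs fg x y; apply/eqP; rewrite -subr_eq0; apply/eqP/cabs_eq0/eqP.
rewrite eq_le cabs_ge0 andbT; apply: (@le_eps_mul _ _ _ (2 * (rnorm x * rnorm y))).
  by rewrite !mulr_ge0 ?rnorm_ge0.
move=> e e0; have [t [st ct]] := ex _ (filterI fs (fg e e0)); rewrite add0r.
have -> : '[g x, y] - '[x, g y] = '[x, f t y - g y] - '[f t x - g x, y].
  by rewrite dotBl dotBr st; ring.
apply: le_trans (cabsD _ _) _; rewrite cabsN.
have h1 := cabs_dot_le x (f t y - g y); have h2 := cabs_dot_le (f t x - g x) y.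
have := ler_wpM2l (rnorm_ge0 x) (ct y); have := ler_wpM2r (rnorm_ge0 y) (ct x).
by move: h1 h2; lra.
Qed.

(** Only resolvents at real points enter. Since $\mu=1/(\lambda-z_0)$ has the value $1/d$ at [l0], a
    slope $\rho$ of $\mu$ is a slope $-d^2\rho$ of $\lambda$; the vectors [u] diagonalize the form
    of [S (l0 - d)] on the eigenspace. *)
Lemma bifurcating_eigenvalues (R : realType) (H : hilbertType R) (Hf : R -> operator H)
    (t0 l0 : R) (m : nat) (S : R -> H -> H) : t0 \in `[0, 1] ->
  (forall t, t \in `[0, 1] -> hermitian_op (Hf t)) ->
  (forall s : R, ~ spectrum (Hf t0) s%:C%C -> forall e, 0 < e ->
    \forall t \near near01 t0, ~ spectrum (Hf t) s%:C%C /\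
      opbound (fun h => resolvent (Hf t) s%:C%C h - resolvent (Hf t0) s%:C%C h) e) ->
  (forall s : R, ~ spectrum (Hf t0) s%:C%C -> bounded_operator (S s)) ->
  (forall s : R, ~ spectrum (Hf t0) s%:C%C -> forall e, 0 < e ->
    \forall t \near dnear01 t0,
      opbound (fun h => ((t - t0)^-1)%:C%C *:
        (resolvent (Hf t) s%:C%C h - resolvent (Hf t0) s%:C%C h) - S s h) e) ->
  isolated_eigenvalue (Hf t0) l0 m ->
  exists (d : R) (u : nat -> H) (lam : 'I_m -> R -> R) (rho : nat -> R),
  [/\ 0 < d /\ ~ spectrum (Hf t0) (l0 - d)%:C%C,
      onb m u /\ (forall j, (j < m)%N -> eigenkernel (Hf t0) l0%:C%C (u j)),
      bifurcating Hf t0 l0 lam,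
      forall j, (j < m)%N -> '[S (l0 - d) (u j), u j] = (rho j)%:C%C &
      forall j : 'I_m, (t - t0)^-1 * (lam j t - lam j t0) @[t --> dnear01 t0]
        --> - (d ^+ 2 * rho j)].
Proof.
move=> t01 hH cont bS diff iso.
have [ra [ra0 hra]] : exists ra, 0 < ra /\ forall s : R, s != l0 -> `|s - l0| < ra ->
    ~ spectrum (Hf t0) s%:C%C.
  case: iso => _ [ra ra0 h] _; exists ra; split=> // s sl sr sp.
  move/eqP: sl; apply; apply: (@complexI R); apply: h => //.
  by rewrite -rmorphB /= cabsE cabsR ltcR.
have h0 := hH _ t01.
(* [d] is fixed before the radius [r] of [bifurcating] is given; [d < ra / 2] keeps the base point
   within the enlarged radius [r2] used there. *)
have [d d0 dra2] : exists2 d, 0 < d & d < ra / 2 by exists (ra / 4); lra.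
have dra : d < ra by move: dra2 ra0; clear; lra.
pose z0 := l0 - d; have rz : ~ spectrum (Hf t0) z0%:C%C by exact: (gap_resolvent d0 dra hra).
pose B t := resolvent (Hf t) z0%:C%C.
have lin : forall a x y, eigenkernel (Hf t0) l0%:C%C x -> eigenkernel (Hf t0) l0%:C%C y ->
    eigenkernel (Hf t0) l0%:C%C (a *: x + y) by exact: eigenkernel_linear.
have [e [oe ke se]] : exists e, [/\ onb m e,
    forall i, (i < m)%N -> eigenkernel (Hf t0) l0%:C%C (e i) &
    forall x, eigenkernel (Hf t0) l0%:C%C x -> in_span m e x].
  by case: iso => _ _ hd; exact: hdim_basis.
have k0 : eigenkernel (Hf t0) l0%:C%C 0.
  by split; [exact: hermitian_dom0|rewrite (hermitian_op0 h0) scaler0].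
have spank x : in_span m e x -> eigenkernel (Hf t0) l0%:C%C x.
  case=> c ->; have : forall k, (k <= m)%N ->
      eigenkernel (Hf t0) l0%:C%C (\sum_(i < k) c i *: e i); last exact.
  elim=> [|k IH] km; first by rewrite big_ord0.
  by rewrite big_ord_recr /= addrC; apply: lin; [exact: ke|exact: IH (ltnW km)].
have sS : forall x y, '[S z0 x, y] = '[x, S z0 y].
  apply: (@limit_symmetric R H (dnear01 t0) (fun t h => ((t - t0)^-1)%:C%C *: (B t h - B t0 h))).
  - by move=> P; exact: dnear01_ex.
  - apply: filterS2 (near01_dnear01 (cont _ rz _ ltr01)) (dnear01_in t0) => t [rt _] tI x y.
    rewrite dotZl dotZr conjR dotBl dotBr.
    by rewrite !(resolvent_symmetric _ _ (hH _ tI) rt) !(resolvent_symmetric _ _ h0 rz).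
  - exact: (diff _ rz).
have [u [rho [ou su du rho_mono]]] := diagonalize oe (bS _ rz) sS.
have spu x : in_span m u x -> in_span m e x by exact: in_span_comb.
have spe x : in_span m e x -> in_span m u x by exact: onb_span_eq.
have ku j : (j < m)%N -> eigenkernel (Hf t0) l0%:C%C (u j) by move=> jm; apply/spank/su.
(* c0 is the top of the spectrum of B t0 and q0 bounds its form on the complement. *)
pose c0 := d^-1; have c00 : 0 < c0 by rewrite invr_gt0.
have B0u x : in_span m u x -> B t0 x = c0%:C%C *: x.
  by move=> sx; apply/(eigenkernel_resolvent h0 d0 dra hra)/spank/spu.
have upper g : d < g -> (forall s : R, s != l0 -> `|s - l0| < g -> ~ spectrum (Hf t0) s%:C%C) ->
    forall y, orth_to m u y -> rdot (B t0 y) y <= (g + d)^-1 * rnorm y ^+ 2.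
  move=> dg hg y oy; apply: (resolvent_form_upper h0 d0 dg hg) => x kx.
  by have [c ->] := spe x (se x kx); exact: orth_comb.
pose q0 := (ra + d)^-1.
have q0c : q0 < c0.
  by rewrite ltf_pV2 ?posrE ?addr_gt0// ltrDr.
(* A quarter of the gap: [c0 - h] and [q0 + h] stay [2 * h] apart, which bounds the denominators of
   [minmax_bounds] from below. *)
pose h := (c0 - q0) / 4; have hp : 0 < h by rewrite divr_gt0// subr_gt0.
have qb x y e' t : opbound (fun h => B t h - B t0 h) e' ->
    `|rdot (B t x) y - rdot (B t0 x) y| <= e' * rnorm x * rnorm y.
  move=> he; rewrite -rdotBl; apply: le_trans (rdot_abs_le _ _) _.
  by rewrite ler_wpM2r ?rnorm_ge0//; exact: he.
have qq x e' t : opbound (fun h => B t h - B t0 h) e' ->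
    `|rdot (B t x) x - rdot (B t0 x) x| <= e' * rnorm x ^+ 2.
  by move=> he; rewrite expr2 mulrA; exact: qb.
pose good t := [/\ t \in `[0, 1], ~ spectrum (Hf t) z0%:C%C &
  opbound (fun x => B t x - B t0 x) h].
have gnear : \forall t \near near01 t0, good t.
  by apply: filterS2 (cont _ rz _ hp) (near01_in t0) => t [r1 r2] tI.
have bB t : good t -> bounded_operator (B t) by case=> _ rt _; exact: resolvent_bounded.
have sB t : good t -> forall x y, '[B t x, y] = '[x, B t y].
  by case=> tI rt _ x y; exact: (resolvent_symmetric _ _ (hH _ tI) rt).
have quad0 x : in_span m u x -> rdot (B t0 x) x = c0 * rnorm x ^+ 2.
  by move=> sx; rewrite B0u// rdotZl rdotxx.
have upt t : good t -> forall y, orth_to m u y -> rdot (B t y) y <= (q0 + h) * rnorm y ^+ 2.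
  case=> _ _ he y oy; have := upper ra dra hra y oy; have := qq y h t he.
  by rewrite ler_norml => /andP[_]; rewrite -/q0; clear; lra.
(* For the other [t] a dummy pair is taken, so that [choice] gives functions of all [t]. *)
have exf t : exists fm : (nat -> H) * (nat -> R), good t ->
    eigensystem (B t) m fm.1 fm.2 /\ forall i, (i < m)%N -> c0 - h <= fm.2 i.
  have [gt|ngt] := pselect (good t); last by exists (fun=> 0, fun=> 0).
  have [|||f [mu [es hmu]]] := top_eigenvectors (bB t gt) (sB t gt) (q := q0 + h) (p := c0 - h) ou.
  - by rewrite /h; move: q0c; clear; lra.
  - exact: upt.
  - move=> x sx; have := quad0 x sx; case: gt => _ _ he; have := qq x h t he.
    by rewrite ler_norml => /andP[+ _]; clear; lra.
  - by exists (f, mu).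
have [fm fmP] := choice exf.
pose mu t i := (fm t).2 i; pose f t i := (fm t).1 i.
have es t : good t -> eigensystem (B t) m (f t) (mu t) by move=> gt; have [] := fmP t gt.
have muh t i : good t -> (i < m)%N -> c0 - h <= mu t i.
  by move=> gt im; have [_] := fmP t gt; exact.
have ch : 0 < c0 - h.
  have : 0 < q0 by rewrite invr_gt0 addr_gt0.
  by rewrite /h; move: q0c; clear; lra.
have mu0 t i : good t -> (i < m)%N -> 0 < mu t i.
  by move=> gt im; apply: lt_le_trans (muh t i gt im).
(* Min-max comparison with the constant value [c0]; as [e' <= h], the quadratic term is at most
   [e']. *)
have mucont t e' : good t -> 0 <= e' -> e' <= h -> opbound (fun x => B t x - B t0 x) e' ->
    forall i, (i < m)%N -> `|mu t i - c0| <= 2 * e'.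
  move=> gt e'0 e'h he i im.
  have [lo hi] : c0 - e' <= mu t i /\
      mu t i <= c0 + e' + e' ^+ 2 / (c0 + e' - (q0 + h)).
    apply: (minmax_bounds (bB t gt) (sB t gt) (q := q0 + h) (nu := fun=> c0)
      (r := e') (k := e') ou (es t gt)) => //.
    - by move=> j _; rewrite /h; move: q0c e'0; clear; lra.
    - move=> x sx; rewrite -mulr_sumr -(span_norm ou sx) -quad0//; exact: qq.
    - move=> x y sx oy; have := qb x y e' t he; rewrite B0u// rdotZl {2}/rdot.
      have -> : '[x, y] = 0 by have [c ->] := sx; rewrite dotC orth_comb ?conjC0.
      by rewrite mulr0 subr0 => /(le_trans (ler_norm _)).
    - exact: upt.
  have D : 2 * h <= c0 + e' - (q0 + h) by rewrite /h; move: q0c e'0; clear; lra.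
  have D0 : 0 < c0 + e' - (q0 + h) by apply: lt_le_trans D; rewrite mulr_gt0.
  have : e' ^+ 2 / (c0 + e' - (q0 + h)) <= e'.
    rewrite ler_pdivrMr// expr2 ler_wpM2l//; move: D e'h hp; clear; lra.
  by rewrite ler_norml => k; move: lo hi k e'0; clear; lra.
pose sg t j := flip m t0 t j.
pose lam (j : 'I_m) t := l0 - d + (mu t (sg t j))^-1.
have g0 : good t0 by exact: near01_at gnear.
have lam0 j : lam j t0 = l0.
  have /(_ _ _) := mucont t0 0 g0 (lexx _) (ltW hp) _.
  rewrite mulr0 /lam => k.
  have -> : mu t0 (sg t0 j) = c0.
    apply/eqP; rewrite -subr_eq0 -normr_le0; apply: k; last exact: flip_lt.
    by move=> x; rewrite subrr rnorm0 mul0r.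
  by rewrite invrK subrK.
exists d, u, lam, rho; split=> //.
- move=> r r0 hr.
  (* The spectrum of Hf t0 also avoids a disc of radius g > r2 >= r, so that
     eigenvalues of Hf t in the closed disc of radius r stay away from the bound. *)
  pose r2 := Num.max r (ra / 2).
  have r2p : d < r2 by rewrite lt_max dra2 orbT.
  have clean s : s != l0 -> `|s - l0| <= r2 -> ~ spectrum (Hf t0) s%:C%C.
    move=> sl; rewrite le_max => /orP[sr|sr]; last first.
      by apply: hra => //; apply: le_lt_trans sr _; move: ra0; clear; lra.
    move=> sp; move/eqP: sl; apply; apply: (@complexI R); apply: hr => //.
    by rewrite -rmorphB /= cabsE cabsR lecR.
  have r20 : 0 < r2 by apply: lt_trans r2p.
  have [e1 e10 he1] : exists2 e1, 0 < e1 & forall w, cabs ((l0 + r2)%:C%C - w) < e1 ->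
      ~ spectrum (Hf t0) w.
    apply: (resolvent_set_open h0); apply: clean.
      by rewrite -subr_eq0 addrAC subrr add0r gt_eqF.
    by rewrite addrAC subrr add0r gtr0_norm.
  have [e2 e20 he2] : exists2 e2, 0 < e2 & forall w, cabs ((l0 - r2)%:C%C - w) < e2 ->
      ~ spectrum (Hf t0) w.
    apply: (resolvent_set_open h0); apply: clean.
      by rewrite -subr_eq0 addrAC subrr add0r oppr_eq0 gt_eqF.
    by rewrite addrAC subrr add0r normrN gtr0_norm.
  pose e3 := Num.min e1 e2; have e30 : 0 < e3 by rewrite lt_min e10.
  pose g := r2 + e3; have rg : r2 < g by rewrite ltrDl.
  have dg : d < g by apply: lt_trans rg.
  have hg s : s != l0 -> `|s - l0| < g -> ~ spectrum (Hf t0) s%:C%C.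
    move=> sl sg'; have [le|gt] := lerP `|s - l0| r2; first exact: clean.
    have [s0|s0] := lerP 0 (s - l0).
      apply: he1; rewrite -rmorphB cabsR; move: gt sg'; rewrite (ger0_norm s0) => a b.
      have : e3 <= e1 by rewrite ge_min lexx.
      by rewrite ltr_norml; move: a b; rewrite /g; clear; lra.
    apply: he2; rewrite -rmorphB cabsR; move: gt sg'; rewrite (ltr0_norm s0) => a b.
    have : e3 <= e2 by rewrite ge_min lexx orbT.
    by rewrite ltr_norml; move: a b; rewrite /g; clear; lra.
  (* Distances between the images of the radii [r2] and [g] under $s\mapsto1/(s-z_0)$, on either
     side of [z0]. *)
  pose a1 := (r2 + d)^-1 - (g + d)^-1; pose a2 := (r2 - d)^-1 - (g - d)^-1.
  have a10 : 0 < a1 by rewrite subr_gt0 ltf_pV2 ?posrE ?addr_gt0// ?ltrD2r// (lt_trans d0).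
  have a20 : 0 < a2.
    by rewrite subr_gt0 ltf_pV2 ?posrE ?subr_gt0// ltrD2r.
  (* [a1 / 4] leaves room for three errors [e'], two in [mucont] and one in the form on the
     complement; [a2 / 2] for the one in the lower form bound. The last entry gives
     $|\lambda_j-l_0|=d|1/d-\mu|/\mu\le r$. *)
  pose e' := Num.min (Num.min h (a1 / 4)) (Num.min (a2 / 2) (r * (c0 - h) / (2 * d))).
  have e'0 : 0 < e'.
    by rewrite !lt_min hp !divr_gt0// ?mulr_gt0.
  have e'h : e' <= h by rewrite !ge_min lexx.
  have e'1 : e' <= a1 / 4 by rewrite !ge_min lexx !orbT.
  have e'2 : e' <= a2 / 2 by rewrite !ge_min lexx !orbT.
  have e'3 : e' <= r * (c0 - h) / (2 * d) by rewrite !ge_min lexx !orbT.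
  apply: filterS2 gnear (cont _ rz _ e'0) => t gt [rt he]; have [tI _ _] := gt.
  have mc := mucont t e' gt (ltW e'0) e'h he.
  have hHt := hH _ tI; split.
    move=> j; set i := sg t j; have im : (i < m)%N by exact: flip_lt.
    have mi := mu0 t i gt im; have := mc i im; have := muh t i gt im.
    rewrite /lam -/i => m1 m2.
    have -> : l0 - d + (mu t i)^-1 - l0 = (c0 - mu t i) * (d / mu t i).
      by rewrite /c0; field; rewrite !gt_eqF.
    rewrite normrM distrC ger0_norm ?divr_ge0 ?(ltW d0) ?(ltW mi)//.
    rewrite mulrA ler_pdivrMr//.
    have f1 := ler_wpM2r (ltW d0) m2.
    have f2 : 2 * e' * d <= r * (c0 - h).
      by move: e'3; rewrite ler_pdivlMr ?mulr_gt0//; clear; lra.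
    by have := ler_wpM2l (ltW r0) m1; move: f1 f2; clear; lra.
  move=> z zr.
  have est := es t gt; have [of_ ef _] := est.
  apply: (@hdim_eigenkernel _ _ _ _ (fun i => f t (sg t i)) (fun j => lam j t)) => //.
  - exact: onb_flip.
  - move=> j; have jm := flip_lt t0 t (ltn_ord j).
    apply: (eigenkernel_of_resolvent hHt rt); first by rewrite gt_eqF// mu0.
    exact: ef.
  - move=> x kx ofx.
    have ox : orth_to m (f t) x.
      by move=> i im; rewrite -(flipK t0 t im); apply: ofx; exact: flip_lt.
    (* No eigenvector in the disc is missed: one orthogonal to [f t] would satisfy $k\langle
       B_tx,x\rangle=\|x\|^2$ with $d-r_2\le k\le d+r_2$, and the form bounds make the left side
       smaller than the right. *)
    apply/eqP/negPn/negP => x0; have nx := exprn_gt0 2 (rnorm_gt0 x0).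
    have zE := real_of_Im0 (eigenvalue_real hHt kx x0).
    set s := complex.Re z in zE.
    have sr : `|s - l0| <= r2.
      rewrite le_max; apply/orP; left; move: zr.
      by rewrite zE -rmorphB /= cabsE cabsR lecR.
    have [dx Ex] := kx; pose k := s - z0.
    have kB : k * rdot (B t x) x = rnorm x ^+ 2.
      have [dkx Ekx] := hermitian_domZ hHt k%:C%C dx.
      have := resolvent_unique rt dx (erefl (Hf t x - z0%:C%C *: x)).
      rewrite Ex zE -scalerBl -rmorphB -/k (linear_mapZ (bounded_linear (resolvent_bounded rt))).
      by move=> E; rewrite -rdotZl E rdotxx.
    have up : rdot (B t x) x <= ((g + d)^-1 + e') * rnorm x ^+ 2.
      apply: (complement_bound (bB t gt) (sB t gt) ou _ est) ox.
        move=> y oy; have := upper g dg hg y oy; have := qq y e' t he.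
        by rewrite ler_norml => /andP[_]; clear; lra.
      move=> i im; have := mc i im; rewrite ler_norml => /andP[+ _].
      have : (r2 + d)^-1 < c0 by rewrite ltf_pV2 ?posrE ?addr_gt0// ltrDr.
      by move: e'1 a10; rewrite /a1; clear; lra.
    have lo : - ((g - d)^-1 + e') * rnorm x ^+ 2 <= rdot (B t x) x.
      have := resolvent_form_lower h0 d0 dg hg x; have := qq x e' t he.
      by rewrite ler_norml => /andP[+ _]; rewrite -/(B t0 x); clear; lra.
    move: sr; rewrite ler_norml => /andP[s1 s2].
    have [kp|kn] := lerP 0 k.
      have c1 : 0 < (g + d)^-1 + e' by rewrite addr_gt0// invr_gt0 addr_gt0// (lt_trans d0).
      have c2 : (r2 + d) * ((g + d)^-1 + e') < 1.
        rewrite mulrC -ltr_pdivlMr ?addr_gt0// mul1r.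
        by move: e'1 a10; rewrite /a1; clear; lra.
      have c3 : k * ((g + d)^-1 + e') <= (r2 + d) * ((g + d)^-1 + e').
        by rewrite ler_wpM2r ?(ltW c1)// /k /z0; move: s1 s2; clear; lra.
      have := ler_wpM2l kp up; rewrite kB mulrA.
      have := ler_wpM2r (ltW nx) c3; have := c2; rewrite -(ltr_pM2r nx); clear; lra.
    have gd : 0 < g - d by rewrite subr_gt0.
    have rd : 0 < r2 - d by rewrite subr_gt0.
    have c1 : 0 < (g - d)^-1 + e' by rewrite addr_gt0// invr_gt0.
    have c2 : (r2 - d) * ((g - d)^-1 + e') < 1.
      rewrite mulrC -ltr_pdivlMr// mul1r.
      by move: e'2 a20; rewrite /a2; clear; lra.
    have c3 : (- k) * ((g - d)^-1 + e') <= (r2 - d) * ((g - d)^-1 + e').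
      by rewrite ler_wpM2r ?(ltW c1)// /k /z0; move: s1 s2; clear; lra.
    have kn' : 0 <= - k by rewrite oppr_ge0 ltW.
    have kB' : - k * rdot (B t x) x = - rnorm x ^+ 2 by rewrite mulNr kB.
    have := ler_wpM2l kn' lo; rewrite kB'.
    have := ler_wpM2r (ltW nx) c3; have := c2; rewrite -(ltr_pM2r nx); clear; lra.
- by move=> j jm; rewrite du// eqxx mul1r.
- move=> j.
  have [b b0 hb] := bounded_opbound (bS _ rz).
  have claim e' : 0 < e' -> \forall t \near dnear01 t0,
      `|(t - t0)^-1 * (mu t (sg t j) - c0) - rho j| <= e'.
    move=> e'0; pose e1 := Num.min (e' / 2) 1.
    have e10 : 0 < e1 by rewrite lt_min divr_gt0// ltr01.
    have e11 : e1 <= 1 by rewrite ge_min lexx orbT.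
    have e12 : e1 <= e' / 2 by rewrite ge_min lexx.
    have b1 : 0 < b + 1 by rewrite addr_gt0.
    (* The first entry keeps $|(t-t_0)\rho_j|\le h$; the second makes the off-diagonal contribution,
       quadratic in $t-t_0$, at most $|t-t_0|e'/2$. *)
    pose tau := Num.min (h / b) (e' * h / (b + 1) ^+ 2).
    have tau0 : 0 < tau.
      rewrite lt_min (divr_gt0 hp b0); apply: divr_gt0; last exact: exprn_gt0.
      exact: mulr_gt0.
    apply: filterS2 (filterI (near01_dnear01 gnear) (diff _ rz _ e10))
      (filterI (dnear01_neq t0) (dnear01_dist t0 tau0)) => t [gt hq] [tn td].
    pose v := t - t0; have vn : v != 0 by rewrite subr_eq0.
    have vp : 0 < `|v| by rewrite normr_gt0.
    have vt1 : `|v| * b <= h.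
      rewrite -ler_pdivlMr//; apply: le_trans (ltW td) _; by rewrite ge_min lexx.
    have vt2 : `|v| * (b + 1) ^+ 2 <= e' * h.
      rewrite -ler_pdivlMr ?exprn_gt0//; apply: le_trans (ltW td) _.
      by rewrite ge_min lexx orbT.
    pose Q x := (v^-1)%:C%C *: (B t x - B t0 x) - S z0 x.
    have hQ : opbound Q e1 by exact: hq.
    have BQ x y : rdot (B t x) y = rdot (B t0 x) y + v * (rdot (S z0 x) y + rdot (Q x) y).
      by rewrite /Q rdotBl rdotZl rdotBl; field.
    set i := sg t j; have im : (i < m)%N by exact: flip_lt.
    have rhob k : (k < m)%N -> `|rho k| <= b.
      move=> km; have := quad_le (u k) hb; rewrite /rdot du// eqxx mul1r /=.
      by rewrite -rdotxx /rdot ou// eqxx mulr1.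
    have usg : onb m (fun k => u (sg t k)) by exact: onb_flip.
    have spsg x : in_span m (fun k => u (sg t k)) x -> in_span m u x.
      apply: in_span_comb => k km; exists (fun l => (l == sg t k)%:R).
      rewrite /comb (bigD1 (Ordinal (flip_lt t0 t km)))//= eqxx scale1r big1 ?addr0// => l lk.
      by rewrite (_ : (l == _ :> nat) = false) ?scale0r//; apply/negbTE.
    have osg y : orth_to m (fun k => u (sg t k)) y -> orth_to m u y.
      by move=> oy k km; rewrite -(flipK t0 t km); apply: oy; exact: flip_lt.
    have xy0 x y : in_span m u x -> orth_to m u y -> rdot x y = 0.
      by move=> [c ->] oy; rewrite rdotC /rdot orth_comb.
    (* As a form on the span, [B t] is $c_0+v(S+Q)$; [B t0] does not couple the span to its
       complement, so the coupling is at most $|v|(b+1)$. *)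
    have [lo hi] : c0 + v * rho (sg t i) - `|v| * e1 <= mu t i /\
       mu t i <= c0 + v * rho (sg t i) + `|v| * e1
         + (`|v| * (b + 1)) ^+ 2 / (c0 + v * rho (sg t i) + `|v| * e1 - (q0 + h)).
      apply: (minmax_bounds (bB t gt) (sB t gt) (q := q0 + h)
        (nu := fun k => c0 + v * rho (sg t k)) (r := `|v| * e1) (k := `|v| * (b + 1))
        usg (es t gt)) => //.
      - move=> k l kl lm; rewrite lerD2l /sg /flip /v.
        have [tl|tg] := ltrP t t0.
          by rewrite ler_nM2l ?subr_lt0//; apply: rho_mono; rewrite ?leq_sub2l// subnS prednK ?subn_gt0 ?(leq_ltn_trans kl)// leq_subr.
        by apply: ler_wpM2l; [rewrite subr_ge0|exact: rho_mono].
      - move=> k km; have := ler_norm (- (v * rho (sg t k))); rewrite normrN normrM.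
        have := ler_wpM2l (ltW vp) (rhob _ (flip_lt t0 t km)).
        have := mulr_gt0 vp e10; move: vt1 q0c; rewrite /h; clear; lra.
      - by rewrite mulr_ge0// ltW.
      - by rewrite mulr_ge0// ltW.
      - move=> x sx; have sx' := spsg x sx; rewrite BQ quad0//.
        have Sx : rdot (S z0 x) x = \sum_(k < m) rho (sg t k) * cabs '[x, u (sg t k)] ^+ 2.
          have [c xc] := sx; rewrite xc.
          rewrite (@comb_diag _ _ m _ c (S z0) (fun k => rho (sg t k)) (bounded_linear (bS _ rz))).
            by apply: eq_bigr => k _; rewrite dot_comb.
          move=> k l km lm; rewrite du ?flip_lt//; congr ((nat_of_bool _)%:R * _).
          by apply/eqP/eqP => [E|->//]; rewrite -(flipK t0 t km) -/(sg t k) E flipK.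
        have -> : \sum_(k < m) (c0 + v * rho (sg t k)) * cabs '[x, u (sg t k)] ^+ 2
            = c0 * rnorm x ^+ 2 + v * rdot (S z0 x) x.
          rewrite Sx (span_norm usg sx) !mulr_sumr -big_split /=.
          by apply: eq_bigr => k _; ring.
        rewrite mulrDr addrA [_ - _]addrC addKr normrM -mulrA ler_wpM2l//.
        exact: quad_le.
      - move=> x y sx oy; have sx' := spsg x sx; have oy' := osg y oy.
        rewrite BQ B0u// rdotZl xy0// mulr0 add0r.
        apply: le_trans (ler_norm _) _; rewrite normrM -!mulrA ler_wpM2l//.
        apply: le_trans (ler_normD _ _) _.
        have p1 := rdot_abs_le (S z0 x) y; have p2 := rdot_abs_le (Q x) y.
        have p3 := ler_wpM2r (rnorm_ge0 y) (hb x); have p4 := ler_wpM2r (rnorm_ge0 y) (hQ x).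
        have p5 := ler_wpM2r (mulr_ge0 (rnorm_ge0 x) (rnorm_ge0 y)) e11.
        by move: p1 p2 p3 p4 p5; clear; lra.
      - by move=> y oy; apply: upt => //; exact: osg.
    have ij : sg t i = j by exact: flipK.
    rewrite ij in lo hi.
    have rj := rhob j (ltn_ord j).
    have vr : `|v * rho j| <= h by rewrite normrM (le_trans _ vt1)// ler_wpM2l.
    have D : 2 * h <= c0 + v * rho j + `|v| * e1 - (q0 + h).
      move: vr; rewrite ler_norml => /andP[+ _].
      by have := mulr_gt0 vp e10; move: q0c; rewrite /h; clear; lra.
    have D0 : 0 < c0 + v * rho j + `|v| * e1 - (q0 + h).
      by apply: lt_le_trans D; rewrite mulr_gt0.
    have K : (`|v| * (b + 1)) ^+ 2 / (c0 + v * rho j + `|v| * e1 - (q0 + h)) <= `|v| * (e' / 2).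
      rewrite ler_pdivrMr// exprMn expr2 -!mulrA ler_wpM2l//.
      apply: le_trans vt2 _.
      have := ler_wpM2l (ltW e'0) D; clear; lra.
    have -> : (t - t0)^-1 * (mu t i - c0) - rho j = v^-1 * (mu t i - c0 - v * rho j).
      by rewrite -/v; field.
    rewrite normrM normfV ler_pdivrMl// ler_norml.
    by move: lo hi K (mulr_gt0 vp e'0) (ler_wpM2l (ltW vp) e12); clear=> *; apply/andP; split; lra.
  have mcv : mu t (sg t j) @[t --> dnear01 t0] --> c0.
    apply/cvgrPdist_le => e' e'0; pose e1 := Num.min h (e' / 2).
    have e10 : 0 < e1 by rewrite lt_min hp divr_gt0.
    apply: filterS2 (near01_dnear01 gnear) (near01_dnear01 (cont _ rz _ e10)) => t gt [_ he].
    have e1h : e1 <= h by rewrite ge_min lexx.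
    have e12 : e1 <= e' / 2 by rewrite ge_min lexx orbT.
    have := mucont t e1 gt (ltW e10) e1h he _ (flip_lt t0 t (ltn_ord j)).
    by rewrite distrC => /le_trans; apply; move: e12; clear; lra.
  have qcv : (t - t0)^-1 * (mu t (sg t j) - c0) @[t --> dnear01 t0] --> rho j.
    by apply/cvgrPdist_le => e' e'0; apply: filterS (claim e' e'0) => t; rewrite distrC.
  have icv : (mu t (sg t j))^-1 @[t --> dnear01 t0] --> d.
    by rewrite -[d]invrK; apply: cvgV => //; rewrite gt_eqF.
  (* $\lambda-l_0=-d\,\mu^{-1}(\mu-1/d)$, and $\mu^{-1}$ tends to $d$. *)
  have -> : - (d ^+ 2 * rho j) = - (d * (d * rho j)) by rewrite expr2 mulrA.
  apply: cvg_trans (cvgN (cvgM (cvg_cst d) (cvgM icv qcv))).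
  apply: near_eq_cvg.
  apply: filterS2 (near01_dnear01 gnear) (dnear01_neq t0) => t gt tn.
  have mp := mu0 t _ gt (flip_lt t0 t (ltn_ord j)).
  have vn : t - t0 != 0 by rewrite subr_eq0.
  rewrite lam0 /lam -[LHS]/(- (d * ((mu t (sg t j))^-1
    * ((t - t0)^-1 * (mu t (sg t j) - d^-1))))); field.
  by rewrite vn !gt_eqF.
Qed.

(** * Slopes of the eigenvalues in terms of the boundary data *)

Section EigenvalueDerivative.
Variable R : realType.
Local Notation C := R[i].
Variables (H K : hilbertType R) (D : completeNormedModType C).
Variables (iD : D -> H) (Astar : operator H).
Hypotheses (iD_linear : linear iD) (iD_inj : injective iD).
Variable Mi : R.
Hypothesis iD_bound : opbound iD Mi.
Variables (T0 : D -> hprod K K) (Ac0 : operator H) (V0 : H -> H) (X0 Y0 : K -> K).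
Hypothesis bd0 : boundary_data iD Astar T0 Ac0 V0 X0 Y0.
Local Notation H0 := (operator_add Ac0 V0).

Lemma kerlift_eq_iff d psi : dom Ac0 (iD d) ->
  ((T0 d).1 = - badj Y0 psi /\ (T0 d).2 = badj X0 psi) <-> psi = Wop X0 Y0 (T0 d).
Proof.
move=> /(bd_kerlift iD_inj bd0) h; split=> [[h1 h2]|->]; last by rewrite {1 3}h.
have -> : T0 d = kerlift X0 Y0 psi by rewrite [T0 d]surjective_pairing h1 h2.
by rewrite (Wop_kerlift (bd_X bd0) (bd_Y bd0) (bd_inv bd0)).
Qed.

Variables (T' : D -> hprod K K) (V' : H -> H) (X' Y' : K -> K).
Hypotheses (bT' : bounded_operator T') (bV' : bounded_operator V').
Hypotheses (bX' : bounded_operator X') (bY' : bounded_operator Y').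
Hypothesis V'_sym : forall x y, '[V' x, y] = '[x, V' y].

(** $R_0(l_0-d)$ is $1/d$ on the eigenspace, so both arguments of the weak derivative are $u/d$ and
    the factor $d^2$ cancels. The left side is real, so the identity may be conjugated, which moves
    the derivatives of [X], [Y] and [T] to the form required. *)
Lemma eigenvalue_derivative (l0 d rho : R) (u : H) : d != 0 ->
  ~ spectrum H0 (l0 - d)%:C%C -> eigenkernel H0 l0%:C%C u ->
  '[resolvent_dot iD T0 Ac0 V0 X0 Y0 T' V' X' Y' (l0 - d)%:C%C u, u] = rho%:C%C ->
  let uD := unembed iD u in let phi := Wop X0 Y0 (T0 uD) in
  (- (d ^+ 2 * rho))%:C%C
    = '[V' u, u] + '[X0 (badj Y' phi) - Y0 (badj X' phi), phi] + omega (T0 uD) (T' uD).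
Proof.
move=> d0 rw [du eu] hrho uD phi; set w := (l0 - d)%:C%C in rw hrho.
have iu : iD uD = u by exact: (bd_embedK iD_inj bd0 du).
pose c : C := (d^-1)%:C%C; have dc : d%:C%C * c = 1 by rewrite -rmorphM mulfV.
have Ru : resolvent H0 w u = c *: u.
  have hu : H0 u - w *: u = d%:C%C *: u.
    rewrite eu -scalerBl /w -rmorphB; congr (_%:C%C *: _); ring.
  rewrite -[in LHS](scale1r u) -dc mulrC -scalerA -hu.
  have lR := bounded_linear (resolvent_bounded rw).
  by rewrite (linear_mapZ lR) (resolvent_unique rw du).
have uRu : unembed iD (resolvent H0 w u) = c *: uD.
  by rewrite Ru -iu -(linear_mapZ iD_linear) (unembedK iD_inj).
have lT := bounded_linear (bd_T bd0).
have lW := bounded_linear (Wop_bounded (bd_X bd0) (bd_Y bd0) (bd_inv bd0)).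
have WTc : Wop X0 Y0 (T0 (c *: uD)) = c *: phi by rewrite (linear_mapZ lT) (linear_mapZ lW).
have lbX := badj_linear (bd_X bd0); have lbY := badj_linear (bd_Y bd0).
have lX' := bounded_linear bX'; have lY' := bounded_linear bY'.
have lV' := bounded_linear bV'; have lT' := bounded_linear bT'.
pose a := '[X' (badj Y0 phi), phi]; pose b := '[Y' (badj X0 phi), phi].
pose e := '[Jop (T' uD), T0 uD].
have key : rho%:C%C = (c * c) * (- '[V' u, u] + (a - b) + e).
  rewrite -hrho (dot_resolvent_dot iD_linear iD_inj iD_bound bd0 T' V' X' Y' rw).
  rewrite conjR !uRu WTc Ru (linear_mapZ lT) (linear_mapZ lT') (linear_mapZ iD_linear) iu.
  rewrite (linear_mapZ lbX) (linear_mapZ lbY) (linear_mapZ lX') (linear_mapZ lY').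
  rewrite (linear_mapZ lV') -scalerBr !dotZl !dotZr conjR.
  have -> : Jop (c *: T' uD) = c *: Jop (T' uD) by rewrite /Jop /= -scalerN.
  by rewrite dotZl dotBl -/a -/b -/e; ring.
have key2 : (- (d ^+ 2 * rho))%:C%C = '[V' u, u] - (a - b) - e.
  have -> : (- (d ^+ 2 * rho))%:C%C = - (d%:C%C * d%:C%C * rho%:C%C).
    by rewrite rmorphN !rmorphM.
  rewrite key mulrA mulrACA dc mulr1 mul1r; ring.
have ->: '[X0 (badj Y' phi) - Y0 (badj X' phi), phi] = (b - a)^*.
  rewrite dotBl (badjP (bd_X bd0)) (badjP (bd_Y bd0)) -(badjP' bX') -(badjP' bY').
  by rewrite rmorphB /= -!dotC.
have -> : omega (T0 uD) (T' uD) = - e^*.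
  rewrite /omega /e -dotC !hdot_hprod /= dotNl dotNr; ring.
have -> : '[V' u, u] = ('[V' u, u])^* by rewrite -dotC V'_sym.
rewrite -conjR key2 !rmorphB /=; ring.
Qed.

End EigenvalueDerivative.

(** * Limits in the parameter *)

Section ParameterLimits.
Variable R : realType.
Local Notation C := R[i].
Variables (A B : normedModType C) (t0 : R).

Lemma derivative_opbound (f : R -> A -> B) (f' : A -> B) :
  (forall t, t \in `[0, 1] -> linear (f t)) -> t0 \in `[0, 1] -> op_derivative f t0 f' ->
  forall e, 0 < e -> \forall t \near dnear01 t0,
    opbound (fun x => ((t - t0)^-1)%:C%C *: (f t x - f t0 x) - f' x) e.
Proof.
move=> lf t01 [bf' hf]; apply/op_cvgP => //.
apply: filterS (dnear01_in t0) => t tI a x y.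
rewrite (lf _ tI) (lf _ t01) (bounded_linear bf') opprD addrACA -scalerBr scalerDr.
by rewrite opprD addrACA scalerA mulrC -scalerA -scalerBr.
Qed.

Lemma continuous_opbound (F : set_system R) (f : R -> A -> B) : Filter F ->
  (\forall t \near F, linear (f t)) -> linear (f t0) -> op_cvg F f (f t0) ->
  forall e, 0 < e -> \forall t \near F, opbound (fun x => f t x - f t0 x) e.
Proof.
move=> FF lf l0 hf; apply/op_cvgP => //.
apply: filterS lf => t lt a x y.
by rewrite lt l0 opprD addrACA -scalerBr.
Qed.

Lemma derivative_continuous (f : R -> A -> B) (f' : A -> B) :
  (forall t, t \in `[0, 1] -> linear (f t)) -> t0 \in `[0, 1] -> op_derivative f t0 f' ->
  forall e, 0 < e -> \forall t \near near01 t0, opbound (fun x => f t x - f t0 x) e.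
Proof.
move=> lf t01 df e e0; have [M M0 hM] := bounded_opbound (proj1 df).
have hq := derivative_opbound lf t01 df ltr01.
apply: dnear01_near01; last by move=> x; rewrite subrr rnorm0 mulr_ge0 ?rnorm_ge0// ltW.
have M1 : 0 < M + 1 by rewrite addr_gt0.
have d0 : 0 < e / (M + 1) by rewrite divr_gt0.
apply: filterS2 hq (filterI (dnear01_neq t0) (dnear01_dist t0 d0)) => t hq [tn td] x.
have vn : t - t0 != 0 by rewrite subr_eq0.
have := opbound_near hq hM x; rewrite rnormZR normfV ler_pdivrMl ?normr_gt0// => h.
apply: le_trans h _; rewrite mulrA ler_wpM2r ?rnorm_ge0//.
by rewrite -ler_pdivlMr// ltW.
Qed.

End ParameterLimits.

Theorem theorem3p26 (R : realType) (H K : hilbertType R)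
  (sepH : separable H) (sepK : separable K)
  (A : operator H)
  (A_linear : linear_operator A)
  (A_dense : dense (dom A))
  (A_closed : closed_operator A)
  (A_sym : symmetric_operator A)
  (A_defect : deficiency A 'i = deficiency A (- 'i))
  (D : completeNormedModType R[i]) (iD : D -> H)
  (iD_linear : linear iD) (iD_inj : injective iD)
  (iD_dom : range iD `<=` dom (adjoint A))
  (iD_A : dom A `<=` range iD)
  (iD_bounded :
    bounded_operator ((fun u => (iD u, adjoint A (iD u))) : D -> hprod H H))
  (iD_dense : graph (adjoint A) `<=`
    closure (range ((fun u => (iD u, adjoint A (iD u))) : D -> hprod H H)))
  (T : R -> D -> hprod K K)
  (T_bounded : forall t : R, t \in `[0, 1] -> bounded_operator (T t))
  (T_dense : forall t : R, t \in `[0, 1] -> dense (range (T t)))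
  (T_green : forall t : R, t \in `[0, 1] -> forall u v : D,
    '[adjoint A (iD u), iD v] - '[iD u, adjoint A (iD v)]
    = '[(T t u).2, (T t v).1] - '[(T t u).1, (T t v).2])
  (Q : R -> hprod K K -> hprod K K)
  (Q_proj : forall t : R, t \in `[0, 1] -> orthogonal_projection (Q t))
  (Q_lagr : forall t : R, t \in `[0, 1] -> lagrangian (range (Q t)))
  (Ac : R -> operator H)
  (Ac_sa : forall t : R, t \in `[0, 1] -> selfadjoint (Ac t))
  (Ac_ext : forall t : R, t \in `[0, 1] -> extends (Ac t) A)
  (Ac_dom : forall t : R, t \in `[0, 1] -> dom (Ac t) `<=` range iD)
  (V : R -> H -> H)
  (V_bounded : forall t : R, t \in `[0, 1] -> bounded_operator (V t))
  (V_sa : forall t : R, t \in `[0, 1] -> forall u v, '[V t u, v] = '[u, V t v])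
  (X Y : R -> K -> K)
  (X_bounded : forall t : R, t \in `[0, 1] -> bounded_operator (X t))
  (Y_bounded : forall t : R, t \in `[0, 1] -> bounded_operator (Y t))
  (Ac_bc : forall t : R, t \in `[0, 1] ->
    dom (Ac t) = iD @` [set u | row_op (X t) (Y t) (T t u) = 0])
  (T_ran : forall t : R, t \in `[0, 1] ->
    closure (T t @` (iD @^-1` dom (Ac t))) = range (Q t))
  (Q_ker : forall t : R, t \in `[0, 1] ->
    range (Q t) = [set f | row_op (X t) (Y t) f = 0])
  (XY_sym : forall t : R, t \in `[0, 1] -> forall x,
    X t (badj (Y t) x) = Y t (badj (X t) x))
  (XY_spec : forall t : R, t \in `[0, 1] ->
    ~ spectrum (total_operator (block_op (X t) (Y t))) 0) :
  let Hm (t : R) := operator_add (Ac t) (V t) in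
  let Rs (t : R) (z : R[i]) := resolvent (Hm t) z in
  let RD (t : R) (z : R[i]) (h : H) := unembed iD (Rs t z h) in
  let TR (t : R) (z : R[i]) (h : H) := T t (RD t z h) in
  let W (t : R) := Wop (X t) (Y t) in
  let Z (t s : R) := Zop (X t) (Y t) (X s) (Y s) in
  let AR (t : R) (h : H) := unembed iD (resolvent (Ac t) 'i h) in
  (forall s t : R, s \in `[0, 1] -> t \in `[0, 1] -> forall z : R[i],
    ~ (spectrum (Hm t) `|` spectrum (Hm s)) z ->
    bounded_operator (Z t s) /\
    forall h : H,
      Rs t z h - Rs s z h
      = Rs t z (V s (Rs s z h) - V t (Rs s z h))
        + badj (TR t z^*) (Z t s (TR s z h))
        + badj (TR t z^*) (Jop (T t (RD s z h) - T s (RD s z h))))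
  /\
  (forall t0 : R, t0 \in `[0, 1] ->
    ((exists M : R, \forall t \near near01 t0, (opnorm (AR t) <= M%:E)%E) ->
     op_continuous T t0 -> op_continuous V t0 ->
     op_continuous X t0 -> op_continuous Y t0 ->
     forall z0 : R[i], ~ spectrum (Hm t0) z0 ->
       (\forall t \near near01 t0, ~ spectrum (Hm t) z0) /\
       op_continuous (fun t => Rs t z0) t0)
    /\
    (forall (T' : D -> hprod K K) (V' : H -> H) (X' Y' : K -> K),
     op_cvg (near01 t0) AR (AR t0) ->
     op_derivative T t0 T' -> op_derivative V t0 V' ->
     op_derivative X t0 X' -> op_derivative Y t0 Y' ->
     (forall z0 : R[i], ~ spectrum (Hm t0) z0 ->
       (\forall t \near near01 t0, ~ spectrum (Hm t) z0) /\
       op_derivative (fun t => Rs t z0) t0 (fun h =>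
         - Rs t0 z0 (V' (Rs t0 z0 h))
         + badj (TR t0 z0^*) (badj (W t0)
             (X' (badj (Y t0) (W t0 (TR t0 z0 h)))
              - Y' (badj (X t0) (W t0 (TR t0 z0 h)))))
         + badj (TR t0 z0^*) (Jop (T' (RD t0 z0 h)))))
     /\
     (forall (l0 : R) (m : nat), (1 <= m)%N ->
       isolated_eigenvalue (Hm t0) l0 m ->
       exists (u : 'I_m -> H) (lam : 'I_m -> R -> R) (lam' : 'I_m -> R),
       [/\ forall j, eigenkernel (Hm t0) l0%:C%C (u j),
           forall j k, '[u j, u k] = (j == k)%:R,
           bifurcating Hm t0 l0 lam
         & forall j, let uD := unembed iD (u j) in let phi := W t0 (T t0 uD) in
           [/\ (t - t0)^-1 * (lam j t - lam j t0) @[t --> dnear01 t0]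
                 --> lam' j,
               (lam' j)%:C%C
               = '[V' (u j), u j]
                 + '[X t0 (badj Y' phi) - Y t0 (badj X' phi), phi]
                 + omega (T t0 uD) (T' uD)
             & forall psi : K,
                 ((T t0 uD).1 = - badj (Y t0) psi
                  /\ (T t0 uD).2 = badj (X t0) psi)
                 <-> psi = phi]]))).
Proof.
move=> Hm Rs RD TR W Z AR.
have [Mi Mi0 iD_bnd] : exists2 Mi, 0 <= Mi & opbound iD Mi.
  have [_ [M M0 hM]] := (bounded_operatorP _).1 iD_bounded.
  by exists M => // u; apply: le_trans (hM u); exact: (@rnorm_fst R H H (iD u, _)).
have bd t : t \in `[0, 1] -> boundary_data iD (adjoint A) (T t) (Ac t) (V t) (X t) (Y t).
  move=> tI; have sa := selfadjoint_hermitian (Ac_sa t tI); split.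
  - exact: T_bounded.
  - by move=> u v; rewrite (T_green t tI) hdot_hprod /Jop /= dotNl.
  - exact: sa.
  (* $A^*$ agrees with $\mathcal A_t$ on the domain of the latter, because $\mathcal A_t$ is
     symmetric and extends $A$; density of [dom A] makes the value chosen in [adjoint] unique. *)
  - move=> u du; apply: (dense_dot_inj A_dense) => w dw.
    have rep : forall w, dom A w -> '[A w, u] = '[w, Ac t u].
      move=> w' dw'; have [dAc <-] := Ac_ext t tI w' dw'.
      by case: sa => _ sym _; exact: sym.
    rewrite -rep// .
    have ex : exists x, [set x | forall u', dom A u' -> '[A u', u] = '[u', x]] x.
      by exists (Ac t u).
    by rewrite -(xgetPex 0 ex).
  - exact: Ac_bc.
  - exact: V_bounded.
  - exact: V_sa.
  - exact: X_bounded.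
  - exact: Y_bounded.
  - exact: XY_sym.
  - exact: XY_spec.
have lAR t : t \in `[0, 1] -> linear (AR t).
  move=> tI; exact: (unembed_resolvent_linear (B := Ac t) iD_linear iD_inj (bd t tI) erefl
    (resolvent_set_i (bd_hermitian (bd t tI)))).
have bAR t : t \in `[0, 1] -> bounded_operator (AR t).
  move=> tI; exact: (unembed_resolvent_bounded (B := Ac t) iD_linear iD_inj (bd t tI) erefl
    (resolvent_set_i (bd_hermitian (bd t tI))) iD_bnd).
have bW t : t \in `[0, 1] -> bounded_operator (W t).
  by move=> tI; exact: (Wop_bounded (X_bounded t tI) (Y_bounded t tI) (XY_spec t tI)).
have hHm t : t \in `[0, 1] -> hermitian_op (Hm t).
  by move=> tI; exact: (bd_hermitian_add (bd t tI)).
have lT t : t \in `[0, 1] -> linear (T t) by move=> tI; exact: (bounded_linear (T_bounded t tI)).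
have lV t : t \in `[0, 1] -> linear (V t) by move=> tI; exact: (bounded_linear (V_bounded t tI)).
have lX t : t \in `[0, 1] -> linear (X t) by move=> tI; exact: (bounded_linear (X_bounded t tI)).
have lY t : t \in `[0, 1] -> linear (Y t) by move=> tI; exact: (bounded_linear (Y_bounded t tI)).
split.
  move=> s t sI tI z hz.
  have rt : ~ spectrum (Hm t) z by move=> h; apply: hz; left.
  have rs : ~ spectrum (Hm s) z by move=> h; apply: hz; right.
  split; last by move=> h; exact: (krein_formula iD_linear iD_inj (bd t tI) (bd s sI) iD_bnd rt rs).
  by apply: Zop_bounded; [exact: X_bounded|exact: Y_bounded|exact: X_bounded
    |exact: Y_bounded|exact: bW|exact: bW].
move=> t0 tI0; have bd0 := bd t0 tI0.
have near_lin (A' B' : normedModType R[i]) (f : R -> A' -> B') :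
    (forall t, t \in `[0, 1] -> linear (f t)) -> \forall t \near near01 t0, linear (f t).
  by move=> lf; apply: filterS (near01_in t0) => t tI; exact: lf.
(* Shared by the continuous and the differentiable case, which differ in how the bound [M] and the
   closeness of the data are obtained. *)
have resolvent_continuous M z : 0 <= M -> ~ spectrum (Hm t0) z ->
    (\forall t \near near01 t0, opbound (AR t) M) ->
    (forall e, 0 < e -> \forall t \near near01 t0,
      close_data (T t0) (V t0) (X t0) (Y t0) e (T t) (V t) (X t) (Y t)) ->
    forall e, 0 < e -> \forall t \near near01 t0, ~ spectrum (Hm t) z /\
      opbound (fun h => Rs t z h - Rs t0 z h) e.
  move=> M0 rz hAR hcd e e0.
  have [e1 [k [e10 k0 hk]]] := resolvent_near iD_linear iD_inj Mi0 iD_bnd bd0 M0 rz.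
  have k1 : 0 < k + 1 by rewrite ltr_wpDl.
  pose e' := Num.min e1 (e / (k + 1)).
  have e'0 : 0 < e' by rewrite lt_min e10 divr_gt0.
  apply: filterS2 hAR (filterI (hcd e' e'0) (near01_in t0)) => t ha [hc tI].
  have e'1 : e' <= e1 by rewrite ge_min lexx.
  have [rt hR] := hk _ _ _ _ _ e' (bd t tI) (ltW e'0) e'1 hc ha; split=> //.
  apply: opboundW hR; have e'2 : e' <= e / (k + 1) by rewrite ge_min lexx orbT.
  apply: le_trans (ler_wpM2r k0 e'2) _.
  by rewrite -mulrA ler_piMr ?(ltW e0)// mulrC ler_pdivrMr// mul1r lerDl.
split.
  move=> [M hM] cT cV cX cY z rz.
  have hAR : \forall t \near near01 t0, opbound (AR t) (Num.max M 0).
    apply: filterS2 hM (near01_in t0) => t hM tI.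
    apply/opnorm_le; [exact: lAR|by rewrite le_max lexx orbT|].
    by apply: le_trans hM _; rewrite lee_fin le_max lexx.
  have M0 : 0 <= Num.max M 0 by rewrite le_max lexx orbT.
  have hcd e : 0 < e -> \forall t \near near01 t0,
      close_data (T t0) (V t0) (X t0) (Y t0) e (T t) (V t) (X t) (Y t).
    move=> e0.
    have h1 := continuous_opbound (near01_filter t0) (near_lin _ _ _ lT) (lT _ tI0) cT e0.
    have h2 := continuous_opbound (near01_filter t0) (near_lin _ _ _ lV) (lV _ tI0) cV e0.
    have h3 := continuous_opbound (near01_filter t0) (near_lin _ _ _ lX) (lX _ tI0) cX e0.
    have h4 := continuous_opbound (near01_filter t0) (near_lin _ _ _ lY) (lY _ tI0) cY e0.
    by apply: filterS2 (filterI h1 h2) (filterI h3 h4) => t [? ?] [? ?]; split.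
  have main := resolvent_continuous _ z M0 rz hAR hcd.
  split; first by apply: filterS (main 1 ltr01) => t [].
  apply/op_cvgP; last by move=> e e0; apply: filterS (main e e0) => t [].
  apply: filterS (main 1 ltr01) => t [rt _].
  by apply/bounded_linear/bounded_sub; exact: resolvent_bounded.
move=> T' V' X' Y' cAR dT dV dX dY.
have [bT' bV' bX' bY'] : [/\ bounded_operator T', bounded_operator V',
    bounded_operator X' & bounded_operator Y'] by split; [case: dT|case: dV|case: dX|case: dY].
have hARe := continuous_opbound (near01_filter t0) (near_lin _ _ _ lAR) (lAR _ tI0) cAR.
(* Convergence of [AR t] in the operator norm gives the uniform bound [M + 1] near [t0]. *)
have [M M0 hM] := bounded_opbound (bAR t0 tI0).
have M10 : 0 <= M + 1 by rewrite addr_ge0// ltW.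
have hAR : \forall t \near near01 t0, opbound (AR t) (M + 1).
  by apply: filterS (hARe 1 ltr01) => t h; exact: opbound_near h hM.
have hcd e : 0 < e -> \forall t \near near01 t0,
    close_data (T t0) (V t0) (X t0) (Y t0) e (T t) (V t) (X t) (Y t).
  move=> e0.
  have h1 := derivative_continuous lT tI0 dT e0.
  have h2 := derivative_continuous lV tI0 dV e0.
  have h3 := derivative_continuous lX tI0 dX e0.
  have h4 := derivative_continuous lY tI0 dY e0.
  by apply: filterS2 (filterI h1 h2) (filterI h3 h4) => t [? ?] [? ?]; split.
have rcont z (rz : ~ spectrum (Hm t0) z) := resolvent_continuous _ z M10 rz hAR hcd.
pose R' z := resolvent_dot iD (T t0) (Ac t0) (V t0) (X t0) (Y t0) T' V' X' Y' z.
have bR' z : ~ spectrum (Hm t0) z -> bounded_operator (R' z).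
  by move=> rz; exact: (resolvent_dot_bounded iD_linear iD_inj iD_bnd bd0 bT' bV' bX' bY' rz).
have rdiff z : ~ spectrum (Hm t0) z -> forall e, 0 < e -> \forall t \near dnear01 t0,
    opbound (fun h => ((t - t0)^-1)%:C%C *: (Rs t z h - Rs t0 z h) - R' z h) e.
  move=> rz e e0.
  have [e1 [k [e10 k0 hk]]] := resolvent_derivative iD_linear iD_inj Mi0 iD_bnd bd0
    bT' bV' bX' bY' rz M10.
  have k1 : 0 < k + 1 by rewrite ltr_wpDl.
  pose e' := Num.min e1 (e / (k + 1)).
  have e'0 : 0 < e' by rewrite lt_min e10 divr_gt0.
  have q1 := derivative_opbound lT tI0 dT e'0.
  have q2 := derivative_opbound lV tI0 dV e'0.
  have q3 := derivative_opbound lX tI0 dX e'0.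
  have q4 := derivative_opbound lY tI0 dY e'0.
  have n1 := near01_dnear01 (hcd e' e'0).
  have n2 := near01_dnear01 hAR.
  have n3 := near01_dnear01 (hARe e' e'0).
  apply: filterS2 (filterI (filterI n1 (filterI n2 n3)) (dnear01_in t0))
    (filterI (filterI q1 q2) (filterI q3 q4)).
  move=> t [[hc [ha hae]] tI] [[qT qV] [qX qY]].
  have e'1 : e' <= e1 by rewrite ge_min lexx.
  have := hk _ _ _ _ _ e' _ (bd t tI) (ltW e'0) e'1 hc ha hae qT qV qX qY.
  apply: opboundW; have e'2 : e' <= e / (k + 1) by rewrite ge_min lexx orbT.
  apply: le_trans (ler_wpM2r k0 e'2) _.
  by rewrite -mulrA ler_piMr ?(ltW e0)// mulrC ler_pdivrMr// mul1r lerDl.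
split.
  move=> z rz; split; first by apply: filterS (rcont z rz 1 ltr01) => t [].
  split; first exact: bR'.
  apply/op_cvgP; last exact: rdiff.
  apply: filterS (near01_dnear01 (rcont z rz 1 ltr01)) => t [rt _].
  apply/bounded_linear/bounded_sub; last exact: (bR' z rz).
  by apply: bounded_scale; apply: bounded_sub; exact: resolvent_bounded.
move=> l0 m m1 iso.
have [d [u [lam [rho [[d0 rd] [ou ku] bif Srho lamd]]]]] :=
  bifurcating_eigenvalues (S := fun s => R' s%:C%C) tI0 hHm
    (fun s rs => rcont _ rs) (fun s rs => bR' _ rs) (fun s rs => rdiff _ rs) iso.
exists (fun j => u j), lam, (fun j => - (d ^+ 2 * rho j)); split=> //.
- by move=> j; exact: ku.
- by move=> j k; rewrite ou.
- move=> j uD phi; have [du eu] := ku j (ltn_ord j); split; first exact: lamd.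
    apply: (eigenvalue_derivative iD_linear iD_inj iD_bnd bd0 bT' bV' bX' bY' _
      (lt0r_neq0 d0) rd (ku j (ltn_ord j)) (Srho j (ltn_ord j))).
    apply: (limit_symmetric (dnear01_filter t0) _ _ (derivative_opbound lV tI0 dV)).
      by move=> P; exact: dnear01_ex.
    apply: filterS (dnear01_in t0) => t tI x y.
    by rewrite dotZl dotZr conjR dotBl dotBr !V_sa.
  move=> psi; apply: (kerlift_eq_iff iD_inj bd0).
  by rewrite (bd_embedK iD_inj bd0 du).
Qed.
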